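(* Let $K\ge0$, let $X$ be a two-dimensional Alexandrov space of curvature bounded below by $K$ which is homeomorphic to the closed unit disk, and let $\gamma=\partial X$, assumed rectifiable. Let $\kappa\ge0$. Then $\underline\chi_\gamma(q)\ge\kappa$ for almost every $q\in\gamma$ if and only if $\chi_{\gamma,K}\ge\kappa$ globally.
   Context: $S_K$: model surface of constant curvature $K$ (sphere of radius $1/\sqrt K$ if $K>0$, plane if $K=0$). For three points $a,b,c$ of $X$ with a comparison triangle in $S_K$, $\chi_K(a,b,c)$ is the $\kappa'\ge0$ such that the comparison triangle's vertices lie on a circle in $S_K$ of constant geodesic curvature $\kappa'$. $\underline\chi_\gamma(q)=\liminf\chi_K(a,q,c)$ as $a,c\to q$ along $\gamma$ from opposite sides of $q$. ''$\chi_{\gamma,K}\ge\kappa$ globally'' means $\chi_K(p,q,m)\ge\kappa$ for all $p,q,m\in\gamma$ whose triangle has perimeter at most $2\pi/\sqrt K$ when $K>0$. *)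

(* Defs.v *)
From mathcomp Require Import all_boot all_order all_algebra.
From mathcomp Require Import all_classical all_reals all_analysis.
Set Implicit Arguments. Unset Strict Implicit. Unset Printing Implicit Defensive.
Import Order.TTheory GRing.Theory Num.Theory.
Local Open Scope ring_scope.
Local Open Scope classical_set_scope.

Section Defs.
Variable R : realType.

Definition is_metric (X : Type) (d : X -> X -> R) : Prop :=
  [/\ (forall x y, 0 <= d x y),
      (forall x y, d x y = 0 <-> x = y),
      (forall x y, d x y = d y x) &
      (forall x y z, d x z <= d x y + d y z)].

(** Existence of midpoints; for complete (here: compact) spaces this is
    equivalent to being a geodesic (= complete length) space. *)
Definition has_midpoints (X : Type) (d : X -> X -> R) : Prop :=
  forall x y : X, exists m, d x m = d x y / 2 /\ d m y = d x y / 2.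

(** ** The model surface S_K (K >= 0)
    [model_dist K a b c t]: in a comparison triangle p~ x~ y~ in S_K with
    |p~x~| = a, |p~y~| = b, |x~y~| = c, the distance from p~ to the point z~
    of the side x~y~ with |x~z~| = t.  (Euclidean Stewart formula for K = 0,
    spherical Stewart formula on the sphere of radius 1/sqrt K for K > 0.) *)
Definition model_dist (K a b c t : R) : R :=
  if K == 0 then Num.sqrt (((c - t) * a ^+ 2 + t * b ^+ 2) / c - t * (c - t))
  else acos ((cos (Num.sqrt K * a) * sin (Num.sqrt K * (c - t))
              + cos (Num.sqrt K * b) * sin (Num.sqrt K * t))
             / sin (Num.sqrt K * c)) / Num.sqrt K.

(** Curvature >= K in the sense of Alexandrov (triangle comparison):
    for every geodesic triangle p x y (perimeter < 2 pi / sqrt K if K > 0)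
    and every point z on a shortest path from x to y
    (i.e. d x z + d z y = d x y), d p z is at least the corresponding
    distance in the comparison triangle in S_K. *)
Definition curv_ge (X : Type) (d : X -> X -> R) (K : R) : Prop :=
  forall p x y z : X,
    (0 < K -> d p x + d x y + d y p < 2 * pi / Num.sqrt K) ->
    0 < d x y -> d x z + d z y = d x y ->
    model_dist K (d p x) (d p y) (d x y) (d x z) <= d p z.

(** Alexandrov space of curvature >= K (completeness and finite
    dimension are automatic in the theorem below, since X is assumed
    homeomorphic to the closed disk, hence compact of dimension 2). *)
Definition alexandrov (X : Type) (d : X -> X -> R) (K : R) : Prop :=
  [/\ is_metric d, has_midpoints d & curv_ge d K].

Definition edist (z w : R * R) : R :=
  Num.sqrt ((z.1 - w.1) ^+ 2 + (z.2 - w.2) ^+ 2).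
Definition cdisk : set (R * R) := [set z | z.1 ^+ 2 + z.2 ^+ 2 <= 1].
Definition ucircle : set (R * R) := [set z | z.1 ^+ 2 + z.2 ^+ 2 = 1].

Definition homeo_disk (X : Type) (d : X -> X -> R) (h : R * R -> X) : Prop :=
  [/\ (forall z w, cdisk z -> cdisk w -> h z = h w -> z = w),
      (forall x : X, exists2 z, cdisk z & h z = x),
      (forall z, cdisk z -> forall e, 0 < e -> exists2 del, 0 < del &
         forall w, cdisk w -> edist z w < del -> d (h z) (h w) < e) &
      (forall z, cdisk z -> forall e, 0 < e -> exists2 del, 0 < del &
         forall w, cdisk w -> d (h z) (h w) < del -> edist z w < e)].

Definition poly_length (X : Type) (d : X -> X -> R) (c : R -> X) (p : seq R) : R :=
  \sum_(i < (size p).-1) d (c (nth 0 p i)) (c (nth 0 p i.+1)).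

Definition partition (a b : R) (p : seq R) : Prop :=
  [/\ (0 < size p)%N, sorted <=%R p, nth 0 p 0 = a & nth 0 p (size p).-1 = b].

Definition curve_length_is (X : Type) (d : X -> X -> R) (c : R -> X) (a b l : R) : Prop :=
  (forall p, partition a b p -> poly_length d c p <= l) /\
  (forall e, 0 < e -> exists2 p, partition a b p & l - e < poly_length d c p).

Definition rectifiable_boundary (X : Type) (d : X -> X -> R) (h : R * R -> X) : Prop :=
  exists M : R, forall p, partition 0 (2 * pi) p ->
    poly_length d (fun th => h (cos th, sin th)) p <= M.

Definition arclength_param (X : Type) (d : X -> X -> R) (B : set X)
  (L : R) (sigma : R -> X) : Prop :=
  [/\ 0 < L,
      (forall t, sigma (t + L) = sigma t),
      (forall s t, 0 <= s -> s < L -> 0 <= t -> t < L -> sigma s = sigma t -> s = t),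
      range sigma = B &
      (forall s t, s <= t -> curve_length_is d sigma s t (t - s))].

(** ** chi_K
    For a comparison triangle in S_K with side lengths a, b, c, its vertices
    lie on a circle of geodesic curvature
       kappa' = sqrt (1 / s^2 - K),
    where s is the (Euclidean) circumradius of the triangle formed by the
    chords (in the plane for K = 0, resp. in R^3 for the sphere of radius
    1/sqrt K, whose chords have length 2/sqrt K * sin (sqrt K * a / 2)).
    For K = 0 this is 1/s; for K > 0 a circle with Euclidean radius s on
    the sphere of radius rho = 1/sqrt K has geodesic curvature
    sqrt(rho^2 - s^2)/(rho s) = sqrt(1/s^2 - K).
    By Heron, 1/s^2 = H / (A B C)^2 with
    H = (A+B+C)(-A+B+C)(A-B+C)(A+B-C) (= 16 area^2).
    Collinear / great-circle configurations give 0. *)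
Definition chord (K a : R) : R :=
  if K == 0 then a else 2 / Num.sqrt K * sin (Num.sqrt K * a / 2).

Definition circ_curv (K a b c : R) : R :=
  let A := chord K a in let B := chord K b in let C := chord K c in
  Num.sqrt ((A + B + C) * (- A + B + C) * (A - B + C) * (A + B - C)
            / (A * B * C) ^+ 2 - K).

Definition chiK (X : Type) (d : X -> X -> R) (K : R) (a q c : X) : R :=
  circ_curv K (d a q) (d q c) (d c a).

Definition lower_chi_ge (X : Type) (d : X -> X -> R) (K : R) (sigma : R -> X)
  (t kappa : R) : Prop :=
  forall e, 0 < e -> exists2 del, 0 < del &
    forall s u, t - del < s -> s < t -> t < u -> u < t + del ->
      kappa - e <= chiK d K (sigma s) (sigma t) (sigma u).

Definition global_chi_ge (X : Type) (d : X -> X -> R) (K : R) (B : set X)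
  (kappa : R) : Prop :=
  forall p q m, B p -> B q -> B m -> p <> q -> q <> m -> p <> m ->
    (0 < K -> d p q + d q m + d m p <= 2 * pi / Num.sqrt K) ->
    kappa <= chiK d K p q m.

End Defs.

(* Main.v *)
Require Import Defs.
From mathcomp Require Import all_boot all_order all_algebra.
From mathcomp Require Import all_classical all_reals all_analysis.
From mathcomp Require Import ring lra.
Set Implicit Arguments. Unset Strict Implicit. Unset Printing Implicit Defensive.
Import Order.TTheory GRing.Theory Num.Theory numFieldNormedType.Exports.
Local Open Scope ring_scope.
Local Open Scope classical_set_scope.

(** Put [Y x y := chord (d x y) ^ 2 / 2].  In these coordinates the law of cosines on
    [S_K] is polynomial, and with [Del K a b c] the corresponding Heron polynomial
    [chi_K ^ 2 = Del K a b c / (2 a b c)], so that [chi_K >= kappa] reads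
    [Del (K + kappa ^ 2) a b c >= 0].

    Two shortest paths that join interlaced pairs of boundary points meet (a winding
    number argument), and comparison at the meeting point shows that comparison angles
    at a boundary point are superadditive along the boundary.  Fix a boundary point [p]
    and run along the boundary through points [x_0, x_1, ...]: superadditivity bounds the
    turn of the comparison triangles [p x_i x_(i+1)] below by the turn of
    [x_(i-1) x_i x_(i+1)], which is at least [k] times the step at almost every point, for
    every [k < kappa].  Hence [S sin theta - k Y] (the value for a circle of curvature [k]
    being 0) cannot drop below 0 by more than an error that vanishes with the mesh; bad
    points contribute little since they have measure 0.  In the limit the chord [p x] makes
    with the boundary an angle at least the one in a circle of curvature [kappa].  At the
    vertex opposite to the longest side of a triangle the two angles with the boundary and
    the comparison angle add up to at most [pi], which is [Del (K + kappa ^ 2) >= 0]. *)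

(** * The model surface *)

(** The quantity [S sin theta - k Y] comes from Clairaut's relation. Rotation about [p] is an
    isometry of [S_K], so along a curve of geodesic curvature [g] the derivative of
    [sn r * sin theta] is [g * sn r * cos theta], while that of [md r] is [sn r * cos theta]; the
    difference grows as long as [g >= k] and [cos theta >= 0]. Once [theta] is obtuse this is lost,
    but then the distance to [p] shrinks, and [Sy y - k * y], the value for a right angle, stays
    nonnegative as [y] decreases. The boundary has no tangent, so this is done for comparison
    triangles of mesh [e], with an error of order [e ^ 2] at each step and of order [e] at a bad
    one. For [K > 0] the run needs distances below [pi / sqrt K], which is not assumed: the run
    itself gives that bound, through the first time a distance reaches a value above the diameter of
    a circle of positive curvature. A perimeter of exactly [2 * pi / sqrt K] turns out not to occur.
    The estimates are made for [k < kappa], since [kappa] bounds [chi] only as a lower limit; the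
    margin is removed at the end. *)

Section Model.
Variables (R : realType) (K : R).
Hypothesis K_ge0 : 0 <= K.
Local Notation sK := (Num.sqrt K).

(* The generalized sine; the generalized versine [(1 - cos (sK * r)) / K] is [md]. *)
Definition sn (r : R) : R := if K == 0 then r else sin (sK * r) / sK.
Definition md (r : R) : R := chord K r ^+ 2 / 2.

Lemma sqrtK2 : sK ^+ 2 = K. Proof. exact: sqr_sqrtr. Qed.

Lemma sqrtK_gt0 : K != 0 -> 0 < sK.
Proof. by move=> K0; rewrite sqrtr_gt0 lt_neqAle eq_sym K0. Qed.

Lemma mdE (r : R) : md r = if K == 0 then r ^+ 2 / 2 else (1 - cos (sK * r)) / K.
Proof.
rewrite /md /chord; case: eqP => // /eqP K0.
have s0 := sqrtK_gt0 K0; have s1 : sK != 0 by rewrite gt_eqF.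
have -> : cos (sK * r) = 1 - 2 * sin (sK * r / 2) ^+ 2.
  rewrite [in LHS](_ : sK * r = (sK * r / 2) *+ 2) ?cos_mulr2n ?cos2sin2; first ring.
  by rewrite -mulr_natr divfK.
move: (sK) sqrtK2 s1 => s Ks s1; rewrite -Ks; by field.
Qed.

Lemma md_add (a b : R) : md (a + b) = md a + md b - K * md a * md b + sn a * sn b.
Proof.
rewrite !mdE /sn; case: eqP => [->|/eqP K0]; first by field.
have s1 : sK != 0 by rewrite gt_eqF ?sqrtK_gt0.
rewrite mulrDr cosD; move: (sK) sqrtK2 s1 => s Ks s1; rewrite -Ks; by field.
Qed.

Lemma sn_add (a b : R) : sn (a + b) = sn a * (1 - K * md b) + (1 - K * md a) * sn b.
Proof.
rewrite !mdE /sn; case: eqP => [->|/eqP K0]; first by field.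
have s1 : sK != 0 by rewrite gt_eqF ?sqrtK_gt0.
rewrite mulrDr sinD; field; by rewrite s1 K0.
Qed.

Lemma sn_sqr (a : R) : sn a ^+ 2 = 2 * md a - K * md a ^+ 2.
Proof.
rewrite !mdE /sn; case: eqP => [->|/eqP K0]; first by field.
have s1 : sK != 0 by rewrite gt_eqF ?sqrtK_gt0.
rewrite exprMn sin2cos2 exprVn sqrtK2; by field.
Qed.

Lemma md0 : md 0 = 0.
Proof. by rewrite mdE mulr0 cos0; case: eqP => _; ring. Qed.

Lemma mdN (a : R) : md (- a) = md a.
Proof. by rewrite !mdE mulrN cosN; case: eqP => _ //; ring. Qed.

Lemma snN (a : R) : sn (- a) = - sn a.
Proof. by rewrite /sn mulrN sinN; case: eqP => _ //; ring. Qed.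

Lemma md_sub (a b : R) : md (a - b) = md a + md b - K * md a * md b - sn a * sn b.
Proof. by rewrite md_add mdN snN mulrN. Qed.

Lemma md_ge0 (a : R) : 0 <= md a.
Proof. by rewrite /md divr_ge0 // sqr_ge0. Qed.

Lemma md_le2 (a : R) : K * md a <= 2.
Proof.
rewrite mdE; case: eqP => [->|/eqP K0]; first by rewrite mul0r.
rewrite mulrC divfK //; have := cos_geN1 (sK * a); lra.
Qed.

Lemma sn_ge0 (a : R) : 0 <= a -> sK * a <= pi -> 0 <= sn a.
Proof.
move=> a0 ap; rewrite /sn; case: eqP => // /eqP K0.
by rewrite divr_ge0 ?sqrtr_ge0 // sin_ge0_pi // ap mulr_ge0 // sqrtr_ge0.
Qed.

Lemma sn_gt0 (a : R) : 0 < a -> sK * a < pi -> 0 < sn a.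
Proof.
move=> a0 ap; rewrite /sn; case: eqP => // /eqP K0.
by rewrite divr_gt0 ?sqrtK_gt0 // sin_gt0_pi // ap mulr_gt0 ?sqrtK_gt0.
Qed.

Lemma md_lt (a b : R) : 0 <= a -> a < b -> sK * b <= pi -> md a < md b.
Proof.
move=> a0 ab bp; rewrite !mdE; case: eqP => [_|/eqP K0].
  by rewrite ltr_pM2r ?invr_gt0 // ltrXn2r // ?(le_trans a0) // ltW.
have Kp : 0 < K by rewrite lt_neqAle eq_sym K0.
rewrite ltr_pM2r ?invr_gt0 // ltrD2l ltrN2 ltr_cos ?ltr_pM2l ?sqrtK_gt0 //.
- by rewrite in_itv /= (le_trans _ bp) ?mulr_ge0 ?sqrtr_ge0 // ler_wpM2l ?sqrtr_ge0 // ltW.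
- by rewrite in_itv /= bp mulr_ge0 ?sqrtr_ge0 // (le_trans a0) // ltW.
Qed.

Lemma md_le (a b : R) : 0 <= a -> a <= b -> sK * b <= pi -> md a <= md b.
Proof.
move=> a0; rewrite le_eqVlt => /orP[/eqP -> //|ab] bp; exact/ltW/md_lt.
Qed.

Lemma md_gt0 (a : R) : 0 < a -> sK * a <= pi -> 0 < md a.
Proof. by move=> a0 ap; rewrite -md0 md_lt. Qed.

Lemma md_le_inv (a b : R) : 0 <= b -> sK * a <= pi -> md a <= md b -> a <= b.
Proof. by move=> b0 ap; apply: contraTT; rewrite -!ltNge => ba; rewrite md_lt. Qed.

Lemma md_lt_inv (a b : R) : 0 <= b -> sK * a <= pi -> md a < md b -> a < b.
Proof. by move=> b0 ap; apply: contraTT; rewrite -!leNgt => ba; rewrite md_le. Qed.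

Lemma md_surj (y : R) : 0 <= y -> K * y <= 2 ->
  exists r, [/\ 0 <= r, sK * r <= pi & md r = y].
Proof.
move=> y0 y2; case: (eqVneq K 0) => K0.
  exists (Num.sqrt (2 * y)); split; rewrite ?sqrtr_ge0 //.
    by rewrite K0 sqrtr0 mul0r pi_ge0.
  by rewrite mdE K0 eqxx sqr_sqrtr ?mulr_ge0 //; field.
have s0 := sqrtK_gt0 K0.
have i1 : -1 <= 1 - K * y <= 1.
  by have := mulr_ge0 K_ge0 y0; lra.
exists (acos (1 - K * y) / sK); rewrite [sK * _]mulrC divfK ?gt_eqF //; split.
- by rewrite divr_ge0 ?acos_ge0 ?sqrtr_ge0.
- exact: acos_lepi.
- rewrite mdE (negbTE K0) [sK * _]mulrC divfK ?gt_eqF // acosK ?in_itv //=.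
  by field.
Qed.

Lemma sin_le_id (x : R) : 0 <= x -> sin x <= x.
Proof.
rewrite le_eqVlt => /orP[/eqP <-|x0]; first by rewrite sin0.
have cs : {within `[0, x], continuous (@sin R)}.
  by apply: continuous_subspaceT => z; exact: continuous_sin.
have [c _] := @MVT R (@sin R) (@cos R) 0 x x0 (fun y _ => is_derive_sin y) cs.
rewrite sin0 !subr0 => ->; have := cos_le1 c; nra.
Qed.

Lemma norm_sin_le (x : R) : `|sin x| <= `|x|.
Proof.
case: (leP 0 x) => x0.
  rewrite (ger0_norm x0) ler_norml sin_le_id // andbT.
  case: (leP x pi) => xp.
    by rewrite (@le_trans _ _ 0) ?oppr_le0 // sin_ge0_pi // x0.
  by have := sin_geN1 x; have := pi_ge2 R; lra.
rewrite (ltr0_norm x0) -normrN -sinN ler_norml sin_le_id ?oppr_ge0 ?(ltW x0) //.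
rewrite andbT; case: (leP (- x) pi) => xp.
  have : 0 <= sin (- x) by apply: sin_ge0_pi; rewrite xp oppr_ge0 ltW.
  lra.
by have := sin_geN1 (- x); have := pi_ge2 R; lra.
Qed.

Lemma md_le_sqr (a : R) : md a <= a ^+ 2 / 2.
Proof.
rewrite /md ler_pM2r ?invr_gt0 //; rewrite /chord; case: eqP => // /eqP K0.
have s0 := sqrtK_gt0 K0.
rewrite -[X in X <= _]real_normK ?num_real // -[X in _ <= X]real_normK ?num_real //.
rewrite ler_sqr ?nnegrE // normrM.
have : `|sin (sK * a / 2)| <= `|sK * a / 2| := norm_sin_le _.
rewrite !normrM [`|2^-1|]gtr0_norm ?invr_gt0 // (gtr0_norm s0).
rewrite normrV ?unitfE ?gt_eqF // (gtr0_norm s0) [`|2|]gtr0_norm // => H.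
rewrite (_ : `|a| = 2 / sK * (sK * `|a| / 2)); last by field; rewrite gt_eqF.
by rewrite ler_wpM2l // divr_ge0 // ltW.
Qed.

(* [Sy], [cang], [ang] and [Del] take values of [md] as arguments: [Sy (md r) = sn r],
   [ang a b c] is the angle between the sides [a] and [b], opposite to [c]. *)
Definition Sy (y : R) : R := Num.sqrt (2 * y - K * y ^+ 2).
Definition cang (a b c : R) : R := (a + b - K * a * b - c) / (Sy a * Sy b).
Definition ang (a b c : R) : R := acos (cang a b c).
Definition Del (a b c : R) : R :=
  2 * (a * b + b * c + c * a) - (a ^+ 2 + b ^+ 2 + c ^+ 2) - 2 * K * a * b * c.

Lemma Sy_md (r : R) : 0 <= r -> sK * r <= pi -> Sy (md r) = sn r.
Proof. by move=> r0 rp; rewrite /Sy -sn_sqr sqrtr_sqr ger0_norm // sn_ge0. Qed.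

Lemma Sy_sqr (y : R) : 0 <= y -> K * y <= 2 -> Sy y ^+ 2 = 2 * y - K * y ^+ 2.
Proof. move=> y0 y2; rewrite /Sy sqr_sqrtr //; nra. Qed.

(** [Del] is the product of [md (a + b) - md c] and [md c - md (a - b)]. When [a + b] exceeds half a
    great circle, [md (a + b)] is [md] of the complement to a full circle, and the perimeter bound
    keeps [c] below that complement. *)
Lemma Del_tri (a b c : R) : 0 <= a -> 0 <= b -> 0 <= c ->
  c <= a + b -> a <= b + c -> b <= c + a -> sK * (a + b + c) <= 2 * pi ->
  0 <= Del (md a) (md b) (md c).
Proof.
move=> a0 b0 c0 cab abc bca per.
have s0 : 0 <= sK by rewrite sqrtr_ge0.
have -> : Del (md a) (md b) (md c) =
    sn a ^+ 2 * sn b ^+ 2 - (md a + md b - K * md a * md b - md c) ^+ 2.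
  by rewrite !sn_sqr /Del; ring.
have up : md c <= md (a + b).
  case: (leP (sK * (a + b)) pi) => h; first exact: md_le.
  have K0 : K != 0 by apply: contraTneq h => ->; rewrite sqrtr0 mul0r -leNgt pi_ge0.
  have s1 := sqrtK_gt0 K0.
  have -> : md (a + b) = md (2 * pi / sK - (a + b)).
    rewrite !mdE (negbTE K0) mulrBr [sK * (_ / _)]mulrC divfK ?gt_eqF //.
    by rewrite [2 * pi]mulr_natl cosB cos2pi sin2pi mul1r mul0r addr0.
  have e : sK * (2 * pi / sK) = 2 * pi by rewrite mulrC divfK ?gt_eqF.
  apply: md_le => //.
    by rewrite -(ler_pM2l s1) mulrBr e; lra.
  by rewrite mulrBr e; lra.
have lo : md (a - b) <= md c.
  case: (leP b a) => ba.
    by apply: md_le; [lra|lra|nra].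
  by rewrite -mdN opprB; apply: md_le; [lra|lra|nra].
move: up lo; rewrite md_add md_sub => up lo.
by rewrite -exprMn subr_sqr; apply: mulr_ge0; lra.
Qed.

Lemma cang_norm (a b c : R) : 0 <= a -> 0 <= b -> K * a <= 2 -> K * b <= 2 ->
  0 < Sy a -> 0 < Sy b -> 0 <= Del a b c -> -1 <= cang a b c <= 1.
Proof.
move=> a0 b0 a2 b2 sa sb D0.
have p : 0 < Sy a * Sy b by rewrite mulr_gt0.
rewrite -ler_norml -(@ler_sqr _ `|_|) ?nnegrE // real_normK ?num_real //.
rewrite expr1n /cang exprMn exprVn ler_pdivrMr ?exprn_gt0 // mul1r.
by rewrite exprMn !Sy_sqr //; move: D0; rewrite /Del; nra.
Qed.

Lemma cos_ang (a b c : R) : -1 <= cang a b c <= 1 -> cos (ang a b c) = cang a b c.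
Proof. by move=> h; rewrite /ang acosK // in_itv. Qed.

Lemma ang_ge0 (a b c : R) : -1 <= cang a b c <= 1 -> 0 <= ang a b c.
Proof. exact: acos_ge0. Qed.

Lemma ang_lepi (a b c : R) : -1 <= cang a b c <= 1 -> ang a b c <= pi.
Proof. exact: acos_lepi. Qed.

(** The right-hand side is symmetric in the three sides, which is how the law of sines is
    obtained. *)
Lemma sin_ang (a b c : R) : 0 <= a -> 0 <= b -> K * a <= 2 -> K * b <= 2 ->
  0 < Sy a -> 0 < Sy b -> 0 <= Del a b c ->
  Sy a * Sy b * sin (ang a b c) = Num.sqrt (Del a b c).
Proof.
move=> a0 b0 a2 b2 sa sb D0.
have h := cang_norm a0 b0 a2 b2 sa sb D0.
have p : 0 < Sy a * Sy b by rewrite mulr_gt0.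
rewrite /ang sin_acos // -[X in X * _](ger0_norm (ltW p)) -sqrtr_sqr -sqrtrM ?sqr_ge0 //.
congr Num.sqrt; rewrite mulrBr mulr1 -exprMn /cang [_ * (_ / _)]mulrC divfK ?gt_eqF //.
by rewrite exprMn !Sy_sqr // /Del; ring.
Qed.

Lemma angC (a b c : R) : ang a b c = ang b a c.
Proof. by rewrite /ang /cang [Sy b * _]mulrC; congr (acos (_ / _)); ring. Qed.

Lemma DelC12 (a b c : R) : Del a b c = Del b a c. Proof. by rewrite /Del; ring. Qed.
Lemma DelC23 (a b c : R) : Del a b c = Del a c b. Proof. by rewrite /Del; ring. Qed.

End Model.

(** * Superadditivity of comparison angles *)

Section Cmp.
Variables (R : realType) (K : R).
Hypothesis K_ge0 : 0 <= K.
Local Notation sK := (Num.sqrt K).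
Local Notation md := (md K).
Local Notation snK := (sn K).

(** Law of cosines: [md] of the side opposite to an angle of cosine [q] between sides [a] and
    [t]. *)
Definition hinge (a t q : R) : R := md a + md t - K * md a * md t - snK a * snK t * q.

(* The triangle of three hinges with a common vertex and angles [f1], [f2], [f1 + f2]:
   its [Del] is a square, so it satisfies the triangle inequality. *)
Lemma Del_det (mx mz mw sx sz sw c1 s1 c2 s2 : R) :
  sx ^+ 2 = 2 * mx - K * mx ^+ 2 -> sz ^+ 2 = 2 * mz - K * mz ^+ 2 ->
  sw ^+ 2 = 2 * mw - K * mw ^+ 2 -> s1 ^+ 2 = 1 - c1 ^+ 2 -> s2 ^+ 2 = 1 - c2 ^+ 2 ->
  Del K (mx + mz - K * mx * mz - sx * sz * c1) (mz + mw - K * mz * mw - sz * sw * c2)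
      (mx + mw - K * mx * mw - sx * sw * (c1 * c2 - s1 * s2)) =
  (sx * sz * (1 - K * mw) * s1 + sz * sw * (1 - K * mx) * s2
   - sx * sw * (1 - K * mz) * (s1 * c2 + c1 * s2)) ^+ 2.
Proof.
move=> Hx Hz Hw H1 H2; rewrite /Del.
ring: Hx Hz Hw H1 H2.
Qed.

Lemma hinge_range (a t q : R) : 0 <= a -> 0 <= t -> sK * a <= pi -> sK * t <= pi ->
  -1 <= q <= 1 -> 0 <= hinge a t q /\ K * hinge a t q <= 2.
Proof.
move=> a0 t0 ap tp /andP[q1 q2].
have sa := sn_ge0 a0 ap; have st := sn_ge0 t0 tp.
have p := mulr_ge0 sa st.
have lo : md (a - t) <= hinge a t q by rewrite md_sub // /hinge; nra.
have up : hinge a t q <= md (a + t) by rewrite md_add // /hinge; nra.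
split; first exact: le_trans (md_ge0 _ _) lo.
apply: le_trans (md_le2 K_ge0 (a + t)); exact: ler_wpM2l.
Qed.

Lemma hinge_cos (a t : R) : hinge a t (-1) = md (a + t).
Proof. by rewrite md_add // /hinge; ring. Qed.

Lemma Del_le_add (y3 r1 r2 : R) : 0 <= r1 -> 0 <= r2 -> sK * r1 <= pi ->
  sK * r2 <= pi -> 0 <= Del K (md r1) (md r2) y3 -> y3 <= md (r1 + r2).
Proof.
move=> r10 r20 r1p r2p D0.
have p := mulr_ge0 (sn_ge0 r10 r1p) (sn_ge0 r20 r2p).
rewrite md_add //.
have : (md r1 + md r2 - K * md r1 * md r2 - y3) ^+ 2 <= (snK r1 * snK r2) ^+ 2.
  by rewrite exprMn !sn_sqr // -subr_ge0; move: D0; rewrite /Del; congr (0 <= _); ring.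
rewrite -(@real_normK _ (_ - y3)) ?num_real // ler_sqr ?nnegrE // ler_norml => /andP[].
lra.
Qed.

(** Glue the two hinges along [z] in the model. By [Del_det] the free ends of [x], [z], [w] satisfy
    the triangle inequality whatever [f1 + f2] is, even beyond [pi]; the strict form serves to
    exclude that case in [pang_superadd]. *)
Lemma hinge_triangle (x z w m n f1 f2 : R) :
  0 <= x -> 0 <= z -> 0 <= w -> sK * x <= pi -> sK * z <= pi -> sK * w <= pi ->
  0 <= m -> 0 <= n -> sK * (m + n) <= pi ->
  hinge x z (cos f1) <= md m -> hinge z w (cos f2) <= md n ->
  hinge x w (cos (f1 + f2)) <= md (m + n) /\
  (hinge x z (cos f1) < md m -> hinge x w (cos (f1 + f2)) < md (m + n)).
Proof.
move=> x0 z0 w0 xp zp wp m0 n0 mnp h1 h2.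
have s0 : 0 <= sK by rewrite sqrtr_ge0.
have c1 (f : R) : -1 <= cos f <= 1 by rewrite cos_geN1 cos_le1.
have [y10 y12] := hinge_range x0 z0 xp zp (c1 f1).
have [y20 y22] := hinge_range z0 w0 zp wp (c1 f2).
have [r1 [r10 r1p e1]] := md_surj K_ge0 y10 y12.
have [r2 [r20 r2p e2]] := md_surj K_ge0 y20 y22.
have D0 : 0 <= Del K (md r1) (md r2) (hinge x w (cos (f1 + f2))).
  rewrite e1 e2 /hinge cosD (@Del_det _ _ _ _ _ _ _ (sin f1) _ (sin f2)) ?sqr_ge0 //;
    by rewrite ?sn_sqr ?sin2cos2.
have L := @Del_le_add _ _ _ r10 r20 r1p r2p D0.
have r2n : r2 <= n by apply: (md_le_inv K_ge0); rewrite // e2.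
have r1m : r1 <= m by apply: (md_le_inv K_ge0); rewrite // e1.
split.
  by apply: le_trans L _; apply: md_le => //; lra.
move=> h1'.
have r1m' : r1 < m by apply: (md_lt_inv K_ge0); rewrite // e1.
by apply: le_lt_trans L _; apply: md_lt => //; lra.
Qed.

Section Space.
Variables (X : Type) (d : X -> X -> R).
Hypothesis dm : is_metric d.
Hypothesis cv : curv_ge d K.

Let d_ge0 x y : 0 <= d x y. Proof. by case: dm. Qed.
Let dC x y : d x y = d y x. Proof. by case: dm. Qed.
Let d_tri x y z : d x z <= d x y + d y z. Proof. by case: dm. Qed.
Let s0 : 0 <= sK. Proof. exact: sqrtr_ge0. Qed.

(** The comparison with roots and arc cosines removed: it is linear in [md (d p z)] and has one form
    for all [K >= 0]. *)
Lemma stewart (p x y z : X) : sK * (d p x + d x y + d y p) < 2 * pi ->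
  0 < d x y -> d x z + d z y = d x y ->
  snK (d z y) * (md (d p x) - md (d x z)) + snK (d x z) * (md (d p y) - md (d z y))
   <= snK (d x y) * md (d p z).
Proof.
move=> per xy0 xzy.
have a0 := d_ge0 p x; have b0 := d_ge0 p y; have t0 := d_ge0 x z; have u0 := d_ge0 z y.
have m0 := d_ge0 p z.
have zyE : d z y = d x y - d x z by rewrite -xzy; ring.
move: per; rewrite [d y p]dC => per.
have : model_dist K (d p x) (d p y) (d x y) (d x z) <= d p z.
  apply: cv => // Kp; rewrite [d y p]dC ltr_pdivlMr ?sqrtr_gt0 //; lra.
have mle : d p z <= (d p x + d x y + d p y) / 2.
  have := d_tri p x z; have := d_tri p y z; rewrite [d y z]dC; lra.
rewrite /model_dist !mdE // /sn; case: eqP => [K0|/eqP K0].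
  rewrite zyE; set c := d x y; set t := d x z; set a := d p x; set b := d p y; set m := d p z.
  have c0 : 0 < c by [].
  set W := _ - _ => sW.
  have : W <= m ^+ 2.
    case: (leP 0 W) => W0; last by apply: ltW; apply: lt_le_trans W0 (sqr_ge0 _).
    by rewrite -(sqr_sqrtr W0) ler_sqr ?nnegrE ?sqrtr_ge0.
  rewrite -(ler_pM2l c0) => h.
  have e : c * W = (c - t) * a ^+ 2 + t * b ^+ 2 - t * (c - t) * c.
    by rewrite /W mulrBr [c * (_ / c)]mulrC divfK ?gt_eqF //; ring.
  rewrite e in h; nra.
have sp := sqrtK_gt0 K_ge0 K0.
have Kp : 0 < K by rewrite lt_neqAle eq_sym K0.
have scp : sK * d x y < pi.
  have := d_tri x p y; rewrite [d x p]dC; nra.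
have sc : 0 < sin (sK * d x y) by apply: sin_gt0_pi; rewrite scp mulr_gt0.
set Z := (X in acos X) => H.
(* [acos] is informative only on [[-1, 1]]. The lower bound for [Z] is the triangle inequality in
   [S_K]; if [Z > 1], the claim [cm] below is immediate. *)
have Zge : cos (sK * (d p x + d x z)) <= Z.
  rewrite /Z ler_pdivlMr // -zyE.
  have cb : cos (sK * (d p x + d x y)) <= cos (sK * d p y).
    case: (leP (sK * (d p x + d x y)) pi) => h.
      rewrite leNgt ltr_cos ?in_itv /= ?mulr_ge0 ?addr_ge0 ?h ?(ltW xy0) //.
        by rewrite ltr_pM2l // -leNgt; have := d_tri p x y.
      apply: le_trans h; rewrite ler_pM2l //.
    have -> : cos (sK * (d p x + d x y)) = cos (2 * pi - sK * (d p x + d x y)).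
      by rewrite [2 * pi]mulr_natl cosB cos2pi sin2pi mul1r mul0r addr0.
    rewrite leNgt ltr_cos ?in_itv /= ?mulr_ge0 //; last 2 first.
    - by apply/andP; split; nra.
    - by nra.
    by rewrite -leNgt; nra.
  have t1 : 0 <= sin (sK * d x z).
    apply: sin_ge0_pi; rewrite mulr_ge0 //=; nra.
  have -> : cos (sK * (d p x + d x z)) * sin (sK * d x y) =
     cos (sK * d p x) * sin (sK * d z y) + cos (sK * (d p x + d x y)) * sin (sK * d x z).
    rewrite -xzy !mulrDr !(cosD, sinD).
    have h := sin2cos2 (sK * d x z); ring: h.
  by rewrite lerD2l ler_wpM2r.
have mp : 0 <= sK * d p z <= pi by rewrite mulr_ge0 //=; nra.
have cm : cos (sK * d p z) <= Z.
  case: (leP Z 1) => Z1; last by apply: ltW; apply: le_lt_trans (cos_le1 _) Z1.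
  have Zi : -1 <= Z <= 1 by rewrite Z1 andbT; apply: le_trans (cos_geN1 _) Zge.
  rewrite -[X in _ <= X](@acosK R Z) ?in_itv // leNgt ltr_cos ?in_itv /= ?acos_ge0 ?acos_lepi //.
  by rewrite -leNgt -ler_pdivrMl // mulrC.
move: cm; rewrite /Z ler_pdivlMr // -zyE => cm.
have e : sin (sK * d x y) = sin (sK * d x z) * cos (sK * d z y) + cos (sK * d x z) * sin (sK * d z y).
  by rewrite -sinD -mulrDr xzy.
rewrite -subr_ge0.
set G := (X in 0 <= X).
have -> : G = (cos (sK * d p x) * sin (sK * d z y) + cos (sK * d p y) * sin (sK * d x z)
   - cos (sK * d p z) * sin (sK * d x y)) / (K * sK).
  by rewrite /G e; field; rewrite K0 gt_eqF.
by rewrite divr_ge0 ?subr_ge0 ?mulr_ge0 // ltW.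
Qed.

Definition Yd (x y : X) : R := md (d x y).
Definition pang (a b c : X) : R := ang K (Yd a b) (Yd a c) (Yd b c).

Lemma YdC (x y : X) : Yd x y = Yd y x. Proof. by rewrite /Yd dC. Qed.

Lemma pangC (a b c : X) : pang a b c = pang a c b.
Proof. by rewrite /pang angC [Yd b c]YdC. Qed.

Lemma dist_gt0 (x y : X) : x <> y -> 0 < d x y.
Proof.
move=> xy; rewrite lt_neqAle d_ge0 andbT eq_sym; apply/eqP.
by case: dm => _ h _ _ /h.
Qed.

Lemma per_side (a b c : X) : sK * (d a b + d b c + d c a) < 2 * pi ->
  [/\ sK * d a b < pi, sK * d b c < pi & sK * d c a < pi].
Proof.
move=> per; have := d_tri a b c; have := d_tri b c a; have := d_tri c a b.
rewrite [d a c]dC [d b a]dC [d c b]dC => h1 h2 h3.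
have := ler_wpM2l s0 h1; have := ler_wpM2l s0 h2; have := ler_wpM2l s0 h3; by split; lra.
Qed.

Lemma Yd_ge0 (x y : X) : 0 <= Yd x y. Proof. exact: md_ge0. Qed.
Lemma Yd_le2 (x y : X) : K * Yd x y <= 2. Proof. exact: md_le2. Qed.

Lemma Sy_Yd (x y : X) : sK * d x y <= pi -> Sy K (Yd x y) = snK (d x y).
Proof. by move=> h; rewrite Sy_md. Qed.

Lemma Del_Yd (a b c : X) : sK * (d a b + d b c + d c a) <= 2 * pi ->
  0 <= Del K (Yd a b) (Yd a c) (Yd b c).
Proof.
move=> per; apply: Del_tri => //.
- by rewrite [d a b]dC; apply: d_tri.
- by rewrite [d b c]dC d_tri.
- by rewrite addrC d_tri.
- by rewrite [d a c]dC -addrA [d c a + _]addrC addrA.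
Qed.

Lemma cang_pang (a b c : X) : a <> b -> a <> c ->
  sK * (d a b + d b c + d c a) < 2 * pi ->
  -1 <= cang K (Yd a b) (Yd a c) (Yd b c) <= 1.
Proof.
move=> ab ac per; have [p1 p2 p3] := per_side per.
apply: cang_norm; rewrite ?Yd_ge0 ?Yd_le2 //.
- by rewrite Sy_Yd ?ltW // sn_gt0 // dist_gt0.
- by rewrite Sy_Yd 1?dC ?ltW // sn_gt0 // 1?dC // dist_gt0 // => /esym.
- by apply: Del_Yd; apply: ltW.
Qed.

Lemma pang_range (a b c : X) : a <> b -> a <> c ->
  sK * (d a b + d b c + d c a) < 2 * pi -> 0 <= pang a b c <= pi.
Proof.
by move=> ab ac per; have h := cang_pang ab ac per; rewrite ang_ge0 // ang_lepi.
Qed.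

Lemma pang_hinge (a b c : X) : a <> b -> a <> c ->
  sK * (d a b + d b c + d c a) < 2 * pi ->
  Yd b c = hinge (d a b) (d a c) (cos (pang a b c)).
Proof.
move=> ab ac per; have [p1 p2 p3] := per_side per.
rewrite /pang cos_ang; last exact: cang_pang.
have sb : 0 < snK (d a b) by rewrite sn_gt0 // dist_gt0.
have sc : 0 < snK (d a c) by rewrite sn_gt0 // 1?dC // dist_gt0 // => /esym.
rewrite /hinge /cang !Sy_Yd ?ltW 1?[d a c]dC //.
rewrite [X in _ - X]mulrC divfK ?mulf_neq0 ?gt_eqF 1?[d c a]dC //.
by rewrite /Yd [d a c]dC; ring.
Qed.

(** Stewart's relation is an equality in the comparison triangle, so [stewart] is this hinge
    inequality up to the factor [snK (d x y)]. *)
Lemma hinge_comparison (p x y z : X) : x <> p -> x <> y ->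
  sK * (d p x + d x y + d y p) < 2 * pi -> d x z + d z y = d x y ->
  hinge (d x p) (d x z) (cos (pang x p y)) <= Yd p z.
Proof.
move=> xp xy per xzy.
have per' : sK * (d x p + d p y + d y x) < 2 * pi.
  by apply: le_lt_trans per; rewrite [d x p]dC [d p y]dC [d y x]dC; nra.
have [p1 p2 p3] := per_side per'.
have c0 := dist_gt0 xy.
have sc : 0 < snK (d x y) by rewrite sn_gt0 // dC.
have St := stewart per c0 xzy.
have Hq := pang_hinge xp xy per'.
rewrite -(ler_pM2l sc); apply: le_trans St; rewrite le_eqVlt; apply/orP; left; apply/eqP.
move: Hq; rewrite /Yd /hinge [d x p]dC -xzy; move: (cos _) => q Hq.
have e1 := sn_sqr K_ge0 (d x z); rewrite [md (d p y)]Hq.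
by rewrite (sn_add K_ge0) (md_add K_ge0); ring: e1.
Qed.

Lemma cos_add_ge0_lepi (f1 f2 : R) : 0 <= f1 <= pi -> 0 <= f2 <= pi ->
  0 <= cos f1 + cos f2 -> f1 + f2 <= pi.
Proof.
move=> f1p f2p h; rewrite leNgt; apply/negP => h2.
have : cos f1 < cos (pi - f2).
  by rewrite ltr_cos ?in_itv //=; lra.
rewrite cosB cospi sinpi; lra.
Qed.

(** The two hinges at [a] share the side from [a] to [o]. Comparison at [o] bounds [d b o] and
    [d o e] from below, [hinge_triangle] does so for their sum [d b e], and a larger side opposite
    to [a] means a larger angle. *)
Lemma pang_superadd (a b c e o : X) : a <> b -> a <> c -> a <> e -> b <> e ->
  d a o + d o c = d a c -> d b o + d o e = d b e ->
  sK * (d a b + d b c + d c a) < 2 * pi -> sK * (d a c + d c e + d e a) < 2 * pi ->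
  sK * (d c b + d b e + d e c) < 2 * pi -> sK * (d a b + d a e) < pi ->
  pang a b c + pang a c e <= pang a b e.
Proof.
move=> ab ac ae be oac obe per1 per2 per3 ps.
have be_le : d b e <= d a b + d a e by rewrite [d a b]dC d_tri.
have per4 : sK * (d a b + d b e + d e a) < 2 * pi.
  by rewrite [d e a]dC; have := ler_wpM2l s0 be_le; lra.
have [qb _ _] := per_side per1; have [qc _ qe] := per_side per2.
have r1 := pang_range ab ac per1; have r2 := pang_range ac ae per2.
have r3 := pang_range ab ae per4.
have h3 := pang_hinge ab ae per4.
have sb : 0 < snK (d a b) by rewrite sn_gt0 // dist_gt0.
have se : 0 < snK (d a e) by rewrite sn_gt0 1?dC // 1?dC ?dist_gt0 // => /esym.
have x0 := d_ge0 a b; have w0 := d_ge0 a e; have z0 := d_ge0 a o.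
have be_pi : sK * d b e <= pi by have := ler_wpM2l s0 be_le; lra.
have wp : sK * d a e <= pi by rewrite dC ltW.
have key : pang a b c + pang a c e <= pi -> 
    hinge (d a b) (d a e) (cos (pang a b c + pang a c e)) <= Yd b e ->
    pang a b c + pang a c e <= pang a b e.
  move=> lp; rewrite h3 /hinge lerD2l lerN2 ler_pM2l ?mulr_gt0 // => H.
  rewrite leNgt; apply/negP => lt; move: H; apply/negP; rewrite -ltNge.
  by rewrite ltr_cos ?in_itv //=; lra.
(* Here [a] itself lies between [b] and [e], and the hinges degenerate. Comparison of [c] with the
   path from [b] to [e] at [a] makes the sum of the two cosines nonnegative. *)
case: (pselect (o = a)) => oa.
  subst o.
  have bae : d a b + d a e = d b e by rewrite -obe [d b a]dC.
  have lp : pang a b c + pang a c e <= pi.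
    apply: cos_add_ge0_lepi => //.
    have H1 := pang_hinge ab ac per1; have H2 := pang_hinge ac ae per2.
    have St := stewart per3 (dist_gt0 be) obe.
    have sz : 0 < snK (d a c) by rewrite sn_gt0 // dist_gt0.
    have snE : snK (d b e) = snK (d a b) * (1 - K * md (d a e)) + (1 - K * md (d a b)) * snK (d a e).
      by rewrite -bae sn_add.
    rewrite -(pmulr_rge0 _ (mulr_gt0 (mulr_gt0 sb se) sz)).
    move: H1 H2 St; rewrite /Yd /hinge snE ![d b a]dC ![d c b]dC ![d c a]dC.
    move: (cos (pang a b c)) (cos (pang a c e)) => q1 q2 H1 H2.
    rewrite H1 H2 -subr_ge0; congr (0 <= _); ring.
  apply: key => //.
  by rewrite /Yd -bae -hinge_cos // /hinge lerD2l lerN2 ler_pM2l ?mulr_gt0 // cos_geN1.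
have zpos : 0 < d a o by apply: dist_gt0 => /esym.
have zc : d a o <= d a c by rewrite -oac lerDl.
have zp : sK * d a o < pi by apply: le_lt_trans qc; rewrite ler_wpM2l.
have sz : 0 < snK (d a o) by rewrite sn_gt0.
have C1 : hinge (d a b) (d a o) (cos (pang a b c)) <= Yd b o.
  apply: hinge_comparison => //.
  by apply: le_lt_trans per1; rewrite [d b a]dC [d c b]dC [d c a]dC; lra.
have C2 : hinge (d a o) (d a e) (cos (pang a c e)) <= Yd o e.
  have -> : hinge (d a o) (d a e) (cos (pang a c e)) = hinge (d a e) (d a o) (cos (pang a e c)).
    by rewrite pangC /hinge; ring.
  rewrite YdC; apply: hinge_comparison => //.
  by apply: le_lt_trans per2; rewrite [d c e]dC; lra.
have mn : sK * (d b o + d o e) <= pi by rewrite obe.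
have m0 := d_ge0 b o; have n0 := d_ge0 o e.
case: (leP (pang a b c + pang a c e) pi) => lp.
  apply: key => //; rewrite /Yd -obe.
  by have [] := hinge_triangle x0 z0 w0 (ltW qb) (ltW zp) wp m0 n0 mn C1 C2.
(* Shrinking the first angle until the sum is [pi] makes its hinge inequality strict; the glued
   hinges then give [d b e > d a b + d a e]. *)
exfalso.
have C1' : hinge (d a b) (d a o) (cos (pi - pang a c e)) < Yd b o.
  apply: lt_le_trans C1; rewrite /hinge ltrD2l ltrN2 ltr_pM2l ?mulr_gt0 //.
  by rewrite ltr_cos ?in_itv //=; lra.
have [_ /(_ C1')] := hinge_triangle x0 z0 w0 (ltW qb) (ltW zp) wp m0 n0 mn (ltW C1') C2.
rewrite subrK cospi hinge_cos // obe => lt.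
have := md_lt_inv K_ge0 (d_ge0 b e) (ltW ps) lt; lra.
Qed.

End Space.
End Cmp.

(** * Crossing of chains in the disk *)

Section Winding.
Variable R : realType.

(* The signed number of times the edge from [(xu, yu)] to [(xv, yv)] crosses the ray
   [x > 0, y = 0], for edges too short to distinguish [xu] from [xv] there. *)
Definition ray_cross (xu yu yv : R) : R := ((0 <= yv)%R%:R - (0 <= yu)%R%:R) * (0 < xu)%R%:R.

Lemma ray_cross_eq (xu yu yv : R) : (0 <= yv) = (0 <= yu) -> ray_cross xu yu yv = 0.
Proof. by rewrite /ray_cross => ->; rewrite subrr mul0r. Qed.

(** Where [y] changes sign, [|yu| <= c]; a point away from the origin then has [|xu| > c], and a
    step of size [c] cannot change the sign of [x]. *)
Lemma same_sign (c xu yu xv yv : R) : `|xv - xu| <= c -> `|yv - yu| <= c ->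
  ~ (`|xu| <= c /\ `|yu| <= c) -> (0 <= yv) != (0 <= yu) -> (0 < xv) = (0 < xu).
Proof.
move=> dx dy far; case: (leP 0 yv) => yv0; case: (leP 0 yu) => yu0 //= _;
  apply/idP/idP => h; rewrite ltNge; apply/negP => h'; apply: far;
  move: dx dy; rewrite !ler_norml => /andP[? ?] /andP[? ?]; split; apply/andP; split; lra.
Qed.

(** A cell this small and this far from the origin cannot wind around it; [same_sign] leaves only
    consistent sign patterns. *)
Lemma ray_cross_cell (c x0 y0 x1 y1 x2 y2 x3 y3 : R) :
  `|x1 - x0| <= c -> `|y1 - y0| <= c -> `|x2 - x0| <= c -> `|y2 - y0| <= c ->
  `|x3 - x0| <= c -> `|y3 - y0| <= c -> 
  `|x3 - x1| <= c -> `|y3 - y1| <= c ->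
  `|x3 - x2| <= c -> `|y3 - y2| <= c ->
  ~ (`|x0| <= c /\ `|y0| <= c) -> ~ (`|x1| <= c /\ `|y1| <= c) ->
  ~ (`|x2| <= c /\ `|y2| <= c) ->
  ray_cross x0 y0 y1 + ray_cross x1 y1 y3 = ray_cross x0 y0 y2 + ray_cross x2 y2 y3.
Proof.
move=> dx1 dy1 dx2 dy2 dx3 dy3 dx31 dy31 dx32 dy32 f0 f1 f2.
have S1 := same_sign dx1 dy1 f0; have S2 := same_sign dx2 dy2 f0.
have S3 := same_sign dx3 dy3 f0; have S31 := same_sign dx31 dy31 f1.
have S32 := same_sign dx32 dy32 f2.
rewrite /ray_cross; move: S1 S2 S3 S31 S32.
case: (0 <= y0); case: (0 <= y1); case: (0 <= y2); case: (0 <= y3) => /=;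
case: (0 < x0); case: (0 < x1); case: (0 < x2); case: (0 < x3) => /= S1 S2 S3 S31 S32;
first [by ring | by have := S1 isT | by have := S2 isT | by have := S3 isT
      | by have := S31 isT | by have := S32 isT].
Qed.

(** Discrete Stokes: [ch] and [cvv] live on the edges in the first and second grid direction, and
    interior edges cancel. *)
Lemma grid_stokes (n m : nat) (ch cvv : nat -> nat -> R) :
  (forall i j, (i < n)%N -> (j < m)%N ->
     ch i j + cvv i.+1 j = cvv i j + ch i j.+1) ->
  \sum_(i < n) ch i 0%N + \sum_(j < m) cvv n j =
  \sum_(j < m) cvv 0%N j + \sum_(i < n) ch i m.
Proof.
move=> H; elim: n H => [|n IH] H; first by rewrite !big_ord0; ring.
have /IH E : forall i j, (i < n)%N -> (j < m)%N -> ch i j + cvv i.+1 j = cvv i j + ch i j.+1.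
  by move=> i j ij; apply: H; apply: ltnW.
have : ch n 0%N + \sum_(j < m) cvv n.+1 j = \sum_(j < m) cvv n j + ch n m.
  have : forall j, (j < m)%N -> ch n j + cvv n.+1 j = cvv n j + ch n j.+1.
    by move=> j jm; apply: H.
  elim: m {IH E H} => [|m IHm] H; first by rewrite !big_ord0; ring.
  have /IHm : forall j, (j < m)%N -> ch n j + cvv n.+1 j = cvv n j + ch n j.+1.
    by move=> j jm; apply: H; apply: ltnW.
  have := H m (ltnSn m); rewrite !big_ord_recr /=; lra.
rewrite !big_ord_recr /=; lra.
Qed.

(* A path inside the half plane [a * x + b * y > 0] crosses the ray [x > 0, y = 0]
   algebraically as often as its endpoints tell, or never. *)
Lemma ray_cross_half_plane (c a b : R) (k : nat) (x y : nat -> R) : 0 <= c ->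
  (forall i, (i < k)%N -> `|x i.+1 - x i| <= c /\ `|y i.+1 - y i| <= c) ->
  (forall i, (i <= k)%N -> ~ (`|x i| <= c /\ `|y i| <= c)) ->
  (forall i, (i <= k)%N -> 0 < a * x i + b * y i) ->
  \sum_(i < k) ray_cross (x i) (y i) (y i.+1) =
    (0 < a)%R%:R * ((0 <= y k)%R%:R - (0 <= y 0%N)%R%:R).
Proof.
move=> c0 st far hp; elim: k st far hp => [|k IH] st far hp.
  by rewrite big_ord0 subrr mulr0.
rewrite big_ord_recr /= IH; last 3 first.
- by move=> i ik; apply: st; apply: ltnW.
- by move=> i ik; apply: far; apply: leqW.
- by move=> i ik; apply: hp; apply: leqW.
suff -> : ray_cross (x k) (y k) (y k.+1) = (0 < a)%R%:R * ((0 <= y k.+1)%R%:R - (0 <= y k)%R%:R).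
  by ring.
case: (eqVneq (0 <= y k.+1) (0 <= y k)) => e.
  by rewrite ray_cross_eq // e subrr mulr0.
have [dx dy] := st k (ltnSn k).
have sx := same_sign dx dy (far k (leqnSn k)) e.
have p1 := hp k (leqnSn k); have p2 := hp k.+1 (leqnn _).
rewrite /ray_cross mulrC; congr (_%:R * _); congr nat_of_bool.
have D : (y k.+1 < 0 /\ 0 <= y k) \/ (y k < 0 /\ 0 <= y k.+1).
  by move: e; case: (leP 0 (y k.+1)) => ?; case: (leP 0 (y k)) => ? // _; [right|left].
have idn : a * (x k * y k.+1 - x k.+1 * y k) =
    y k.+1 * (a * x k + b * y k) - y k * (a * x k.+1 + b * y k.+1) by ring.
move: sx; case: (ltP 0 (x k)) => xk; case: (ltP 0 (x k.+1)) => xk1 // _;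
  case: (ltP 0 a) => a0 //; exfalso; case: D => -[d1 d2].
- have : y k.+1 * (a * x k + b * y k) < 0 by rewrite nmulr_rlt0.
  have : 0 <= y k * (a * x k.+1 + b * y k.+1) by rewrite mulr_ge0 // ltW.
  have : x k * y k.+1 < 0 by rewrite pmulr_rlt0.
  have : 0 <= x k.+1 * y k by rewrite mulr_ge0 // ltW.
  by move=> *; nra.
- have : y k * (a * x k.+1 + b * y k.+1) < 0 by rewrite nmulr_rlt0.
  have : 0 <= y k.+1 * (a * x k + b * y k) by rewrite mulr_ge0 // ltW.
  have : x k.+1 * y k < 0 by rewrite pmulr_rlt0.
  have : 0 <= x k * y k.+1 by rewrite mulr_ge0 // ltW.
  by move=> *; nra.
- have : y k.+1 * (a * x k + b * y k) < 0 by rewrite nmulr_rlt0.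
  have : 0 <= y k * (a * x k.+1 + b * y k.+1) by rewrite mulr_ge0 // ltW.
  have : 0 <= x k * y k.+1 by rewrite mulr_le0 // ltW.
  have : x k.+1 * y k <= 0 by rewrite mulr_le0_ge0.
  by move=> *; nra.
- have : y k * (a * x k.+1 + b * y k.+1) < 0 by rewrite nmulr_rlt0.
  have : 0 <= y k.+1 * (a * x k + b * y k) by rewrite mulr_ge0 // ltW.
  have : 0 <= x k.+1 * y k by rewrite mulr_le0 // ltW.
  have : x k * y k.+1 <= 0 by rewrite mulr_le0_ge0.
  by move=> *; nra.
Qed.

Definition nsq (z : R * R) : R := z.1 ^+ 2 + z.2 ^+ 2.
Definition cross (u v : R * R) : R := u.1 * v.2 - u.2 * v.1.

(** The supporting half plane of the disk at [A]. On a side of the grid where one chain stays at a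
    boundary point, it keeps the difference of the chains in an open half plane, as
    [ray_cross_half_plane] requires. *)
Lemma disk_dot_gt0 (A z : R * R) : nsq A = 1 -> nsq z <= 1 -> z <> A ->
  0 < A.1 * (A.1 - z.1) + A.2 * (A.2 - z.2).
Proof.
case: A z => a1 a2 [z1 z2]; rewrite /nsq /= => hA hz ne.
have : 0 < (a1 - z1) ^+ 2 + (a2 - z2) ^+ 2.
  rewrite lt_neqAle addr_ge0 ?sqr_ge0 // andbT eq_sym paddr_eq0 ?sqr_ge0 //.
  rewrite !sqrf_eq0 !subr_eq0; apply/negP => /andP[/eqP e1 /eqP e2].
  by apply: ne; rewrite e1 e2.
nra.
Qed.

(* Otherwise [P i - Q j] would avoid 0 on the whole grid, while its winding number along
   the boundary of the grid is not 0. *)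
Lemma chains_cross (A B C D : R * R) (n m : nat) (P Q : nat -> R * R) (eta : R) :
  0 <= eta -> nsq A = 1 -> nsq B = 1 -> nsq C = 1 -> nsq D = 1 ->
  0 < cross (C - A) (B - A) -> cross (C - A) (D - A) < 0 ->
  P 0%N = A -> P n = C -> Q 0%N = B -> Q m = D ->
  (forall i, (i <= n)%N -> nsq (P i) <= 1) -> (forall j, (j <= m)%N -> nsq (Q j) <= 1) ->
  (forall i, (i < n)%N -> nsq (P i.+1 - P i) <= eta ^+ 2) ->
  (forall j, (j < m)%N -> nsq (Q j.+1 - Q j) <= eta ^+ 2) ->
  exists i j, [/\ (i <= n)%N, (j <= m)%N & nsq (C - A) * nsq (P i - Q j) <= 32 * eta ^+ 2].
Proof.
move=> eta0 hA hB hC hD cB cD P0 Pn Q0 Qm Pd Qd Ps Qs.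
apply: contrapT => no.
pose e := C - A.
(* Coordinates of [P i - Q j] with first axis along [C - A], scaled by the length of [C - A], which
   is at most 2; hence [2 * eta] bounds a step and [c = 4 * eta] the diagonal of a cell. *)
pose x i j : R := e.1 * ((P i).1 - (Q j).1) + e.2 * ((P i).2 - (Q j).2).
pose y i j : R := e.1 * ((P i).2 - (Q j).2) - e.2 * ((P i).1 - (Q j).1).
pose c := 4 * eta.
have c0 : 0 <= c by rewrite /c; lra.
have e4 : nsq e <= 4.
  rewrite /e /nsq /=; move: hA hC; rewrite /nsq.
  have := sqr_ge0 (C.1 + A.1); have := sqr_ge0 (C.2 + A.2); lra.
have e0 : 0 < nsq e.
  rewrite /nsq lt_neqAle addr_ge0 ?sqr_ge0 // andbT eq_sym; apply/eqP => z.
  move: cB; rewrite /cross -/e; move/eqP: z; rewrite paddr_eq0 ?sqr_ge0 // !sqrf_eq0.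
  by move=> /andP[/eqP -> /eqP ->]; rewrite !mul0r subrr ltxx.
have dAC : C.1 * A.1 + C.2 * A.2 < 1.
  by move: e0 hA hC; rewrite /nsq /e /=; lra.
have small (u v : R) : u ^+ 2 + v ^+ 2 <= eta ^+ 2 ->
    `|e.1 * u + e.2 * v| <= 2 * eta /\ `|e.1 * v - e.2 * u| <= 2 * eta.
  move=> uv.
  have H w : w ^+ 2 <= (2 * eta) ^+ 2 -> `|w| <= 2 * eta.
    by rewrite -real_normK ?num_real // ler_sqr ?nnegrE //; lra.
  have nB : nsq e * (u ^+ 2 + v ^+ 2) <= 4 * eta ^+ 2.
    by apply: ler_pM => //; rewrite /nsq addr_ge0 ?sqr_ge0.
  move: nB; rewrite /nsq => nB.
  have := sqr_ge0 (e.1 * u + e.2 * v); have := sqr_ge0 (e.1 * v - e.2 * u) => s1 s2.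
  split; apply: H; rewrite exprMn; nra.
have far i j : (i <= n)%N -> (j <= m)%N -> ~ (`|x i j| <= c /\ `|y i j| <= c).
  move=> ii jj [hx hy]; apply: no; exists i, j; split => //.
  have sq w : `|w| <= c -> w ^+ 2 <= 16 * eta ^+ 2.
    move=> h; rewrite -[X in X <= _]real_normK ?num_real //.
    have -> : 16 * eta ^+ 2 = c ^+ 2 by rewrite /c; ring.
    by rewrite ler_sqr ?nnegrE.
  have -> : nsq (C - A) * nsq (P i - Q j) = x i j ^+ 2 + y i j ^+ 2.
    by rewrite /nsq /x /y /e /=; ring.
  have := sq _ hx; have := sq _ hy; lra.
have Ne i j : (i <= n)%N -> (j <= m)%N -> P i <> Q j.
  move=> ii jj E; apply: (far i j) => //.
  by rewrite /x /y E !subrr !mulr0 subrr addr0 normr0.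
have stP i j : (i < n)%N ->
    `|x i.+1 j - x i j| <= 2 * eta /\ `|y i.+1 j - y i j| <= 2 * eta.
  move=> /Ps /small[h1 h2]; rewrite /x /y; split.
    by apply: le_trans h1; rewrite le_eqVlt; apply/orP; left; apply/eqP; congr `|_|; rewrite /=; ring.
  by apply: le_trans h2; rewrite le_eqVlt; apply/orP; left; apply/eqP; congr `|_|; rewrite /=; ring.
have stQ i j : (j < m)%N ->
    `|x i j.+1 - x i j| <= 2 * eta /\ `|y i j.+1 - y i j| <= 2 * eta.
  move=> /Qs /small[h1 h2]; rewrite /x /y; split.
    by apply: le_trans h1; rewrite -normrN le_eqVlt; apply/orP; left; apply/eqP; congr `|_|; rewrite /=; ring.
  by apply: le_trans h2; rewrite -normrN le_eqVlt; apply/orP; left; apply/eqP; congr `|_|; rewrite /=; ring.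
have two (w : R) : `|w| <= 2 * eta -> `|w| <= c by rewrite /c; lra.
have tri (u v w : R) : `|u - v| <= 2 * eta -> `|v - w| <= 2 * eta -> `|u - w| <= c.
  by move=> h1 h2; have := ler_distD v u w; rewrite /c; lra.
have St := @grid_stokes n m (fun i j => ray_cross (x i j) (y i j) (y i.+1 j))
  (fun i j => ray_cross (x i j) (y i j) (y i j.+1)).
have {St} /= := St _.
have cell i j : (i < n)%N -> (j < m)%N ->
   ray_cross (x i j) (y i j) (y i.+1 j) + ray_cross (x i.+1 j) (y i.+1 j) (y i.+1 j.+1) =
   ray_cross (x i j) (y i j) (y i j.+1) + ray_cross (x i j.+1) (y i j.+1) (y i.+1 j.+1).
  move=> ii jj.
  have [a1 a2] := stP i j ii; have [b1 b2] := stQ i j jj.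
  have [a3 a4] := stP i j.+1 ii; have [b3 b4] := stQ i.+1 j jj.
  have [x3 y3] := (tri _ _ _ a3 b1, tri _ _ _ a4 b2).
  by apply: (@ray_cross_cell c _ _ _ _ _ _ (x i.+1 j.+1)); [exact: two|exact: two|exact: two|exact: two|by []|by []
    |exact: two|exact: two|exact: two|exact: two|exact: far (ltnW ii) (ltnW jj)
    |exact: far ii (ltnW jj)|exact: far (ltnW ii) jj].
move=> /(_ cell).
have yn0 : (0 <= y n 0%N) = false.
  apply/negbTE; rewrite -ltNge /y Pn Q0; move: cB; rewrite /cross /e /=; lra.
have y00 : (0 <= y 0%N 0%N) = false.
  apply/negbTE; rewrite -ltNge /y P0 Q0; move: cB; rewrite /cross /e /=; lra.
have ynm : (0 <= y n m).
  by rewrite /y Pn Qm; move: cD; rewrite /cross /e /=; lra.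
have y0m : (0 <= y 0%N m).
  by rewrite /y P0 Qm; move: cD; rewrite /cross /e /=; lra.
(* Only the side with [P] at [C] crosses the ray. Its half plane contains the ray, since [e] and [C]
   make an acute angle; at [A] the angle is obtuse and the half plane misses the ray; with [Q] at
   [B] or [D] both ends have [y] of the same sign. *)
have side0 : \sum_(j < m) ray_cross (x 0%N j) (y 0%N j) (y 0%N j.+1) = 0.
  rewrite (@ray_cross_half_plane c (e.1 * A.1 + e.2 * A.2) (e.1 * A.2 - e.2 * A.1)
    m (x 0%N) (y 0%N)) //.
  - have -> : (0 < e.1 * A.1 + e.2 * A.2) = false.
      apply/negbTE; rewrite -leNgt /e /=; move: hA hC; rewrite /nsq; lra.
    by rewrite mul0r.
  - by move=> i im; have [h1 h2] := stQ 0%N i im; split; apply: two.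
  - by move=> i im; apply: far.
  - move=> j jm; have := disk_dot_gt0 hA (Qd j jm); rewrite -P0 => /(_ (nesym (Ne 0%N j isT jm))).
    rewrite P0 /x /y P0 => h.
    have := mulr_gt0 e0 h; rewrite /nsq; congr (0 < _); ring.
have sideN : \sum_(j < m) ray_cross (x n j) (y n j) (y n j.+1) = 1.
  rewrite (@ray_cross_half_plane c (e.1 * C.1 + e.2 * C.2) (e.1 * C.2 - e.2 * C.1)
    m (x n) (y n)) //.
  - have -> : (0 < e.1 * C.1 + e.2 * C.2).
      by rewrite /e /=; move: hA hC; rewrite /nsq; lra.
    by rewrite ynm yn0 subr0 mulr1.
  - by move=> i im; have [h1 h2] := stQ n i im; split; apply: two.
  - by move=> i im; apply: far.
  - move=> j jm; have := disk_dot_gt0 hC (Qd j jm); rewrite -Pn => /(_ (nesym (Ne n j (leqnn n) jm))).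
    rewrite Pn /x /y Pn => h.
    have := mulr_gt0 e0 h; rewrite /nsq; congr (0 < _); ring.
have sideB : \sum_(i < n) ray_cross (x i 0%N) (y i 0%N) (y i.+1 0%N) = 0.
  rewrite (@ray_cross_half_plane c (- (e.1 * B.1 + e.2 * B.2)) (- (e.1 * B.2 - e.2 * B.1))
    n (x^~ 0%N) (y^~ 0%N)) //.
  - by rewrite yn0 y00 subrr mulr0.
  - by move=> i im; have [h1 h2] := stP i 0%N im; split; apply: two.
  - by move=> i im; apply: far.
  - move=> j jm; have := disk_dot_gt0 hB (Pd j jm); rewrite -Q0 => /(_ (Ne j 0%N jm isT)).
    rewrite Q0 /x /y Q0 => h.
    have := mulr_gt0 e0 h; rewrite /nsq; congr (0 < _); ring.
have sideD : \sum_(i < n) ray_cross (x i m) (y i m) (y i.+1 m) = 0.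
  rewrite (@ray_cross_half_plane c (- (e.1 * D.1 + e.2 * D.2)) (- (e.1 * D.2 - e.2 * D.1))
    n (x^~ m) (y^~ m)) //.
  - by rewrite ynm y0m subrr mulr0.
  - by move=> i im; have [h1 h2] := stP i m im; split; apply: two.
  - by move=> i im; apply: far.
  - move=> j jm; have := disk_dot_gt0 hD (Pd j jm); rewrite -Qm => /(_ (Ne j m jm (leqnn m))).
    rewrite Qm /x /y Qm => h.
    have := mulr_gt0 e0 h; rewrite /nsq; congr (0 < _); ring.
rewrite sideB sideN side0 sideD; lra.
Qed.

End Winding.

Local Notation edist := Defs.edist.

(** * Compactness of the closed disk *)

Section DiskTopology.
Variable R : realType.

Lemma edistC (z w : R * R) : edist z w = edist w z.
Proof. by rewrite /edist; congr Num.sqrt; ring. Qed.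

Lemma edist_lt (z w : R * R) (e : R) : 0 < e ->
  (edist z w < e) = (nsq (z - w) < e ^+ 2).
Proof.
move=> e0; rewrite /edist /nsq -[X in _ < X](ger0_norm (ltW e0)) -sqrtr_sqr.
by rewrite ltr_sqrt ?exprn_gt0.
Qed.

Lemma edist_tri (x y z : R * R) : edist x z <= edist x y + edist y z.
Proof.
rewrite /edist; set a := x.1 - y.1; set b := x.2 - y.2.
set a' := y.1 - z.1; set b' := y.2 - z.2.
have -> : x.1 - z.1 = a + a' by rewrite /a /a'; ring.
have -> : x.2 - z.2 = b + b' by rewrite /b /b'; ring.
have n1 : 0 <= a ^+ 2 + b ^+ 2 by rewrite addr_ge0 ?sqr_ge0.
have n2 : 0 <= a' ^+ 2 + b' ^+ 2 by rewrite addr_ge0 ?sqr_ge0.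
set s := Num.sqrt (a ^+ 2 + _); set t := Num.sqrt (a' ^+ 2 + _).
have s0 : 0 <= s by rewrite sqrtr_ge0.
have t0 : 0 <= t by rewrite sqrtr_ge0.
have s2 : s ^+ 2 = a ^+ 2 + b ^+ 2 by rewrite sqr_sqrtr.
have t2 : t ^+ 2 = a' ^+ 2 + b' ^+ 2 by rewrite sqr_sqrtr.
have st : a * a' + b * b' <= s * t.
  have [h|h] := leP (a * a' + b * b') 0; first exact: le_trans h (mulr_ge0 s0 t0).
  rewrite -ler_sqr ?nnegrE ?(ltW h) ?mulr_ge0 // exprMn s2 t2.
  have := sqr_ge0 (a * b' - b * a'); lra.
rewrite -[X in _ <= X](ger0_norm (addr_ge0 s0 t0)) -sqrtr_sqr ler_wsqrtr //.
lra.
Qed.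

Lemma disk_cluster (z : nat -> R * R) : (forall n, cdisk (z n)) ->
  exists2 w, cdisk w & forall e, 0 < e -> forall N, exists2 n, (N <= n)%N & edist (z n) w < e.
Proof.
move=> zd.
have cpt : compact (`[(-1 : R), 1] `*` `[(-1 : R), 1]).
  by apply: compact_setX; apply: segment_compact.
have zin n : (`[(-1 : R), 1] `*` `[(-1 : R), 1]) (z n).
  have := zd n; rewrite /cdisk /= !in_itv /=.
  move: (z n).1 (z n).2 => a b ab.
  have sa := sqr_ge0 a; have sb := sqr_ge0 b.
  split; rewrite -ler_norml -(@ler_sqr _ `|_|) ?nnegrE // real_normK ?num_real // expr1n; lra.
have [|w [_ wcl]] := cpt (z @ \oo) _.
  by exists 0%N => // n _; apply: zin.
have cl e : 0 < e -> forall N, exists2 n, (N <= n)%N & `|(z n).1 - w.1| < e /\ `|(z n).2 - w.2| < e.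
  move=> e0 N.
  have [||y [[n Nn <-] [h1 h2]]] := wcl (z @` [set n | (N <= n)%N]) (ball w e).
  - by exists N => // n /= Nn; exists n.
  - exact: nbhsx_ballx.
  by exists n => //; rewrite distrC [`|_.2 - _|]distrC.
have cl2 e : 0 < e -> forall N, exists2 n, (N <= n)%N & edist (z n) w < e.
  move=> e0 N; have [|n Nn [h1 h2]] := cl (e / 2) _ N; first by rewrite divr_gt0.
  exists n => //; rewrite edist_lt // /nsq /=.
  move: h1 h2; rewrite !ltr_norml => /andP[? ?] /andP[? ?]; nra.
exists w => //.
have o0 : cdisk ((0, 0) : R * R) by rewrite /cdisk /= expr0n /=; lra.
rewrite /cdisk /= leNgt; apply/negP => h.
have e1 : 0 < edist w 0 - 1.
  rewrite subr_gt0 /edist -[X in X < _]sqrtr1 ltr_sqrt //= ?subr0 //; lra.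
have [n _] := cl2 _ e1 0%N; have := edist_tri w (z n) 0; rewrite [edist w (z n)]edistC.
have : edist (z n) 0 <= 1.
  rewrite /edist -[X in _ <= X]sqrtr1 ler_wsqrtr // /= !subr0; exact: zd.
lra.
Qed.

End DiskTopology.

(** * Chains of midpoints and the meeting of two shortest paths *)

Section Geodesics.
Variables (R : realType) (X : Type) (d : X -> X -> R).
Hypothesis dm : is_metric d.
Hypothesis mid : has_midpoints d.

Let d_ge0 x y : 0 <= d x y. Proof. by case: dm. Qed.
Let dC x y : d x y = d y x. Proof. by case: dm. Qed.
Let d_tri x y z : d x z <= d x y + d y z. Proof. by case: dm. Qed.
Let dxx x : d x x = 0. Proof. by case: dm => _ h _ _; apply/h. Qed.

(** Dyadic chains stand in for shortest paths: the crossing argument only uses chains with small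
    steps, so no limit path is constructed. *)
Lemma midpoint_chain (n : nat) (x y : X) : exists c : nat -> X,
  [/\ c 0%N = x, c (2 ^ n)%N = y & forall i, (i < 2 ^ n)%N -> d (c i) (c i.+1) = d x y / 2 ^+ n].
Proof.
elim: n x y => [|n IH] x y.
  exists (fun i => if i == 0%N then x else y); split => // i.
  by rewrite expn0 ltnS leqn0 => /eqP ->; rewrite /= expr0 divr1.
have [m [m1 m2]] := mid x y.
have [c1 [c10 c11 c1s]] := IH x m; have [c2 [c20 c21 c2s]] := IH m y.
exists (fun i => if (i <= 2 ^ n)%N then c1 i else c2 (i - 2 ^ n)%N); split => //.
- rewrite expnS mul2n -addnn -{3}[(2 ^ n)%N]addn0 leq_add2l leqn0 expn_eq0 /=.
  by rewrite addnK.
- move=> i; rewrite expnS mul2n -addnn => lt; case: (ltnP i (2 ^ n)) => h.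
    by rewrite (ltnW h) c1s // m1 exprS; field; rewrite expf_neq0.
  have e : d (c2 (i - 2 ^ n)%N) (c2 (i.+1 - 2 ^ n)%N) = d x y / 2 ^+ n.+1.
    by rewrite subSn // c2s ?ltn_subLR // m2 exprS; field; rewrite expf_neq0.
  case: (eqVneq i (2 ^ n)%N) => [E|ne].
    by move: e; rewrite E leqnn subnn c20 c11.
  by rewrite leqNgt ltn_neqAle eq_sym ne h.
Qed.

Lemma midpoint_chain_geodesic (n : nat) (x y : X) : exists c : nat -> X,
  [/\ c 0%N = x, c (2 ^ n)%N = y,
    forall i, (i < 2 ^ n)%N -> d (c i) (c i.+1) = d x y / 2 ^+ n &
    forall i, (i <= 2 ^ n)%N -> d x (c i) + d (c i) y = d x y].
Proof.
have [c [c0 c1 cs]] := midpoint_chain n x y.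
exists c; split => // i ile.
have up : d x (c i) <= i%:R * (d x y / 2 ^+ n).
  elim: i ile => [|i IHi] ile; first by rewrite c0 dxx mul0r.
  have := IHi (ltnW ile); have := d_tri x (c i) (c i.+1); rewrite cs // -natr1; lra.
have dn k : (k <= 2 ^ n)%N -> d (c (2 ^ n - k)%N) y <= k%:R * (d x y / 2 ^+ n).
  elim: k => [|k IHk] kle; first by rewrite subn0 c1 dxx mul0r.
  have := IHk (ltnW kle); have := d_tri (c (2 ^ n - k.+1)%N) (c (2 ^ n - k.+1).+1) y.
  by rewrite cs ?ltn_subrL ?expn_gt0 // subnSK // -natr1; lra.
have := dn (2 ^ n - i)%N (leq_subr _ _); rewrite subKn // natrB // => h.
apply/eqP; rewrite eq_le d_tri andbT.
have e : (2 ^ n)%:R * (d x y / 2 ^+ n) = d x y.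
  by rewrite natrX mulrC divfK // expf_neq0.
by move: h; rewrite mulrBl e; lra.
Qed.

Variable h : R * R -> X.
Hypothesis hd : homeo_disk d h.

(** Uniform continuity of the inverse of [h], by compactness; it turns chains with small steps in
    [X] into chains with small steps in the disk. *)
Lemma inverse_uniform (e : R) : 0 < e -> exists2 del, 0 < del &
  forall z w, cdisk z -> cdisk w -> d (h z) (h w) < del -> edist z w < e.
Proof.
move=> e0; apply: contrapT => no.
have P n : exists zw : (R * R) * (R * R), [/\ cdisk zw.1, cdisk zw.2,
    d (h zw.1) (h zw.2) < n.+1%:R^-1 & e <= edist zw.1 zw.2].
  apply: contrapT => no2; apply: no; exists n.+1%:R^-1; first by rewrite invr_gt0.
  move=> z w hz hw hzw; rewrite ltNge; apply/negP => h2; apply: no2.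
  by exists (z, w).
have [f fP] := choice P.
have fd n : cdisk ((fst \o f) n) by have [] := fP n.
have [w wd wcl] := disk_cluster fd.
have [_ _ hc hi] := hd.
have e2 : 0 < e / 2 by rewrite divr_gt0.
have [del del0 hdel] := hi w wd _ e2.
have del2 : 0 < del / 2 by rewrite divr_gt0.
have [del' del'0 hdel'] := hc w wd _ del2.
have [N N0 NP] : exists2 N, (0 <= N)%N & forall n, (N <= n)%N -> n.+1%:R^-1 < del / 2.
  exists (Num.truncn (del / 2)^-1) => // n Nn.
  rewrite invf_plt ?posrE //.
  apply: lt_le_trans (truncnS_gt _) _; by rewrite ler_nat ltnS.
have m0 : 0 < Num.min (e / 2) del' by rewrite lt_min e2 del'0.
have [n Nn] := wcl _ m0 N; rewrite lt_min => /andP[c1 c2].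
have [zd ud dlt ege] := fP n.
have d1 : d (h w) (h (f n).1) < del / 2 by apply: hdel' => //; rewrite edistC.
have d2 : d (h w) (h (f n).2) < del.
  have := d_tri (h w) (h (f n).1) (h (f n).2); have := lt_trans dlt (NP n Nn); lra.
have := hdel _ ud d2; have := edist_tri (f n).1 w (f n).2; lra.
Qed.

(** Fine chains on the two paths come arbitrarily close to each other in the disk. At a cluster
    point of the close pairs both betweenness equations persist by continuity of [h]. *)
Lemma geodesics_cross (A B C D : R * R) : nsq A = 1 -> nsq B = 1 -> nsq C = 1 -> nsq D = 1 ->
  0 < cross (C - A) (B - A) -> cross (C - A) (D - A) < 0 ->
  exists o, d (h A) o + d o (h C) = d (h A) (h C) /\ d (h B) o + d o (h D) = d (h B) (h D).
Proof.
move=> hA hB hC hD cB cD.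
have [hinj hsur hc hi] := hd.
have e0 : 0 < nsq (C - A).
  rewrite /nsq lt_neqAle addr_ge0 ?sqr_ge0 // andbT eq_sym; apply/eqP => z.
  move: cB; rewrite /cross; move/eqP: z; rewrite paddr_eq0 ?sqr_ge0 // !sqrf_eq0.
  by move=> /andP[/eqP -> /eqP ->]; rewrite !mul0r subrr ltxx.
have P k : exists zw : (R * R) * (R * R), [/\ cdisk zw.1, cdisk zw.2, 
   edist zw.1 zw.2 < k.+1%:R^-1,
   d (h A) (h zw.1) + d (h zw.1) (h C) = d (h A) (h C) &
   d (h B) (h zw.2) + d (h zw.2) (h D) = d (h B) (h D)].
  set r := k.+1%:R^-1.
  have r0 : 0 < r by rewrite invr_gt0.
  (* The minimum [q] with 1 satisfies [q ^ 2 <= q <= nsq (C - A)], which absorbs the factor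
     [nsq (C - A)] in [chains_cross]; the 8 beats the constant 32, as [32 / 8 ^ 2 < 1]. *)
  pose eta := Num.min 1 (nsq (C - A)) * r / 8.
  have m0 : 0 < Num.min 1 (nsq (C - A)) by rewrite lt_min e0 ltr01.
  have eta0 : 0 < eta by rewrite /eta divr_gt0 // mulr_gt0.
  have [del del0 hdel] := inverse_uniform eta0.
  have [n nP] : exists n, (d (h A) (h C) + d (h B) (h D)) / 2 ^+ n < del.
    pose M := (d (h A) (h C) + d (h B) (h D)).
    have M0 : 0 <= M by rewrite addr_ge0.
    exists (Num.truncn (M / del)).+1; rewrite ltr_pdivrMr ?exprn_gt0 // mulrC -ltr_pdivrMr //.
    apply: lt_le_trans (truncnS_gt _) _.
    by rewrite -natrX ler_nat ltnW // ltn_expl.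
  have lt1 : d (h A) (h C) / 2 ^+ n < del.
    by apply: le_lt_trans nP; rewrite ler_pM2r ?invr_gt0 ?exprn_gt0 // lerDl.
  have lt2 : d (h B) (h D) / 2 ^+ n < del.
    by apply: le_lt_trans nP; rewrite ler_pM2r ?invr_gt0 ?exprn_gt0 // lerDr.
  have [c1 [c10 c11 c1s c1g]] := midpoint_chain_geodesic n (h A) (h C).
  have [c2 [c20 c21 c2s c2g]] := midpoint_chain_geodesic n (h B) (h D).
  have hsur' x : exists z, cdisk z /\ h z = x by have [z zd <-] := hsur x; exists z.
  have [g gP] := choice hsur'.
  have gh z : cdisk z -> g (h z) = z.
    by move=> zd; have [g1 g2] := gP (h z); apply: hinj.
  have dsk z : nsq z = 1 -> cdisk z by rewrite /cdisk /= -/(nsq z) => ->.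
  have [||||||||i [j [il jl ij]]] := @chains_cross R A B C D (2 ^ n) (2 ^ n) (g \o c1) (g \o c2) eta
    (ltW eta0) hA hB hC hD cB cD.
  - by rewrite /= c10 gh //; apply: dsk.
  - by rewrite /= c11 gh //; apply: dsk.
  - by rewrite /= c20 gh //; apply: dsk.
  - by rewrite /= c21 gh //; apply: dsk.
  - by move=> i _; have [] := gP (c1 i).
  - by move=> i _; have [] := gP (c2 i).
  - move=> i il; apply: ltW; rewrite -edist_lt // edistC; apply: hdel; [exact: (gP _).1|exact: (gP _).1|].
    by rewrite /= !(gP _).2 c1s.
  - move=> i il; apply: ltW; rewrite -edist_lt // edistC; apply: hdel; [exact: (gP _).1|exact: (gP _).1|].
    by rewrite /= !(gP _).2 c2s.
  exists (g (c1 i), g (c2 j)); rewrite /= !(gP _).2; split.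
  - exact: (gP _).1.
  - exact: (gP _).1.
  - rewrite edist_lt // -(ltr_pM2l e0); apply: le_lt_trans ij _.
    rewrite /eta; set q := Num.min _ _.
    have q1 : q <= 1 by rewrite ge_min lexx.
    have q2 : q <= nsq (C - A) by rewrite ge_min lexx orbT.
    have -> : 32 * (q * r / 8) ^+ 2 = q ^+ 2 * r ^+ 2 / 2 by field.
    have := exprn_gt0 2 r0; move: (r ^+ 2) => rr rr0.
    have q0 : 0 < q by [].
    have qq : q ^+ 2 <= q by rewrite expr2 -[X in _ <= X]mulr1 ler_pM2l.
    have := ler_wpM2r (ltW rr0) (le_trans qq q2); have := mulr_gt0 e0 rr0; lra.
  - exact: c1g.
  - exact: c2g.
have [f fP] := choice P.
have fd n : cdisk ((fst \o f) n) by have [] := fP n.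
have [w wd wcl] := disk_cluster fd.
exists (h w).
have near e : 0 < e -> exists n, d (h w) (h (f n).1) < e /\ d (h w) (h (f n).2) < e.
  move=> ep; have [del del0 hdel] := hc w wd _ ep.
  have del2 : 0 < del / 2 by rewrite divr_gt0.
  have [N N0 NP] : exists2 N, (0 <= N)%N & forall n, (N <= n)%N -> n.+1%:R^-1 < del / 2.
    exists (Num.truncn (del / 2)^-1) => // n Nn.
    rewrite invf_plt ?posrE //.
    apply: lt_le_trans (truncnS_gt _) _; by rewrite ler_nat ltnS.
  have [n Nn] := wcl _ del2 N; have [z1 z2 z3 z4 z5] := fP n => h1.
  exists n; split; apply: hdel => //; first by rewrite edistC; move: h1 => /=; lra.
  have := edist_tri w (f n).1 (f n).2; rewrite [edist w (f n).1]edistC; have := lt_trans z3 (NP n Nn); move: h1 => /=; lra.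
split; apply/eqP; rewrite eq_le d_tri andbT; apply/ler_addgt0Pr => e ep.
- have [|n [h1 _]] := near (e / 2); first by rewrite divr_gt0.
  have [_ _ _ z4 _] := fP n.
  have := d_tri (h A) (h (f n).1) (h w); have := d_tri (h w) (h (f n).1) (h C).
  by rewrite [d (h (f n).1) (h w)]dC; lra.
- have [|n [_ h1]] := near (e / 2); first by rewrite divr_gt0.
  have [_ _ _ _ z4] := fP n.
  have := d_tri (h B) (h (f n).2) (h w); have := d_tri (h w) (h (f n).2) (h D).
  by rewrite [d (h (f n).2) (h w)]dC; lra.
Qed.

End Geodesics.


(** * Chords of the unit circle *)

Section Circle.
Variable R : realType.

Lemma unit_collinear (A C Z : R * R) : nsq A = 1 -> nsq C = 1 -> nsq Z = 1 -> C <> A ->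
  cross (C - A) (Z - A) = 0 -> Z = A \/ Z = C.
Proof.
case: A C Z => a1 a2 [c1 c2] [z1 z2]; rewrite /nsq /cross /= => hA hC hZ ne cr.
have e0 : (c1 - a1) ^+ 2 + (c2 - a2) ^+ 2 != 0.
  rewrite paddr_eq0 ?sqr_ge0 // !sqrf_eq0 !subr_eq0; apply/negP => /andP[/eqP h1 /eqP h2].
  by apply: ne; rewrite h1 h2.
set E := _ + _ in e0.
pose l := ((z1 - a1) * (c1 - a1) + (z2 - a2) * (c2 - a2)) / E.
have lE : l * E = (z1 - a1) * (c1 - a1) + (z2 - a2) * (c2 - a2) by rewrite /l divfK.
have h1 : z1 - a1 = l * (c1 - a1).
  apply: (mulIf e0); rewrite mulrAC lE /E; apply/eqP; rewrite -subr_eq0; apply/eqP.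
  transitivity (- (c2 - a2) * ((c1 - a1) * (z2 - a2) - (c2 - a2) * (z1 - a1))); first by ring.
  by rewrite cr mulr0.
have h2 : z2 - a2 = l * (c2 - a2).
  apply: (mulIf e0); rewrite mulrAC lE /E; apply/eqP; rewrite -subr_eq0; apply/eqP.
  transitivity ((c1 - a1) * ((c1 - a1) * (z2 - a2) - (c2 - a2) * (z1 - a1))); first by ring.
  by rewrite cr mulr0.
have : l * (l - 1) * E = 0.
  have z1E : z1 = a1 + l * (c1 - a1) by rewrite -h1; ring.
  have z2E : z2 = a2 + l * (c2 - a2) by rewrite -h2; ring.
  have : (z1 ^+ 2 + z2 ^+ 2) - (a1 ^+ 2 + a2 ^+ 2) - l * ((c1 ^+ 2 + c2 ^+ 2) - (a1 ^+ 2 + a2 ^+ 2)) = 0.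
    by rewrite hA hC hZ; ring.
  by rewrite z1E z2E /E => <-; ring.
move/eqP; rewrite mulf_eq0 (negbTE e0) orbF mulf_eq0 => /orP[/eqP l0|].
  left; move: h1 h2; rewrite l0 !mul0r => /eqP; rewrite subr_eq0 => /eqP ->.
  by move/eqP; rewrite subr_eq0 => /eqP ->.
rewrite subr_eq0 => /eqP l1; right; move: h1 h2; rewrite l1 !mul1r => /eqP.
by rewrite (inj_eq (addIr _)) => /eqP -> /eqP; rewrite (inj_eq (addIr _)) => /eqP ->.
Qed.

(** The witnesses are the two unit normals to the chord: its line is at distance [|q| / r < 1] from
    the centre, so they lie strictly on opposite sides of it. *)
Lemma unit_both_sides (A C : R * R) : nsq A = 1 -> nsq C = 1 -> C <> A ->
  (exists2 Z, nsq Z = 1 & 0 < cross (C - A) (Z - A)) /\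
  (exists2 Z, nsq Z = 1 & cross (C - A) (Z - A) < 0).
Proof.
case: A C => a1 a2 [c1 c2]; rewrite /nsq /cross /= => hA hC ne.
have E0 : 0 < (c1 - a1) ^+ 2 + (c2 - a2) ^+ 2.
  rewrite lt_neqAle addr_ge0 ?sqr_ge0 // andbT eq_sym.
  rewrite paddr_eq0 ?sqr_ge0 // !sqrf_eq0 !subr_eq0; apply/negP => /andP[/eqP h1 /eqP h2].
  by apply: ne; rewrite h1 h2.
set E := _ + _ in E0; pose r := Num.sqrt E.
have r0 : 0 < r by rewrite sqrtr_gt0.
have r2 : r ^+ 2 = E by rewrite sqr_sqrtr // ltW.
pose q := c1 * a2 - c2 * a1.
have qr : `|q| < r.
  rewrite -(@ltr_sqr _ `|q|) ?nnegrE ?(ltW r0) // real_normK ?num_real // r2.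
  have e1 : E = 2 * (1 - (c1 * a1 + c2 * a2)).
    by rewrite /E; transitivity ((c1 ^+ 2 + c2 ^+ 2) + (a1 ^+ 2 + a2 ^+ 2) - 2 * (c1 * a1 + c2 * a2));
      [ring|rewrite hA hC; ring].
  have e2 : q ^+ 2 = 1 - (c1 * a1 + c2 * a2) ^+ 2.
    by rewrite /q; transitivity ((c1 ^+ 2 + c2 ^+ 2) * (a1 ^+ 2 + a2 ^+ 2) - (c1 * a1 + c2 * a2) ^+ 2);
      [ring|rewrite hA hC; ring].
  move: E0; rewrite e1 e2; move: (c1 * a1 + c2 * a2) => u u1; have : 0 < (1 - u) ^+ 2 by rewrite exprn_gt0 //; lra.
  lra.
have nu : ((- (c2 - a2) / r) ^+ 2 + ((c1 - a1) / r) ^+ 2) = 1.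
  rewrite !exprMn exprVn r2 sqrrN -mulrDl addrC divff //; exact: lt0r_neq0.
have cE : (c1 - a1) * ((c1 - a1) / r) - (c2 - a2) * (- (c2 - a2) / r) = r.
  transitivity (E / r); first by rewrite /E; field; rewrite gt_eqF.
  by rewrite -r2 expr2 mulfK ?gt_eqF.
move: qr; rewrite ltr_norml => /andP[q1 q2]; split.
- exists (- (c2 - a2) / r, (c1 - a1) / r) => //=.
  by rewrite /q in q1 q2; lra.
- exists ((c2 - a2) / r, - (c1 - a1) / r) => /=.
    by rewrite -nu !mulNr !sqrrN; ring.
  by rewrite /q in q1 q2; lra.
Qed.

Lemma nonvanishing_sign (f : R -> R) (s t : R) : continuous f -> s <= t ->
  (forall x, s <= x <= t -> f x != 0) -> (0 < f s) = (0 < f t).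
Proof.
move=> cf st nz.
have cf' : {within `[s, t], continuous f} by apply: continuous_subspaceT.
apply/idP/idP => h; rewrite ltNge; apply/negP => h'.
- have [|c] := IVT (v := 0) st cf'; first by rewrite ge_min h' orbT le_max (ltW h).
  by rewrite in_itv /= => /nz /eqP.
- have [|c] := IVT (v := 0) st cf'; first by rewrite ge_min h' le_max (ltW h) orbT.
  by rewrite in_itv /= => /nz /eqP.
Qed.

End Circle.

(** * The boundary curve and interlaced boundary points *)

Section Boundary.
Variables (R : realType) (X : Type) (d : X -> X -> R) (h : R * R -> X).
Variables (L : R) (sigma : R -> X).
Hypothesis dm : is_metric d.
Hypothesis mid : has_midpoints d.
Hypothesis hd : homeo_disk d h.
Hypothesis ap : arclength_param d (h @` (@ucircle R)) L sigma.

Let dC x y : d x y = d y x. Proof. by case: dm. Qed.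

Lemma L_gt0 : 0 < L. Proof. by case: ap. Qed.

Lemma sigma_lip (s t : R) : d (sigma s) (sigma t) <= `|s - t|.
Proof.
wlog st : s t / s <= t.
  move=> W; case: (leP s t) => h1; first exact: W.
  by rewrite dC distrC; apply: W; apply: ltW.
have [_ _ _ _ /(_ s t st) [+ _]] := ap.
move=> /(_ [:: s; t]); rewrite /Defs.partition /= andbT => /(_ _).
rewrite /poly_length /= big_ord1 /= distrC ger0_norm ?subr_ge0 //; apply.
by split.
Qed.

Lemma sigma_periodn (t : R) (n : nat) : sigma (t + n%:R * L) = sigma t.
Proof.
have [_ p _ _ _] := ap; elim: n => [|n IH]; first by rewrite mul0r addr0.
by rewrite -natr1 mulrDl mul1r addrA p IH.
Qed.

Lemma sigma_period (t : R) (k : int) : sigma (t + k%:~R * L) = sigma t.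
Proof.
case: k => n; first exact: sigma_periodn.
rewrite NegzE mulrNz mulNr -[RHS](sigma_periodn _ n.+1).
by rewrite -(sigma_periodn (_ - _) n.+1) subrK -(sigma_periodn _ n.+1) //.
Qed.

Lemma sigma_shift (t0 t : R) : exists2 s, t0 <= s < t0 + L & sigma s = sigma t.
Proof.
have L0 := L_gt0.
exists (t + (- Num.floor ((t - t0) / L))%:~R * L); last exact: sigma_period.
have /andP[f1 f2] := floor_itv ((t - t0) / L).
rewrite intrD mulr1z in f2; rewrite mulrNz mulNr; move: f1 f2; rewrite ler_pdivlMr // ltr_pdivrMr //.
by move=> f1 f2; apply/andP; split; lra.
Qed.

Lemma sigma_inj (s t : R) : s < t -> t < s + L -> sigma s <> sigma t.
Proof.
move=> st ts E; have L0 := L_gt0.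
pose k := (- Num.floor (s / L))%:~R * L.
have /andP[f1 f2] := floor_itv (s / L).
have kE : k = - ((Num.floor (s / L))%:~R * L) by rewrite /k mulrNz mulNr.
rewrite intrD mulr1z in f2; move: f1 f2; rewrite ler_pdivlMr // ltr_pdivrMr // => f1 f2.
have [_ p inj _ _] := ap.
have E' : sigma (s + k) = sigma (t + k) by rewrite !sigma_period.
case: (ltP (t + k) L) => tk.
  have := inj (s + k) (t + k); rewrite kE; rewrite kE in tk E' => /(_ _ _ _ _ E').
  by move=> H; have := H; lra.
have E2 : sigma (s + k) = sigma (t + k - L) by rewrite E' -[RHS]p subrK.
have : s + k = t + k - L by apply: inj => //; lra.
lra.
Qed.

Lemma boundary_inverse : exists G : R -> R * R,
  [/\ forall t, nsq (G t) = 1, forall t, h (G t) = sigma t,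
      forall z, nsq z = 1 -> exists t, G t = z &
      continuous (fun t => (G t).1) /\ continuous (fun t => (G t).2)].
Proof.
have [hinj hsur hc hi] := hd; have [_ _ _ rg _] := ap.
have dsk (z : R * R) : nsq z = 1 -> cdisk z by rewrite /cdisk /= -/(nsq z) => ->.
have P t : exists z, nsq z = 1 /\ h z = sigma t.
  have : (range sigma) (sigma t) by exists t.
  by rewrite rg => -[z z1 z2]; exists z.
have [G GP] := choice P; exists G; split.
- by move=> t; have [] := GP t.
- by move=> t; have [] := GP t.
- move=> z z1; have : (h @` (@ucircle R)) (h z) by exists z.
  rewrite -rg => -[t _ tz]; exists t; have [g1 g2] := GP t.
  by apply: hinj; [exact: dsk|exact: dsk|rewrite g2].
- have cont t e : 0 < e -> exists2 del, 0 < del & forall s, `|t - s| < del -> edist (G t) (G s) < e.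
    move=> e0; have [g1 g2] := GP t; have [del del0 H] := hi _ (dsk _ g1) _ e0.
    exists del => // s ts; have [g3 g4] := GP s; apply: H; first exact: dsk.
    by rewrite g2 g4; apply: le_lt_trans (sigma_lip _ _) ts.
  have le1 (z w : R * R) : `|z.1 - w.1| <= edist z w.
    by rewrite /edist -sqrtr_sqr ler_wsqrtr // lerDl sqr_ge0.
  have le2 (z w : R * R) : `|z.2 - w.2| <= edist z w.
    by rewrite /edist -sqrtr_sqr ler_wsqrtr // lerDr sqr_ge0.
  split => t; apply/cvgrPdist_lt => e e0; have [del del0 H] := cont t e e0;
    apply/nbhs_ballP; exists del => // s ts.
  - by apply: le_lt_trans; [exact: le1|exact: H].
  - by apply: le_lt_trans; [exact: le2|exact: H].
Qed.

(** The chord from [G t0] to [G t2] is met by the circle only at its ends, so [f] has a constant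
    sign on each of the two arcs. Both signs occur on the circle, hence the arcs have opposite
    signs; no monotone lift of the angle is needed. *)
Lemma boundary_cross (t0 t1 t2 t3 : R) : t0 < t1 -> t1 < t2 -> t2 < t3 -> t3 < t0 + L ->
  exists o, d (sigma t0) o + d o (sigma t2) = d (sigma t0) (sigma t2) /\
            d (sigma t1) o + d o (sigma t3) = d (sigma t1) (sigma t3).
Proof.
move=> t01 t12 t23 t30.
have [G [G1 Gh Gs [c1 c2]]] := boundary_inverse.
have Gne s t : s < t -> t < s + L -> G s <> G t.
  by move=> st ts E; apply: (sigma_inj st ts); rewrite -!Gh E.
have ne : G t2 <> G t0 by apply/nesym/Gne; lra.
pose f t := cross (G t2 - G t0) (G t - G t0).
have cf : continuous f.
  move=> t; rewrite /f /cross /=.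
  apply: cvgB; (apply: cvgM; [exact: cvg_cst|apply: cvgB; [|exact: cvg_cst]]).
    exact: c2.
  exact: c1.
have f0 t : t0 < t -> t < t0 + L -> t != t2 -> f t != 0.
  move=> h1 h2 n2; apply/eqP => /(unit_collinear (G1 t0) (G1 t2) (G1 t) ne) [].
    by apply/nesym/Gne.
  case: (ltgtP t t2) n2 => // h3 _; first by apply: Gne; lra.
  by apply/nesym/Gne; lra.
have I1 s t : t0 < s -> s <= t -> t < t2 -> (0 < f s) = (0 < f t).
  move=> h1 h2 h3; apply: nonvanishing_sign => // x /andP[x1 x2].
  by apply: f0; [lra|lra|rewrite lt_eqF //; lra].
have I2 s t : t2 < s -> s <= t -> t < t0 + L -> (0 < f s) = (0 < f t).
  move=> h1 h2 h3; apply: nonvanishing_sign => // x /andP[x1 x2].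
  by apply: f0; [lra|lra|rewrite gt_eqF //; lra].
have J1 s : t0 < s -> s < t2 -> (0 < f s) = (0 < f t1).
  by move=> h1 h2; case: (leP s t1) => h3; [apply: I1 | apply/esym/I1 => //; apply: ltW].
have J2 s : t2 < s -> s < t0 + L -> (0 < f s) = (0 < f t3).
  by move=> h1 h2; case: (leP s t3) => h3; [apply: I2 | apply/esym/I2 => //; apply: ltW].
have loc z : nsq z = 1 -> cross (G t2 - G t0) (z - G t0) != 0 ->
    exists2 t, f t = cross (G t2 - G t0) (z - G t0) & (t0 < t < t2) \/ (t2 < t < t0 + L).
  move=> z1 z2; have [t tz] := Gs z z1; have [s /andP[s1 s2] st] := sigma_shift t0 t.
  have Gst : G s = z.
    have [hinj _ _ _] := hd.
    have dsk (w : R * R) : nsq w = 1 -> cdisk w by rewrite /cdisk /= -/(nsq w) => ->.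
    by rewrite -tz; apply: hinj; [exact: dsk|exact: dsk|rewrite !Gh].
  have sf : f s = cross (G t2 - G t0) (z - G t0) by rewrite /f Gst.
  exists s => //.
  have n0 : s != t0.
    apply: contra z2 => /eqP E; rewrite -sf E /f /cross /= !subrr !mulr0 subrr //.
  have n2 : s != t2.
    by apply: contra z2 => /eqP E; rewrite -sf E /f /cross /=; apply/eqP; ring.
  have s0 : t0 < s by rewrite lt_neqAle eq_sym n0.
  by case: (ltgtP s t2) n2 => // h1 _; [left|right]; rewrite ?s0 ?h1.
have [[Zp zp1 zp2] [Zm zm1 zm2]] := unit_both_sides (G1 t0) (G1 t2) ne.
have [tp ep lp] := loc Zp zp1 (lt0r_neq0 zp2).
have [tm em lm] := loc Zm zm1 (ltr0_neq0 zm2).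
have fp : 0 < f tp by rewrite ep.
have fm : (0 < f tm) = false by apply/negbTE; rewrite -leNgt em ltW.
have n1 : f t1 != 0 by apply: f0; [lra|lra|rewrite lt_eqF].
have n3 : f t3 != 0 by apply: f0; [lra|lra|rewrite gt_eqF].
have opp : (0 < f t1 /\ f t3 < 0) \/ (0 < f t3 /\ f t1 < 0).
  case: lp => /andP[p1 p2]; case: lm => /andP[m1 m2].
  - by move: fm; rewrite (J1 tm) // -(J1 tp) // fp.
  - left; rewrite -(J1 tp) // fp; split => //; rewrite ltNge; apply/negP => h3.
    by move: fm; rewrite (J2 tm) // lt_neqAle eq_sym n3 h3.
  - right; rewrite -(J2 tp) // fp; split => //; rewrite ltNge; apply/negP => h3.
    by move: fm; rewrite (J1 tm) // lt_neqAle eq_sym n1 h3.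
  - by move: fm; rewrite (J2 tm) // -(J2 tp) // fp.
rewrite -!Gh; case: opp => [[u1 u2]|[u1 u2]].
  exact: (geodesics_cross dm mid hd (G1 t0) (G1 t1) (G1 t2) (G1 t3)).
have [x [h1 h2]] := geodesics_cross dm mid hd (G1 t0) (G1 t3) (G1 t2) (G1 t1) u1 u2.
by exists x; split => //; rewrite addrC dC [d (h (G t1)) x]dC h2 dC.
Qed.

End Boundary.

(** * Evolution of the comparison angle along the boundary *)

Section TrigBounds.
Variable R : realType.

Lemma cos_ge_quad (x : R) : 1 - x ^+ 2 / 2 <= cos x.
Proof.
have -> : x = (x / 2) *+ 2 by rewrite -mulr_natr divfK.
rewrite cos_mulr2n cos2sin2; have := norm_sin_le (x / 2).
rewrite -(@ler_sqr _ `|_| `|_|) ?nnegrE // !real_normK ?num_real //.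
lra.
Qed.

Lemma sin_ge_quad (x : R) : 0 <= x -> x <= 1 -> x - x ^+ 2 / 2 <= sin x.
Proof.
rewrite le_eqVlt => /orP[/eqP <- _|x0 x1]; first by rewrite sin0; lra.
have cs : {within `[0, x], continuous (@sin R)}.
  by apply: continuous_subspaceT => z; exact: continuous_sin.
have [c] := @MVT R (@sin R) (@cos R) 0 x x0 (fun y _ => is_derive_sin y) cs.
rewrite sin0 !subr0 in_itv /= => /andP[c0 cx] ->.
have h := cos_ge_quad c.
have : 1 - x / 2 <= cos c by nra.
by nra.
Qed.

Lemma sin_add_ge (t w : R) : 0 <= t <= pi -> 0 <= cos t -> 0 <= w -> w <= 1 ->
  sin t + w * cos t - w ^+ 2 <= sin (t + w).
Proof.
move=> t1 ct w0 w1; rewrite sinD.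
have h1 := sin_ge_quad w0 w1; have h2 := cos_ge_quad w.
have st : 0 <= sin t by apply: sin_ge0_pi.
have st1 := sin_le1 t; have ct1 := cos_le1 t.
have : sin t * (1 - w ^+ 2 / 2) <= sin t * cos w by rewrite ler_wpM2l.
have : cos t * (w - w ^+ 2 / 2) <= cos t * sin w by rewrite ler_wpM2l.
have : sin t * w ^+ 2 <= w ^+ 2 by rewrite ler_piMl // sqr_ge0.
have : cos t * w ^+ 2 <= w ^+ 2 by rewrite ler_piMl // sqr_ge0.
lra.
Qed.

Lemma cos_ge0_lepihalf (t : R) : 0 <= t <= pi -> (0 <= cos t) = (t <= pi / 2).
Proof.
move=> t1; have pp := pi_gt0 R.
rewrite -(cos_pihalf R) !leNgt ltr_cos ?in_itv //=; lra.
Qed.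

End TrigBounds.

(** * One step along the boundary, in model coordinates *)

Section Step.
Variables (R : realType) (K k : R).
Hypothesis K_ge0 : 0 <= K.
Hypothesis k_gt0 : 0 < k.
Local Notation SyK := (Sy K).

(** Sides are measured by their chords: [A ^ 2 / 2] is [md] of a side of chord [A], and up to size
    [e] its [Sy] agrees with [A] up to a relative error of order [e ^ 2]. *)
Lemma Sy_chord (e A : R) : 0 <= A -> A <= e -> K * e ^+ 2 <= 1 ->
  [/\ A / 2 <= SyK (A ^+ 2 / 2), SyK (A ^+ 2 / 2) <= A,
      A * (1 - K * e ^+ 2 / 4) <= SyK (A ^+ 2 / 2) &
      SyK (A ^+ 2 / 2) ^+ 2 = A ^+ 2 * (1 - K * A ^+ 2 / 4)].
Proof.
move=> A0 Ae Ke.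
have Ae2 : A ^+ 2 <= e ^+ 2 by rewrite ler_sqr ?nnegrE // (le_trans A0).
have KA : K * A ^+ 2 <= K * e ^+ 2 by rewrite ler_wpM2l.
have KA0 : 0 <= K * A ^+ 2 by rewrite mulr_ge0 ?sqr_ge0.
have A20 := sqr_ge0 A.
have sq : SyK (A ^+ 2 / 2) ^+ 2 = A ^+ 2 * (1 - K * A ^+ 2 / 4).
  rewrite Sy_sqr; [by field|by rewrite divr_ge0|lra].
have S0 : 0 <= SyK (A ^+ 2 / 2) by rewrite sqrtr_ge0.
have key : A * (1 - K * e ^+ 2 / 4) <= SyK (A ^+ 2 / 2).
  rewrite -ler_sqr ?nnegrE ?mulr_ge0 //; last by lra.
  rewrite sq exprMn ler_wpM2l //.
  have : 0 <= K * e ^+ 2 by rewrite mulr_ge0 ?sqr_ge0.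
  move: (K * e ^+ 2) Ke KA => q q1 q2 q0; nra.
split => //.
- apply: le_trans key; have : 0 <= A * (1 - K * e ^+ 2) by rewrite mulr_ge0 // subr_ge0.
  have : 0 <= A * (K * e ^+ 2) by rewrite mulr_ge0 // mulr_ge0 ?sqr_ge0.
  lra.
- by rewrite -ler_sqr ?nnegrE // sq ler_piMr //; lra.
Qed.

(** In the plane, [chi] is twice the sine of the angle [T] over the opposite side, so [chi >= k]
    bounds the sine of the turn [pi - T] below by [k / 2] times that side; for a small turn the side
    is nearly [A0 + A1]. Curvature [K] only adds to the error term. *)
Lemma turn_lower_bound (e A0 A1 zu T : R) :
  0 < A0 -> 0 < A1 -> A0 <= e -> A1 <= e -> e <= 1 -> (K + k ^+ 2) * e ^+ 2 <= 1 ->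
  0 <= T <= pi ->
  zu = A0 ^+ 2 / 2 + A1 ^+ 2 / 2 - K * (A0 ^+ 2 / 2) * (A1 ^+ 2 / 2)
       - SyK (A0 ^+ 2 / 2) * SyK (A1 ^+ 2 / 2) * cos T ->
  2 * k ^+ 2 * (A0 ^+ 2 / 2) * (A1 ^+ 2 / 2) * zu <= Del K (A0 ^+ 2 / 2) (A1 ^+ 2 / 2) zu ->
  k / 2 * (A0 + A1) - k * (K + k ^+ 2) * e ^+ 2 <= pi - T.
Proof.
move=> A00 A10 A0e A1e e1 Qe Tp zuE curv.
set w := pi - T.
have e0 : 0 < e by apply: lt_le_trans A0e.
set P := A0 + A1; set Q := K + k ^+ 2.
have Q0 : 0 <= Q by rewrite addr_ge0 ?sqr_ge0.
have kQ : 0 <= k * Q * e ^+ 2 by rewrite !mulr_ge0 ?sqr_ge0 // ltW.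
(* From here on the turn is below [k * e], so that [cos w] is 1 up to order [e ^ 2] and the opposite
   side is nearly [A0 + A1]. *)
case: (leP (k / 2 * P) w) => hw; first by lra.
have w0 : 0 <= w by rewrite /w; lra.
have e20 := sqr_ge0 e.
have Ke1 : K * e ^+ 2 <= 1.
  by apply: le_trans Qe; rewrite ler_wpM2r // lerDl sqr_ge0.
have [_ u0 l0 q0] := Sy_chord (ltW A00) A0e Ke1.
have [_ u1 l1 q1] := Sy_chord (ltW A10) A1e Ke1.
set s0 := SyK _ in u0 l0 q0 zuE; set s1 := SyK _ in u1 l1 q1 zuE.
have s00 : 0 <= s0 by rewrite sqrtr_ge0.
have s10 : 0 <= s1 by rewrite sqrtr_ge0.
have cw : cos T = - cos w by rewrite /w cosB cospi sinpi; ring.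
have sw : sin T = sin w by rewrite /w sinB cospi sinpi; ring.
have ke1 : k ^+ 2 * e ^+ 2 <= 1.
  by apply: le_trans Qe; rewrite ler_wpM2r // lerDr.
have Pe : P <= 2 * e by rewrite /P; lra.
have P0 : 0 < P by rewrite /P addr_gt0.
have wke : w <= k * e by apply: le_trans (ltW hw) _; rewrite -mulrA ler_pM2l //; lra.
have w2 : w ^+ 2 <= k ^+ 2 * e ^+ 2.
  by rewrite -exprMn ler_sqr ?nnegrE // mulr_ge0 // ltW.
have cwl : 1 - k ^+ 2 * e ^+ 2 / 2 <= cos w by have := cos_ge_quad w; lra.
have AA : 0 < A0 * A1 by rewrite mulr_gt0.
have Ke0 : 0 <= K * e ^+ 2 by rewrite mulr_ge0.
have ss : A0 * A1 * (1 - K * e ^+ 2 / 2) <= s0 * s1.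
  have : (A0 * (1 - K * e ^+ 2 / 4)) * (A1 * (1 - K * e ^+ 2 / 4)) <= s0 * s1.
    by apply: ler_pM => //; apply: mulr_ge0; lra.
  apply: le_trans; rewrite mulrACA; rewrite ler_pM2l //.
  have := sqr_ge0 (K * e ^+ 2); lra.
have ke0 : 0 <= k ^+ 2 * e ^+ 2 by rewrite mulr_ge0 ?sqr_ge0.
have zul : P ^+ 2 / 2 * (1 - Q * e ^+ 2) <= zu.
  have p1 : A0 * A1 * (1 - K * e ^+ 2 / 2) * (1 - k ^+ 2 * e ^+ 2 / 2) <= s0 * s1 * cos w.
    apply: ler_pM => //; last by lra.
    by rewrite mulr_ge0 ?(ltW AA) //; lra.
  have p2 : K * A0 ^+ 2 * A1 ^+ 2 <= K * e ^+ 2 * (A0 * A1).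
    have : A0 * A1 <= e ^+ 2 by rewrite expr2; apply: ler_pM => //; apply: ltW.
    move=> /(ler_wpM2l (mulr_ge0 K_ge0 (ltW AA))); lra.
  have p3 : A0 * A1 <= P ^+ 2 / 4 by rewrite /P; have := sqr_ge0 (A0 - A1); lra.
  have p4 : 0 <= (P ^+ 2 / 4 - A0 * A1) * (K * e ^+ 2) by rewrite mulr_ge0 // subr_ge0.
  have p5 : 0 <= (P ^+ 2 / 4 - A0 * A1) * (k ^+ 2 * e ^+ 2) by rewrite mulr_ge0 // subr_ge0.
  have p6 : 0 <= A0 * A1 * (K * e ^+ 2) * (k ^+ 2 * e ^+ 2) by rewrite !mulr_ge0 // ltW.
  have p7 : 0 <= P ^+ 2 * (K * e ^+ 2) by rewrite mulr_ge0 ?sqr_ge0.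
  have p8 : 0 <= P ^+ 2 * (k ^+ 2 * e ^+ 2) by rewrite mulr_ge0 ?sqr_ge0.
  rewrite zuE cw; move: p1 p2 p3 p4 p5 p6 p7 p8; rewrite /P /Q; lra.
have DelE : Del K (A0 ^+ 2 / 2) (A1 ^+ 2 / 2) zu = s0 ^+ 2 * s1 ^+ 2 * sin w ^+ 2.
  have := sin2cos2 w; rewrite cw in zuE => ->; rewrite zuE q0 q1 /Del.
  have h0 : s0 ^+ 2 = A0 ^+ 2 * (1 - K * A0 ^+ 2 / 4) by [].
  have h1 : s1 ^+ 2 = A1 ^+ 2 * (1 - K * A1 ^+ 2 / 4) by [].
  transitivity (s0 ^+ 2 * s1 ^+ 2 * (1 - cos w ^+ 2) + (A0 ^+ 2 * (1 - K * A0 ^+ 2 / 4) * (A1 ^+ 2 * (1 - K * A1 ^+ 2 / 4)) - s0 ^+ 2 * s1 ^+ 2)).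
    by field.
  by rewrite h0 h1; ring.
have sw2 : k ^+ 2 * zu / 2 <= sin w ^+ 2.
  have A02 : 0 < A0 ^+ 2 by rewrite exprn_gt0.
  have A12 : 0 < A1 ^+ 2 by rewrite exprn_gt0.
  rewrite -(ler_pM2l (mulr_gt0 A02 A12)).
  apply: (@le_trans _ _ (s0 ^+ 2 * s1 ^+ 2 * sin w ^+ 2)).
    by rewrite -DelE; apply: le_trans curv; rewrite le_eqVlt; apply/orP; left; apply/eqP; field.
  rewrite ler_wpM2r ?sqr_ge0 //; apply: ler_pM; rewrite ?sqr_ge0 //.
    by rewrite ler_sqr ?nnegrE // ltW.
  by rewrite ler_sqr ?nnegrE // ltW.
have sl : k / 2 * P * (1 - Q * e ^+ 2) <= sin w.
  have Qe0 : 0 <= 1 - Q * e ^+ 2 by rewrite subr_ge0.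
  have wp : 0 <= w <= pi by rewrite /w; lra.
  rewrite -ler_sqr ?nnegrE ?sin_ge0_pi ?mulr_ge0 ?(ltW k_gt0) ?(ltW P0) //.
  apply: le_trans sw2.
  have := ler_wpM2l (sqr_ge0 k) zul => h.
  have : (1 - Q * e ^+ 2) ^+ 2 <= 1 - Q * e ^+ 2.
    by rewrite expr2 ler_piMr // gerBl mulr_ge0.
  move/(ler_wpM2l (mulr_ge0 (sqr_ge0 k) (sqr_ge0 P))); lra.
have := sin_le_id w0 => h.
have : k / 2 * P * (Q * e ^+ 2) <= k * Q * e ^+ 2.
  have : P / 2 <= 1 by lra.
  move/(ler_wpM2l kQ); lra.
lra.
Qed.

(* [s] and [c] are the sine and cosine of the angle at the current point, [y] and [yp] its
   and its predecessor's distance from the base point.  An obtuse angle counts as a right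
   one. *)
Definition Phi (S y yp c s : R) : R :=
  if c <= 0 then S - k * y else S * s - k * (y + yp) / 2.

(** [Sy y / y] is the geodesic curvature of the circle whose diameter [r] has [md r = y]; thus
    [k * y <= Sy y] says that [r] is at most the diameter of a circle of curvature [k]. *)
Lemma Sy_over_id_decr (y1 y2 : R) : 0 <= y2 -> y2 <= y1 -> K * y1 <= 2 ->
  SyK y1 * y2 <= SyK y2 * y1.
Proof.
move=> y20 y21 y12; have y10 := le_trans y20 y21.
have y22 : K * y2 <= 2 by apply: le_trans y12; rewrite ler_wpM2l.
rewrite -ler_sqr ?nnegrE ?mulr_ge0 ?sqrtr_ge0 // !exprMn !Sy_sqr //.
have : 0 <= y1 * y2 * (y1 - y2) by rewrite !mulr_ge0 // subr_ge0.
lra.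
Qed.

(** If [y] decreases, [Sy y / y] grows, so a negative defect is scaled towards 0 and a nonnegative
    one stays nonnegative; this is why the minimum with 0 appears. If [y] increases, by at most
    [eps], the bound [s0] makes [Sy] lose at most [eps / s0]. *)
Lemma defect_almost_mono (s0 eps y1 y2 : R) : 0 < s0 -> 0 <= y1 -> 0 <= y2 ->
  K * y1 <= 2 -> K * y2 <= 2 -> s0 <= SyK y1 -> s0 <= SyK y2 -> 0 <= eps -> y2 <= y1 + eps ->
  Num.min 0 (SyK y1 - k * y1) - (s0^-1 + k) * eps <= SyK y2 - k * y2.
Proof.
move=> s00 y10 y20 y12 y22 S1 S2 eps0 y21.
have m0 : Num.min 0 (SyK y1 - k * y1) <= 0 by rewrite ge_min lexx.
have m1 : Num.min 0 (SyK y1 - k * y1) <= SyK y1 - k * y1 by rewrite ge_min lexx orbT.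
have c0 : 0 <= (s0^-1 + k) * eps by rewrite mulr_ge0 // addr_ge0 ?invr_ge0 // ltW.
case: (leP y2 y1) => h.
  apply: (@le_trans _ _ (Num.min 0 (SyK y1 - k * y1))); first by rewrite gerBl.
  have yp : 0 < y1.
    rewrite lt_neqAle y10 andbT eq_sym; apply/eqP => z; move: S1.
    by rewrite z /Sy mulr0 expr0n /= mulr0 subr0 sqrtr0 leNgt s00.
  rewrite -(ler_pM2r yp) mulrBl.
  have := Sy_over_id_decr y20 h y12.
  have a1 : Num.min 0 (SyK y1 - k * y1) * y1 <= Num.min 0 (SyK y1 - k * y1) * y2 by rewrite ler_wnM2l.
  have a2 := ler_wpM2r y20 m1.
  lra.
have sq : SyK y2 ^+ 2 - SyK y1 ^+ 2 = (y2 - y1) * (2 - K * (y1 + y2)).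
  by rewrite !Sy_sqr //; ring.
have lo : - 2 * (y2 - y1) <= (SyK y2 - SyK y1) * (SyK y2 + SyK y1).
  rewrite -subr_sqr sq [X in _ <= X]mulrC ler_wpM2r ?subr_ge0 ?(ltW h) //; lra.
have : - (s0^-1 * (y2 - y1)) <= SyK y2 - SyK y1.
  rewrite leNgt; apply/negP => lt.
  have p : 0 < SyK y2 + SyK y1 by lra.
  have := ltr_pM2r p (SyK y2 - SyK y1) (- (s0^-1 * (y2 - y1))); rewrite lt => q.
  have : (s0^-1 * (y2 - y1)) * (2 * s0) <= (s0^-1 * (y2 - y1)) * (SyK y2 + SyK y1).
    rewrite ler_wpM2l //; last by lra.
    by rewrite mulr_ge0 ?invr_ge0 ?subr_ge0 // ltW.
  rewrite (_ : s0^-1 * (y2 - y1) * (2 * s0) = 2 * (y2 - y1)); last by field; rewrite gt_eqF.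
  lra.
have : s0^-1 * (y2 - y1) <= s0^-1 * eps by rewrite ler_wpM2l ?invr_ge0 ?(ltW s00) //; lra.
have : k * (y2 - y1) <= k * eps by rewrite ler_wpM2l ?(ltW k_gt0) //; lra.
lra.
Qed.

(** The errors of [Phi_step]: [sin p] against 1 near a right angle, the [e ^ 2] in differences of
    [y], the [w ^ 2] term of [sin (t + w)], the error of [turn_lower_bound], that of
    [defect_almost_mono], and the missing turn at a bad point. *)
Definition step_const (B s0 : R) : R :=
  4 * B / s0 ^+ 2 + 2 * k + B * k ^+ 2 + B * (k * (K + k ^+ 2)) + s0^-1 + B * k.

(** Discrete form of the derivative of [S sin theta - k Y]: [t] is the angle of the chord with the
    incoming side, [p] that with the outgoing one, [t'] the angle at the next point. By the law of
    sines [H], [S sin] changes only at the corner, by about [S * cos t * w] or more. The mean in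
    [Phi] changes by [(y2 - y0) / 2], at most about [S * cos t * (A0 + A1) / 2], which a turn [w] of
    [k / 2 * (A0 + A1)] pays for. *)
Lemma Phi_step (B s0 e b w A0 A1 y0 y1 y2 t p t' : R) :
  0 < s0 -> 0 < e -> K * e ^+ 2 <= 1 -> 0 <= b -> 0 < A0 -> A0 <= e -> 0 < A1 -> A1 <= e ->
  0 <= y1 -> 0 <= y2 -> K * y1 <= 2 -> K * y2 <= 2 ->
  s0 <= SyK y1 -> s0 <= SyK y2 -> SyK y1 <= B ->
  0 <= t <= pi -> 0 <= p <= pi -> 0 <= t' <= pi ->
  0 <= w -> w <= 1 -> w <= k * e -> t + w <= p ->
  k / 2 * (A0 + A1) - k * (K + k ^+ 2) * e ^+ 2 - b * k * e <= w ->
  y0 = y1 + A0 ^+ 2 / 2 - K * y1 * (A0 ^+ 2 / 2) - SyK y1 * SyK (A0 ^+ 2 / 2) * cos t ->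
  y2 = y1 + A1 ^+ 2 / 2 - K * y1 * (A1 ^+ 2 / 2) + SyK y1 * SyK (A1 ^+ 2 / 2) * cos p ->
  y1 = y2 + A1 ^+ 2 / 2 - K * y2 * (A1 ^+ 2 / 2) - SyK y2 * SyK (A1 ^+ 2 / 2) * cos t' ->
  SyK y1 * sin p = SyK y2 * sin t' ->
  Num.min 0 (Phi (SyK y1) y1 y0 (cos t) (sin t)) - step_const B s0 * (e ^+ 2 + b * e)
   <= Phi (SyK y2) y2 y1 (cos t') (sin t').
Proof.
move=> s00 e0 Ke b0 A00 A0e A10 A1e y10 y20 y12 y22 S1s S2s S1B tp pp tp' w0 w1 wke twp wl E0 E2 E1 H.
have [_ u0 _ _] := Sy_chord (ltW A00) A0e Ke.
have [l1 u1 _ _] := Sy_chord (ltW A10) A1e Ke.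
set S1 := SyK y1 in S1s S1B E0 E2 H *; set S2 := SyK y2 in S2s E1 H *.
set r0 := SyK (A0 ^+ 2 / 2) in u0 E0; set r1 := SyK (A1 ^+ 2 / 2) in l1 u1 E2 E1.
have r00 : 0 <= r0 by rewrite sqrtr_ge0.
have r10 : 0 <= r1 by rewrite sqrtr_ge0.
have S10 : 0 < S1 by apply: lt_le_trans S1s.
have S20 : 0 < S2 by apply: lt_le_trans S2s.
have B0 : 0 < B by apply: lt_le_trans S1B.
have e20 : 0 < e ^+ 2 by rewrite exprn_gt0.
have Fg0 : y2 <= y1 + e ^+ 2 ->
    Num.min 0 (S1 - k * y1) - (s0^-1 + k) * e ^+ 2 <= S2 - k * y2.
  by move=> le; apply: defect_almost_mono => //; exact: ltW.
have si0 : 0 < s0^-1 by rewrite invr_gt0.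
clearbody S1 S2 r0 r1.
set c1 := 4 * B / s0 ^+ 2.
have c10 : 0 <= c1 by rewrite divr_ge0 ?sqr_ge0 // mulr_ge0 // ltW.
set c0 := k * (K + k ^+ 2) in wl *.
have c00 : 0 <= c0 by rewrite mulr_ge0 ?addr_ge0 ?sqr_ge0 // ltW.
have c1E : c1 = 4 * B / s0 ^+ 2 by [].
have scE : step_const B s0 = c1 + 2 * k + B * k ^+ 2 + B * c0 + s0^-1 + B * k by [].
set si := s0^-1 in Fg0 si0 scE; clearbody c1 c0 si; set sc := step_const B s0 in scE *; clearbody sc.
have A0e2 : A0 ^+ 2 <= e ^+ 2 by rewrite ler_sqr ?nnegrE // ltW.
have A1e2 : A1 ^+ 2 <= e ^+ 2 by rewrite ler_sqr ?nnegrE // ltW.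
have A02 := sqr_ge0 A0; have A12 := sqr_ge0 A1.
have z01 : - (A0 ^+ 2 / 2) <= A0 ^+ 2 / 2 - K * y1 * (A0 ^+ 2 / 2) <= A0 ^+ 2 / 2.
  have := mulr_ge0 (mulr_ge0 K_ge0 y10) A02; have := ler_wpM2r A02 y12; clear; lra.
have z11 : - (A1 ^+ 2 / 2) <= A1 ^+ 2 / 2 - K * y1 * (A1 ^+ 2 / 2) <= A1 ^+ 2 / 2.
  have := mulr_ge0 (mulr_ge0 K_ge0 y10) A12; have := ler_wpM2r A12 y12; clear; lra.
have z12 : - (A1 ^+ 2 / 2) <= A1 ^+ 2 / 2 - K * y2 * (A1 ^+ 2 / 2) <= A1 ^+ 2 / 2.
  have := mulr_ge0 (mulr_ge0 K_ge0 y20) A12; have := ler_wpM2r A12 y22; clear; lra.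
have sp0 : 0 <= sin p by apply: sin_ge0_pi.
have sp1 := sin_le1 p.
have be0 : 0 <= b * e by rewrite mulr_ge0 // ltW.
have ctp : cos p <= cos t.
  by rewrite leNgt ltr_cos ?in_itv //= -leNgt; move: twp w0; clear; lra.
(* The outgoing side passes the foot of the perpendicular from the base point, so [- cos p] is at
   most [2 * e / s0] and [sin p] differs from 1 by order [e ^ 2]. *)
have F1 : cos p <= 0 -> 0 < cos t' -> S1 - c1 * e ^+ 2 <= S1 * sin p.
  move=> cp ct'; pose q := - cos p.
  have q0 : 0 <= q by rewrite oppr_ge0.
  have a1 : S1 * q * r1 <= A1 ^+ 2.
    have : 0 <= S2 * r1 * cos t' by rewrite !mulr_ge0 // ltW.
    rewrite /q; move: E1 E2 z11 z12; clear; lra.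
  have a2 : S1 * q <= 2 * e.
    have : S1 * q * (A1 / 2) <= S1 * q * r1 by rewrite ler_wpM2l // mulr_ge0 // ltW.
    move=> h; have : (S1 * q) * A1 <= (2 * A1) * A1 by move: h a1; clear; lra.
    rewrite ler_pM2r //; move: A1e; clear; lra.
  have a3 : s0 * q <= 2 * e by apply: le_trans a2; rewrite ler_wpM2r.
  have a4 : q ^+ 2 <= 4 * e ^+ 2 / s0 ^+ 2.
    rewrite ler_pdivlMr ?exprn_gt0 // mulrC -exprMn.
    rewrite (_ : 4 * e ^+ 2 = (2 * e) ^+ 2); last by ring.
    by rewrite ler_sqr ?nnegrE // mulr_ge0 // ltW.
  have a5 : 1 - q ^+ 2 <= sin p.
    rewrite /q sqrrN -sin2cos2 expr2; exact: ler_piMr.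
  have a6 : S1 * q ^+ 2 <= c1 * e ^+ 2.
    apply: (@le_trans _ _ (B * q ^+ 2)); first by rewrite ler_wpM2r ?sqr_ge0.
    apply: le_trans (ler_wpM2l (ltW B0) a4) _.
    by rewrite le_eqVlt c1E; apply/orP; left; apply/eqP; ring.
  have := ler_wpM2l (ltW S10) a5; move: a6; clear; lra.
have F3 : 0 < cos t -> 0 < cos t' -> S1 * sin (t + w) - c1 * e ^+ 2 <= S1 * sin p.
  move=> ct ct'; case: (leP 0 (cos p)) => cp.
    have : S1 * sin (t + w) <= S1 * sin p.
      rewrite ler_pM2l // leNgt; have := pi_gt0 R => pi0.
      move: cp; rewrite cos_ge0_lepihalf // => cp.
      move: cp w0 tp pp twp pi0; clear => *; rewrite ltr_sin ?in_itv /= -?leNgt; lra.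
    have := mulr_ge0 c10 (ltW e20); clear; lra.
  have := F1 (ltW cp) ct'; have : S1 * sin (t + w) <= S1 by rewrite ler_piMr ?(ltW S10) // sin_le1.
  clear; lra.
have F4 : 0 < cos t -> S1 * sin t + S1 * cos t * w - B * k ^+ 2 * e ^+ 2 <= S1 * sin (t + w).
  move=> ct; have := ler_wpM2l (ltW S10) (sin_add_ge tp (ltW ct) w0 w1).
  have w2 : w ^+ 2 <= k ^+ 2 * e ^+ 2 by rewrite -exprMn ler_sqr ?nnegrE // mulr_ge0 // ltW.
  have : S1 * w ^+ 2 <= B * (k ^+ 2 * e ^+ 2) by apply: ler_pM; rewrite ?sqr_ge0 // ltW.
  clear; lra.
have F5 : 0 < cos t -> k / 2 * (S1 * cos t * (A0 + A1)) - B * (c0 * e ^+ 2 + b * k * e) <= S1 * cos t * w.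
  move=> ct; have q0 : 0 <= S1 * cos t by rewrite mulr_ge0 // ltW.
  have qB : S1 * cos t <= B by apply: le_trans S1B; rewrite ler_piMr ?(ltW S10) ?cos_le1.
  have := ler_wpM2l q0 wl.
  have : (S1 * cos t) * (c0 * e ^+ 2 + b * k * e) <= B * (c0 * e ^+ 2 + b * k * e).
    rewrite ler_wpM2r // addr_ge0 //; first exact: mulr_ge0 c00 (ltW e20).
    by rewrite !mulr_ge0 // ltW.
  clear; lra.
have F6 : 0 < cos t -> S1 * (r1 * cos p + r0 * cos t) <= S1 * cos t * (A0 + A1).
  move=> ct; rewrite -mulrA ler_pM2l //.
  have : r1 * cos p <= A1 * cos t.
    apply: (@le_trans _ _ (r1 * cos t)); first by rewrite ler_wpM2l.
    by rewrite ler_wpM2r // ltW.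
  have : r0 * cos t <= A0 * cos t by rewrite ler_wpM2r // ltW.
  clear; lra.
have F6' : 0 < cos t -> S1 * (r0 * cos t) <= S1 * cos t * (A0 + A1).
  move=> ct; rewrite -mulrA ler_pM2l //.
  have : r0 * cos t <= A0 * cos t by rewrite ler_wpM2r // ltW.
  have : 0 <= A1 * cos t by rewrite mulr_ge0 // ltW.
  clear; lra.
have Fg : cos t' <= 0 -> Num.min 0 (S1 - k * y1) - (si + k) * e ^+ 2 <= S2 - k * y2.
  move=> ct'; apply: Fg0.
  have : S2 * r1 * cos t' <= 0 by rewrite mulr_ge0_le0 // mulr_ge0 // ltW.
  move: E1 z12 A1e2 A12 e20; clear; lra.
have ME : sc * (e ^+ 2 + b * e) = c1 * e ^+ 2 + 2 * (k * e ^+ 2) + B * k ^+ 2 * e ^+ 2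
    + B * (c0 * e ^+ 2) + si * e ^+ 2 + B * k * e ^+ 2 + sc * (b * e).
  by rewrite scE; ring.
have Bk2 := mulr_ge0 (ltW B0) (sqr_ge0 k); have Bk := mulr_gt0 B0 k_gt0.
have Bc0 := mulr_ge0 (ltW B0) c00.
have scl : B * k <= sc by rewrite scE; move: c10 k_gt0 Bk2 Bc0 si0; clear; lra.
have sc0 : 0 <= sc by apply: le_trans scl; apply: ltW.
have Mb : B * (b * k * e) <= sc * (b * e).
  have := ler_wpM2r be0 scl; clear; lra.
have n1 := mulr_ge0 c10 (ltW e20).
have n2 : 0 <= k * e ^+ 2 by rewrite mulr_ge0 // ltW.
have n3 : 0 <= B * k ^+ 2 * e ^+ 2 by rewrite !mulr_ge0 ?sqr_ge0 // ltW.
have n4 : 0 <= B * (c0 * e ^+ 2) by rewrite !mulr_ge0 // ltW.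
have n5 : 0 <= si * e ^+ 2 by rewrite !mulr_ge0 // ltW.
have n6 : 0 <= B * k * e ^+ 2 by rewrite !mulr_ge0 // ltW.
have n7 : 0 <= sc * (b * e) by rewrite mulr_ge0.
set PH := Phi S1 y1 y0 _ _.
have m0 : Num.min 0 PH <= 0 by rewrite ge_min lexx.
have m1 : Num.min 0 PH <= PH by rewrite ge_min lexx orbT.
rewrite ME; move: m1; rewrite {2}/PH /Phi; move: (Num.min 0 PH) m0 => m m0.
(* If the next angle is right or obtuse, [y] hardly grows and [Fg] transfers [S - k * y]; otherwise
   the law of sines transfers [S * sin]. *)
case: (leP (cos t) 0) => ct; case: (leP (cos t') 0) => ct' m1.
- have := Fg ct'; have : m <= Num.min 0 (S1 - k * y1) by rewrite le_min m0 m1.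
  move: n1 n2 n3 n4 n5 n6 n7; clear; lra.
- have cp := le_trans ctp ct; have := F1 cp ct'.
  have : S1 * r1 * cos p <= 0 by rewrite mulr_ge0_le0 // mulr_ge0 // ltW.
  move=> h1 h2; have h3 : y2 - y1 <= e ^+ 2 / 2 by move: h1 E2 z11 A1e2; clear; lra.
  have := ler_wpM2l (ltW k_gt0) h3; rewrite -H; move: h2 m1 n1 n2 n3 n4 n5 n6 n7; clear; lra.
- have := Fg ct'; have := F4 ct; have := F5 ct; have := F6' ct => f6 f5 f4 fg.
  have s1 : S1 * sin (t + w) <= S1 by rewrite ler_piMr ?(ltW S10) // sin_le1.
  have h3 : y1 - y0 <= e ^+ 2 / 2 + S1 * cos t * (A0 + A1) by move: E0 f6 z01 A0e2; clear; lra.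
  have h4 := ler_wpM2l (ltW k_gt0) h3.
  have : m - (k * e ^+ 2 + B * k ^+ 2 * e ^+ 2 + B * (c0 * e ^+ 2) + sc * (b * e)) <= Num.min 0 (S1 - k * y1).
    rewrite le_min; apply/andP; split; first by move: m0 n2 n3 n4 n7; clear; lra.
    move: m1 s1 f4 f5 h4 Mb n2; clear; lra.
  move: fg n1 n5 n6; clear; lra.
- have := F3 ct ct'; have := F4 ct; have := F5 ct; have := F6 ct => f6 f5 f4 f3.
  have h3 : y2 - y0 <= e ^+ 2 + S1 * cos t * (A0 + A1) by move: E0 E2 f6 z01 z11 A0e2 A1e2; clear; lra.
  have h4 := ler_wpM2l (ltW k_gt0) h3.
  rewrite -H; move: m1 f3 f4 f5 h4 Mb n1 n2 n3 n4 n5 n6 n7; clear; lra.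
Qed.

End Step.

(** * The same step for points of the space *)

Section PointStep.
Variables (R : realType) (K k : R) (X : Type) (d : X -> X -> R).
Hypothesis K_ge0 : 0 <= K.
Hypothesis k_gt0 : 0 < k.
Hypothesis dm : is_metric d.
Local Notation sK := (Num.sqrt K).
Local Notation Sy := (Sy K).
Local Notation Yd := (Yd K d).
Local Notation pang := (pang K d).

Let d_ge0 x y : 0 <= d x y. Proof. by case: dm. Qed.
Let dC x y : d x y = d y x. Proof. by case: dm. Qed.
Let d_tri x y z : d x z <= d x y + d y z. Proof. by case: dm. Qed.
Let s0 : 0 <= sK. Proof. exact: sqrtr_ge0. Qed.

Lemma Sy_Yd_gt0 (a b : X) : a <> b -> sK * d a b < pi -> 0 < Sy (Yd a b).
Proof. by move=> ab h; rewrite (Sy_Yd K_ge0 dm) ?ltW // sn_gt0 // (dist_gt0 dm). Qed.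

Lemma pang_law (a b c : X) : a <> b -> a <> c ->
  sK * (d a b + d b c + d c a) < 2 * pi ->
  Yd b c = Yd a b + Yd a c - K * Yd a b * Yd a c - Sy (Yd a b) * Sy (Yd a c) * cos (pang a b c).
Proof.
move=> ab ac per; rewrite (pang_hinge K_ge0 dm ab ac per) /hinge.
have [p1 p2 p3] := per_side dm per.
by rewrite !(Sy_Yd K_ge0 dm) ?ltW // dC.
Qed.

Lemma pang_law_sines (a b p : X) : a <> b -> a <> p -> b <> p ->
  sK * (d a b + d b p + d p a) < 2 * pi ->
  Sy (Yd a p) * sin (pang a b p) = Sy (Yd b p) * sin (pang b p a).
Proof.
move=> ab ap bp per; have [p1 p2 p3] := per_side dm per.
have sab := Sy_Yd_gt0 ab p1; have sbp := Sy_Yd_gt0 bp p2.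
have sap : 0 < Sy (Yd a p) by apply: Sy_Yd_gt0 => //; rewrite dC.
have D0 : 0 <= Del K (Yd a b) (Yd a p) (Yd b p) by apply: (Del_Yd K_ge0 dm); apply: ltW.
have y0 := Yd_ge0 K d; have y2 := Yd_le2 K_ge0 d.
have h1 := sin_ang (y0 a b) (y0 a p) (y2 a b) (y2 a p) sab sap D0.
have D0' : 0 <= Del K (Yd b p) (Yd a b) (Yd a p) by rewrite DelC12 DelC23.
have h2 := sin_ang (y0 b p) (y0 a b) (y2 b p) (y2 a b) sbp sab D0'.
apply: (mulfI (lt0r_neq0 sab)); rewrite !mulrA /(pang a b p) /(pang b p a) h1 [Sy (Yd a b) * _]mulrC.
by rewrite [Yd b a](YdC _ dm) [Yd p a](YdC _ dm) h2 [in RHS]DelC12 [in RHS]DelC23.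
Qed.

Definition PhiP (p x y : X) : R :=
  Phi k (Sy (Yd p y)) (Yd p y) (Yd p x) (cos (pang y p x)) (sin (pang y p x)).

Lemma Yd_sqrt (x y : X) : (Num.sqrt (2 * Yd x y)) ^+ 2 / 2 = Yd x y.
Proof.
have h : 0 <= 2 * Yd x y by rewrite mulr_ge0 // Yd_ge0.
by rewrite sqr_sqrtr //; field.
Qed.

Lemma sqrt_Yd_le (x y : X) : Num.sqrt (2 * Yd x y) <= d x y.
Proof.
rewrite -[X in _ <= X](ger0_norm (d_ge0 x y)) -sqrtr_sqr ler_wsqrtr //.
have := md_le_sqr K_ge0 (d x y); rewrite /(Yd _ _); lra.
Qed.

Lemma sqrt_Yd_gt0 (x y : X) : x <> y -> sK * d x y <= pi -> 0 < Num.sqrt (2 * Yd x y).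
Proof. by move=> xy h; rewrite sqrtr_gt0 mulr_gt0 // md_gt0 // (dist_gt0 dm). Qed.

Lemma PhiP_step (p x0 x1 x2 : X) (B c e b : R) :
  x1 <> p -> x2 <> p -> x0 <> x1 -> x1 <> x2 -> x0 <> x2 ->
  d x0 x1 <= e -> d x1 x2 <= e -> 0 < e -> e <= 1 -> (K + k ^+ 2) * e ^+ 2 <= 1 -> k * e <= 1 ->
  sK * (d p x1 + 2 * e) < pi ->
  0 < c -> c <= Sy (Yd p x1) -> c <= Sy (Yd p x2) -> Sy (Yd p x1) <= B ->
  pang x1 x2 p + pang x1 p x0 <= pang x1 x2 x0 ->
  b = 1 \/ (b = 0 /\ 2 * k ^+ 2 * Yd x0 x1 * Yd x1 x2 * Yd x0 x2
     <= Del K (Yd x0 x1) (Yd x1 x2) (Yd x0 x2)) ->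
  Num.min 0 (PhiP p x0 x1) - step_const K k B c * (e ^+ 2 + b * e) <= PhiP p x1 x2.
Proof.
move=> x1p x2p x01 x12 x02 d01 d12 e0 e1 Qe ke far c0 c1 c2 cB SA good.
have e20 := sqr_ge0 e.
have k2 := sqr_ge0 k.
have Ke : K * e ^+ 2 <= 1 by apply: le_trans Qe; rewrite ler_wpM2r // lerDl.
have se : 0 <= sK * e by rewrite mulr_ge0 // ltW.
have sp : 0 <= sK * d p x1 by rewrite mulr_ge0.
have s01 := ler_wpM2l s0 d01; have s12 := ler_wpM2l s0 d12.
have per1 : sK * (d x1 p + d p x0 + d x0 x1) < 2 * pi.
  have := ler_wpM2l s0 (d_tri p x1 x0); rewrite [d x1 x0]dC [d x1 p]dC; lra.
have per2 : sK * (d x1 x2 + d x2 p + d p x1) < 2 * pi.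
  have := ler_wpM2l s0 (d_tri p x1 x2); rewrite [d x2 p]dC; lra.
have per3 : sK * (d x1 x2 + d x2 x0 + d x0 x1) < 2 * pi.
  have := ler_wpM2l s0 (d_tri x0 x1 x2); rewrite [d x2 x0]dC; lra.
have per2' : sK * (d x2 p + d p x1 + d x1 x2) < 2 * pi.
  by apply: le_lt_trans per2; lra.
have x10 := nesym x01; have x21 := nesym x12.
have r1 := pang_range K_ge0 dm x1p x10 per1.
have r2 := pang_range K_ge0 dm x12 x1p per2.
have r3 := pang_range K_ge0 dm x12 x10 per3.
have r2' := pang_range K_ge0 dm x2p x21 per2'.
set A0 := Num.sqrt (2 * Yd x0 x1); set A1 := Num.sqrt (2 * Yd x1 x2).
have A00 : 0 < A0 by apply: sqrt_Yd_gt0 => //; lra.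
have A10 : 0 < A1 by apply: sqrt_Yd_gt0 => //; lra.
have A0e : A0 <= e by apply: le_trans (sqrt_Yd_le _ _) d01.
have A1e : A1 <= e by apply: le_trans (sqrt_Yd_le _ _) d12.
have z0E : A0 ^+ 2 / 2 = Yd x0 x1 by apply: Yd_sqrt.
have z1E : A1 ^+ 2 / 2 = Yd x1 x2 by apply: Yd_sqrt.
clearbody A0 A1.
have b0 : 0 <= b by case: good => [->|[-> _]].
(* The turn that is guaranteed at [x1]. For [b = 1] the second argument is nonpositive, so that a
   bad corner is credited with no turn at all. *)
pose w := Num.max 0 (k / 2 * (A0 + A1) - k * (K + k ^+ 2) * e ^+ 2 - b * k * e).
have w0 : 0 <= w by rewrite le_max lexx.
have kQ : 0 <= k * (K + k ^+ 2) * e ^+ 2 by rewrite !mulr_ge0 ?addr_ge0 // ltW.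
have be : 0 <= b * k * e by rewrite !mulr_ge0 // ltW.
have kA : k / 2 * (A0 + A1) <= k * e.
  by rewrite -mulrA ler_pM2l //; lra.
have wke : w <= k * e.
  by rewrite ge_max; apply/andP; split; [rewrite mulr_ge0 // ltW | lra].
have wT : w <= pi - pang x1 x2 x0.
  rewrite ge_max; apply/andP; split; first by lra.
  case: good => [b1|[b1 curv]]; first by rewrite b1; lra.
  have := @turn_lower_bound R K k K_ge0 k_gt0 e A0 A1 (Yd x0 x2) (pang x1 x2 x0)
    A00 A10 A0e A1e e1 Qe r3.
  rewrite z0E z1E => T; rewrite b1; have := T _ curv; move=> T'.
  suff H : Yd x0 x2 = Yd x0 x1 + Yd x1 x2 - K * Yd x0 x1 * Yd x1 x2 - Sy (Yd x0 x1) * Sy (Yd x1 x2) * cos (pang x1 x2 x0).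
    by have := T' H; lra.
  have := pang_law x12 x10 per3; rewrite [Yd x2 x0](YdC _ dm) [Yd x1 x0](YdC _ dm) => ->; ring.
have Yp (x : X) : Yd x p = Yd p x by apply: YdC.
have := @Phi_step R K k K_ge0 k_gt0 B c e b w A0 A1 (Yd p x0) (Yd p x1) (Yd p x2)
  (pang x1 p x0) (pi - pang x1 x2 p) (pang x2 p x1).
apply=> //; rewrite ?Yd_ge0 ?Yd_le2 //.
- by lra.
- by lra.
- by lra.
- by rewrite le_max lexx orbT.
- by rewrite z0E (pang_law x1p x10 per1) Yp [Yd x1 x0](YdC _ dm).
- rewrite z1E -[Yd p x2]Yp (pang_law x12 x1p per2) Yp cosB cospi sinpi; ring.
- by rewrite z1E (pang_law x2p x21 per2') Yp [Yd x2 x1](YdC _ dm).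
- rewrite sinB cospi sinpi -!Yp -(pang_law_sines x12 x1p x2p per2); ring.
Qed.

End PointStep.

(** * Summing the steps over a fine subdivision *)

Section Dynamics.
Variables (R : realType) (K k : R) (X : Type) (d : X -> X -> R).
Variables (L : R) (sigma : R -> X).
Hypothesis K_ge0 : 0 <= K.
Hypothesis k_gt0 : 0 < k.
Hypothesis dm : is_metric d.
Hypothesis lip : forall s t, d (sigma s) (sigma t) <= `|s - t|.
Hypothesis inj : forall s t, s < t -> t < s + L -> sigma s <> sigma t.
Hypothesis period : forall t, sigma (t + L) = sigma t.
Local Notation sK := (Num.sqrt K).
Local Notation Sy := (Sy K).
Local Notation Yd := (Yd K d).
Local Notation pang := (pang K d).

Let d_ge0 x y : 0 <= d x y. Proof. by case: dm. Qed.
Let dC x y : d x y = d y x. Proof. by case: dm. Qed.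
Let d_tri x y z : d x z <= d x y + d y z. Proof. by case: dm. Qed.
Let s0 : 0 <= sK. Proof. exact: sqrtr_ge0. Qed.

(** Stated for a curve and a metric alone, so that it can be carried over to the reversed curve. *)
Definition cyclic_superadd : Prop := forall t0 t1 t2 t3,
  t0 < t1 -> t1 < t2 -> t2 < t3 -> t3 < t0 + L ->
  sK * (d (sigma t0) (sigma t1) + d (sigma t1) (sigma t2) + d (sigma t2) (sigma t0)) < 2 * pi ->
  sK * (d (sigma t0) (sigma t2) + d (sigma t2) (sigma t3) + d (sigma t3) (sigma t0)) < 2 * pi ->
  sK * (d (sigma t2) (sigma t1) + d (sigma t1) (sigma t3) + d (sigma t3) (sigma t2)) < 2 * pi ->
  sK * (d (sigma t0) (sigma t1) + d (sigma t0) (sigma t3)) < pi ->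
  pang (sigma t0) (sigma t1) (sigma t2) + pang (sigma t0) (sigma t2) (sigma t3)
    <= pang (sigma t0) (sigma t1) (sigma t3).

Definition curved_at (del t : R) : Prop := forall s u,
  t - del < s -> s < t -> t < u -> u < t + del ->
  2 * k ^+ 2 * Yd (sigma s) (sigma t) * Yd (sigma t) (sigma u) * Yd (sigma s) (sigma u)
  <= Del K (Yd (sigma s) (sigma t)) (Yd (sigma t) (sigma u)) (Yd (sigma s) (sigma u)).

Definition curved_cell (del lo hi : R) : Prop :=
  exists2 t, lo < t < hi & curved_at del t.

(* The cells of a uniform subdivision of [[a, b]] without a curved point have small total
   length, uniformly in the number of cells. *)
Definition mostly_curved : Prop := forall a b eps, a < b -> 0 < eps ->
  exists2 del, 0 < del & forall N, (0 < N)%N ->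
    \sum_(i < N) (~~ `[< curved_cell del (a + i%:R * ((b - a) / N%:R))
                          (a + i.+1%:R * ((b - a) / N%:R)) >])%:R * ((b - a) / N%:R) <= eps.

Hypothesis SA : cyclic_superadd.
Hypothesis MC : mostly_curved.

(** Lets a proof list all its smallness demands [eta * c <= e] at once and take a single mesh for
    them. *)
Lemma small_scale (l : seq (R * R)) : all (fun cd => 0 < cd.2) l ->
  exists2 eta0, 0 < eta0 & forall eta, 0 <= eta -> eta <= eta0 ->
    all (fun cd => eta * cd.1 <= cd.2) l.
Proof.
elim: l => [|[c e] l IH] /=; first by exists 1.
move=> /andP[e0 /IH [eta0 eta00 H]].
have c0 : 0 < 1 + `|c| by rewrite ltr_pwDl.
exists (Num.min eta0 (e / (1 + `|c|))); first by rewrite lt_min eta00 divr_gt0.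
move=> eta eta1; rewrite le_min => /andP[h1 h2]; rewrite H // andbT.
apply: (@le_trans _ _ (eta * (1 + `|c|))); last by rewrite -ler_pdivlMr.
by rewrite ler_wpM2l //; have := ler_norm c; lra.
Qed.

Lemma fine_subdivision (a b eta0 : R) : a < b -> 0 < eta0 ->
  exists2 N, (1 < N)%N & (b - a) / N%:R <= eta0.
Proof.
move=> ab e0; exists (Num.truncn ((b - a) / eta0)).+2 => //.
rewrite ler_pdivrMr // mulrC -ler_pdivrMr //.
by apply: le_trans (ltW (truncnS_gt _)) _; rewrite ler_nat.
Qed.

Lemma md_continuous : continuous (md K).
Proof.
move=> x; rewrite (_ : md K = fun r => if K == 0 then r ^+ 2 / 2 else (1 - cos (sK * r)) / K).
  case: (eqVneq K 0) => K0.
    apply: cvgM; last exact: cvg_cst.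
    exact: exprn_continuous.
  apply: cvgM; last exact: cvg_cst.
  apply: cvgB; first exact: cvg_cst.
  apply: continuous_comp; last exact: continuous_cos.
  apply: cvgM; [exact: cvg_cst|exact: cvg_id].
by apply/funext => r; rewrite mdE.
Qed.

Lemma dist_sigma_continuous (x : X) : continuous (fun t => d x (sigma t)).
Proof.
move=> t; apply/cvgrPdist_lt => e e0; apply/nbhs_ballP; exists e => // s ts.
apply: le_lt_trans ts; apply: le_trans (lip t s).
rewrite ler_norml; have := d_tri x (sigma t) (sigma s); have := d_tri x (sigma s) (sigma t).
by rewrite [d (sigma s) _]dC => h1 h2; apply/andP; split; lra.
Qed.

Lemma Yd_sigma_continuous (x : X) : continuous (fun t => Yd x (sigma t)).
Proof.
move=> t; apply: (@continuous_comp _ _ _ (fun t => d x (sigma t)) (md K)).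
  exact: dist_sigma_continuous.
exact: md_continuous.
Qed.

Lemma Sy_sigma_continuous (x : X) : continuous (fun t => Sy (Yd x (sigma t))).
Proof.
move=> t; apply: (@continuous_comp _ _ _ (fun t => 2 * Yd x (sigma t) - K * Yd x (sigma t) ^+ 2) (@Num.sqrt R)).
  apply: cvgB; (apply: cvgM; first exact: cvg_cst); first exact: Yd_sigma_continuous.
  apply: (@continuous_comp _ _ _ (fun t => Yd x (sigma t)) (fun y => y ^+ 2)).
    exact: Yd_sigma_continuous.
  exact: exprn_continuous.
exact: sqrt_continuous.
Qed.

Lemma PhiP_chain (p : X) (x : nat -> X) (N : nat) (B c e m0 : R) (b : nat -> R) :
  (forall i, (0 < i)%N -> (i < N)%N ->
     Num.min 0 (PhiP K k d p (x i.-1) (x i)) - step_const K k B c * (e ^+ 2 + b i * e)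
       <= PhiP K k d p (x i) (x i.+1)) ->
  0 <= step_const K k B c -> 0 <= e -> (forall i, 0 <= b i) ->
  m0 <= 0 -> m0 <= PhiP K k d p (x 0%N) (x 1%N) ->
  forall i, (i < N)%N ->
    m0 - step_const K k B c * (i%:R * e ^+ 2 + (\sum_(j < i.+1) b j) * e)
      <= Num.min 0 (PhiP K k d p (x i) (x i.+1)).
Proof.
move=> st M0 e0 b0 m00 m1; elim=> [|i IH] iN.
  rewrite le_min; set q := _ * (_ + _).
  have : 0 <= q by rewrite /q mulr_ge0 // mul0r add0r mulr_ge0 // sumr_ge0.
  by move=> q0; apply/andP; split; lra.
have I := IH (ltnW iN); have S := st i.+1 isT iN.
have sb : 0 <= \sum_(j < i.+1) b j by apply: sumr_ge0.
have E : step_const K k B c * (i.+1%:R * e ^+ 2 + (\sum_(j < i.+2) b j) * e) =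
   step_const K k B c * (i%:R * e ^+ 2 + (\sum_(j < i.+1) b j) * e) +
   step_const K k B c * (e ^+ 2 + b i.+1 * e).
  by rewrite big_ord_recr /= -natr1; ring.
have q0 : 0 <= step_const K k B c * (e ^+ 2 + b i.+1 * e).
  by rewrite mulr_ge0 // addr_ge0 ?sqr_ge0 // mulr_ge0.
have q1 : 0 <= step_const K k B c * (i%:R * e ^+ 2 + (\sum_(j < i.+1) b j) * e).
  by rewrite mulr_ge0 // addr_ge0 // mulr_ge0 // sqr_ge0.
rewrite E le_min; apply/andP; split; first by lra.
move: S => /=; lra.
Qed.

Lemma Sy_Yd_le_dist (x y : X) : Sy (Yd x y) <= d x y.
Proof.
apply: le_trans (sqrt_Yd_le K_ge0 dm x y); rewrite ler_wsqrtr // gerBl.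
by rewrite mulr_ge0 ?sqr_ge0.
Qed.

Lemma step_const_ge0 (B c : R) : 0 <= B -> 0 < c -> 0 <= step_const K k B c.
Proof.
move=> B0 c0; have k0 := ltW k_gt0.
have k2 := sqr_ge0 k; have i0 : 0 <= c^-1 by rewrite invr_ge0 ltW.
have i2 : 0 <= (c ^+ 2)^-1 by rewrite invr_ge0 sqr_ge0.
have KK : 0 <= K + k ^+ 2 by rewrite addr_ge0.
by rewrite /step_const; do !apply: addr_ge0 => //; do !apply: mulr_ge0.
Qed.

Lemma small_perimeter (rho e : R) (p x y : X) : sK * (rho + e) < pi ->
  d p x <= rho -> d p y <= rho -> d x y <= 2 * e -> sK * (d p x + d x y + d y p) < 2 * pi.
Proof.
move=> h px py xy; apply: le_lt_trans (_ : sK * (2 * (rho + e)) < _); last by lra.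
by rewrite ler_wpM2l //; rewrite [d y p]dC; lra.
Qed.

Lemma curve_step (tp u0 u1 u2 rho c e b : R) : 
  tp < u0 -> u0 < u1 -> u1 < u2 -> u2 < tp + L -> u1 - u0 <= e -> u2 - u1 <= e ->
  0 < e -> e <= 1 -> (K + k ^+ 2) * e ^+ 2 <= 1 -> k * e <= 1 ->
  sK * (rho + 2 * e) < pi ->
  d (sigma tp) (sigma u0) <= rho -> d (sigma tp) (sigma u1) <= rho ->
  d (sigma tp) (sigma u2) <= rho ->
  0 < c -> c <= Sy (Yd (sigma tp) (sigma u1)) -> c <= Sy (Yd (sigma tp) (sigma u2)) ->
  b = 1 \/ (b = 0 /\ 2 * k ^+ 2 * Yd (sigma u0) (sigma u1) * Yd (sigma u1) (sigma u2) * Yd (sigma u0) (sigma u2)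
     <= Del K (Yd (sigma u0) (sigma u1)) (Yd (sigma u1) (sigma u2)) (Yd (sigma u0) (sigma u2))) ->
  Num.min 0 (PhiP K k d (sigma tp) (sigma u0) (sigma u1)) - step_const K k rho c * (e ^+ 2 + b * e)
    <= PhiP K k d (sigma tp) (sigma u1) (sigma u2).
Proof.
move=> t0 t01 t12 t2 g1 g2 e0 e1 Qe ke far p0 p1 p2 c0 c1 c2 good.
have u0L : u0 < tp + L by apply: lt_trans t01 (lt_trans t12 t2).
have u1L : u1 < tp + L := lt_trans t12 t2.
have tu1 : tp < u1 := lt_trans t0 t01.
have tu2 : tp < u2 := lt_trans tu1 t12.
have d01 : d (sigma u0) (sigma u1) <= e.
  by apply: le_trans (lip _ _) _; rewrite distrC gtr0_norm // subr_gt0.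
have d12 : d (sigma u1) (sigma u2) <= e.
  by apply: le_trans (lip _ _) _; rewrite distrC gtr0_norm // subr_gt0.
have d02 : d (sigma u0) (sigma u2) <= 2 * e.
  by apply: le_trans (d_tri _ (sigma u1) _) _; lra.
have u2L : u2 < u0 + L by apply: lt_trans t2 _; rewrite ltrD2r.
have far' : sK * (rho + e) < pi.
  by apply: le_lt_trans far; rewrite ler_wpM2l // lerD2l; lra.
apply: PhiP_step => //.
- exact/nesym/inj.
- exact/nesym/inj.
- by apply: inj => //; apply: lt_trans u2L.
- by apply: inj => //; apply: lt_trans u2L _; rewrite ltrD2r.
- by apply: inj => //; apply: lt_trans t12.
- by apply: le_lt_trans far; rewrite ler_wpM2l // lerD2r.
- exact: le_trans (Sy_Yd_le_dist _ _) p1.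
(* In the cyclic order starting at [u1], the base point and [u0] come one period later. *)
- have := @SA u1 u2 (tp + L) (u0 + L); rewrite !period; apply => //.
  + by rewrite ltrD2r.
  + by rewrite ltrD2r.
  + have := small_perimeter far' p1 p2; rewrite [d (sigma u2) _]dC => /(_ _).
    by rewrite [sK * (d (sigma u1) (sigma u2) + _ + _)](_ : _ = sK * (d (sigma tp) (sigma u1) + d (sigma u1) (sigma u2) + d (sigma tp) (sigma u2))); [apply; lra|ring].
  + have := small_perimeter far' p1 p0; rewrite [d (sigma u1) _]dC [d (sigma u1) (sigma tp)]dC => /(_ _).
    by rewrite [sK * (d (sigma tp) (sigma u1) + d (sigma tp) (sigma u0) + _)](_ : _ = sK * (d (sigma tp) (sigma u1) + d (sigma u0) (sigma u1) + d (sigma u0) (sigma tp))); [apply; lra|rewrite [d (sigma u0) (sigma tp)]dC; ring].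
  + rewrite [d (sigma u2) (sigma u0)]dC; have := small_perimeter far' p2 p0.
    rewrite [d (sigma u2) (sigma u0)]dC; exact.
  + apply: le_lt_trans far; rewrite ler_wpM2l // [d (sigma u1) (sigma u0)]dC.
    by have := le_trans (d_ge0 _ _) p1; lra.
Qed.

Lemma pang_range_curve (tp u0 u1 rho e : R) : tp < u0 -> u0 < u1 -> u1 < tp + L ->
  u1 - u0 <= e -> sK * (rho + e) < pi ->
  d (sigma tp) (sigma u0) <= rho -> d (sigma tp) (sigma u1) <= rho ->
  0 <= pang (sigma u1) (sigma tp) (sigma u0) <= pi /\
  Yd (sigma tp) (sigma u1) - Yd (sigma tp) (sigma u0) <= e ^+ 2 / 2 + rho * e.
Proof.
move=> t0 t01 t1 g1 far p0 p1.
have d01 : d (sigma u0) (sigma u1) <= e.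
  by apply: le_trans (lip _ _) _; rewrite distrC gtr0_norm // subr_gt0.
have e0 : 0 <= e by apply: le_trans d01.
have n1 : sigma u1 <> sigma tp by apply/nesym/inj => //; apply: lt_trans t01.
have n0 : sigma u1 <> sigma u0 by apply/nesym/inj => //; apply: lt_trans t1 _; rewrite ltrD2r.
have per : sK * (d (sigma u1) (sigma tp) + d (sigma tp) (sigma u0) + d (sigma u0) (sigma u1)) < 2 * pi.
  have d2 : d (sigma u1) (sigma u0) <= 2 * e by rewrite dC; lra.
  have := small_perimeter far p1 p0 d2.
  rewrite [d (sigma u1) (sigma u0)]dC [d (sigma u1) (sigma tp)]dC [d (sigma u0) (sigma tp)]dC; lra.
split; first exact: (pang_range K_ge0 dm).
have law := pang_law K_ge0 dm n1 n0 per.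
have z2 : Yd (sigma u1) (sigma u0) <= e ^+ 2 / 2.
  by apply: le_trans (md_le_sqr K_ge0 _) _; rewrite ler_pM2r // dC ler_sqr ?nnegrE.
have z0 := Yd_ge0 K d (sigma u1) (sigma u0).
have y2 := Yd_le2 K_ge0 d (sigma tp) (sigma u1).
have ss : Sy (Yd (sigma tp) (sigma u1)) * Sy (Yd (sigma u1) (sigma u0)) * cos (pang (sigma u1) (sigma tp) (sigma u0)) <= rho * e.
  apply: (@le_trans _ _ (Sy (Yd (sigma tp) (sigma u1)) * Sy (Yd (sigma u1) (sigma u0)))).
    by rewrite ler_piMr ?cos_le1 // mulr_ge0 ?sqrtr_ge0.
  apply: ler_pM; rewrite ?sqrtr_ge0 //; first exact: le_trans (Sy_Yd_le_dist _ _) p1.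
  by apply: le_trans (Sy_Yd_le_dist _ _) _; rewrite dC.
have := ler_wpM2r z0 y2; rewrite law [Yd (sigma u1) (sigma tp)](YdC _ dm); lra.
Qed.

(** Near the base point nothing is known about angles; but [Y] is at most [2 * tau ^ 2] there, and
    [Phi] is never below [- k] times a value of that size. *)
Lemma PhiP_start (tp u0 u1 rho e tau : R) : tp < u0 -> u0 < u1 -> u1 < tp + L ->
  u1 - u0 <= e -> sK * (rho + e) < pi -> u1 <= tp + 2 * tau ->
  d (sigma tp) (sigma u0) <= rho -> d (sigma tp) (sigma u1) <= rho ->
  - (2 * k * tau ^+ 2) <= PhiP K k d (sigma tp) (sigma u0) (sigma u1).
Proof.
move=> t0 t01 t1 g1 far ut p0 p1.
have [r _] := pang_range_curve t0 t01 t1 g1 far p0 p1.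
have Y u : tp < u -> u <= tp + 2 * tau -> Yd (sigma tp) (sigma u) <= 2 * tau ^+ 2.
  move=> h1 h2; apply: le_trans (md_le_sqr K_ge0 _) _.
  have : d (sigma tp) (sigma u) <= 2 * tau.
    by apply: le_trans (lip _ _) _; rewrite distrC gtr0_norm ?subr_gt0 // lerBlDl.
  rewrite -ler_sqr ?nnegrE //; first by lra.
  by apply: le_trans (_ : u - tp <= _); [rewrite subr_ge0 ltW|rewrite lerBlDl].
have y0 := ler_wpM2l (ltW k_gt0) (Y u0 t0 (le_trans (ltW t01) ut)).
have y1 := ler_wpM2l (ltW k_gt0) (Y u1 (lt_trans t0 t01) ut).
have S0 : 0 <= Sy (Yd (sigma tp) (sigma u1)) by rewrite sqrtr_ge0.
rewrite /PhiP /Phi; case: ifP => _; first by lra.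
have := mulr_ge0 S0 (sin_ge0_pi r); lra.
Qed.

(** At the last point the mean of two [Y] in [Phi] is replaced by the last [Y], at a cost of order
    [e]. *)
Lemma PhiP_end (tp t T rho e eps : R) : tp < t -> t < T -> T < tp + L ->
  T - t <= e -> sK * (rho + e) < pi -> e ^+ 2 <= e -> e * (k * (1 + rho)) <= eps / 4 -> 0 < eps ->
  d (sigma tp) (sigma t) <= rho -> d (sigma tp) (sigma T) <= rho ->
  - (3 * eps / 8) <= PhiP K k d (sigma tp) (sigma t) (sigma T) ->
  let q := pang (sigma T) (sigma tp) (sigma t) in
  let y := Yd (sigma tp) (sigma T) in
  (cos q <= 0 /\ - eps <= Sy y - k * y) \/ (0 < cos q /\ - eps <= Sy y * sin q - k * y).
Proof.
move=> t0 t01 t1 g1 far ee ke eps0 p0 p1.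
have [r diff] := pang_range_curve t0 t01 t1 g1 far p0 p1.
rewrite /PhiP /Phi /=; case: (leP (cos _) 0) => cq fin; [left|right]; split => //; first by lra.
have := ler_wpM2l (ltW k_gt0) diff.
have := ler_wpM2l (ltW k_gt0) ee.
have e0 : 0 <= e by apply: le_trans g1; rewrite subr_ge0 ltW.
have := mulr_ge0 (ltW k_gt0) e0; lra.
Qed.

Lemma cell_points (a T eta del : R) (N : nat) : 0 < eta -> (1 < N)%N -> N%:R * eta = T - a ->
  exists tt : nat -> R, [/\ tt N = T,
    forall i, (i <= N)%N -> a < tt i /\ tt i <= T,
    forall i, (i < N)%N -> tt i < tt i.+1 /\ tt i.+1 - tt i <= 2 * eta,
    tt 1%N <= a + 2 * eta &
    forall i, (i < N)%N -> curved_cell del (a + i%:R * eta) (a + i.+1%:R * eta) ->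
      curved_at del (tt i)].
Proof.
move=> etap N1 etaN.
have nS i : i.+1%:R * eta = i%:R * eta + eta by rewrite -natr1 mulrDl mul1r.
have cell i : exists t, a + i%:R * eta < t < a + i.+1%:R * eta /\
    (curved_cell del (a + i%:R * eta) (a + i.+1%:R * eta) -> curved_at del t).
  case: (pselect (curved_cell del (a + i%:R * eta) (a + i.+1%:R * eta))) => [[t h1 h2]|no].
    by exists t.
  by exists (a + i%:R * eta + eta / 2); split => //; rewrite nS; lra.
have [f fP] := choice cell.
have fT i : (i < N)%N -> a + i.+1%:R * eta <= T.
  by move=> iN; rewrite -lerBrDl -etaN ler_pM2r // ler_nat.
exists (fun i => if (i < N)%N then f i else T); split.
- by rewrite ltnn.
- move=> i iN; case: ifP => iN'.
    have [/andP[h1 h2] _] := fP i; split; last exact: le_trans (ltW h2) (fT i iN').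
    by apply: le_lt_trans h1; rewrite lerDl mulr_ge0 // ltW.
  split => //; rewrite -subr_gt0 -etaN mulr_gt0 // ltr0n; exact: ltnW.
- move=> i iN; rewrite iN; have [/andP[h1 h2] _] := fP i.
  case: ifP => iN1.
    have [/andP[h3 h4] _] := fP i.+1; split; first exact: lt_trans h2 h3.
    by move: h1 h4; rewrite !nS; lra.
  have E : i.+1 = N by apply/eqP; rewrite eqn_leq iN leqNgt iN1.
  have : a + i.+1%:R * eta = T by rewrite E etaN; lra.
  by move: h1 h2; rewrite nS; split; lra.
- by rewrite N1; have [/andP[_ h2] _] := fP 1%N; apply: ltW.
- by move=> i iN; rewrite iN; have [_] := fP i.
Qed.

Lemma base_angle (tp T rho eps : R) : tp < T -> T < tp + L -> 0 < eps -> sK * rho < pi ->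
  (forall t, tp <= t <= T -> d (sigma tp) (sigma t) <= rho) ->
  exists t, [/\ T - eps < t, tp < t, t < T &
    let q := pang (sigma T) (sigma tp) (sigma t) in
    let y := Yd (sigma tp) (sigma T) in
    (cos q <= 0 /\ - eps <= Sy y - k * y) \/ (0 < cos q /\ - eps <= Sy y * sin q - k * y)].
Proof.
move=> tpT TL eps0 rhopi drho; set p := sigma tp.
have rho0 : 0 <= rho by apply: le_trans (d_ge0 p p) (drho tp _); rewrite lexx ltW.
have [tau [tau0 tau1 tau3]] : exists tau, [/\ 0 < tau, tau < T - tp & 2 * k * tau ^+ 2 <= eps / 8].
  have [|t1 t10 H] := @small_scale [:: (1, 1); (2, T - tp); (2 * k, eps / 8)].
    by rewrite /= ltr01 subr_gt0 tpT divr_gt0.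
  exists t1; have := H t1 (ltW t10) (lexx _) => /= /andP[h1 /andP[h2 /andP[h3 _]]].
  split => //; first by lra.
  have : t1 ^+ 2 <= t1 by rewrite expr2 ger_pMl //; lra.
  by move/(ler_wpM2l (ltW k_gt0)); lra.
pose a := tp + tau.
have aT : a < T by rewrite /a -ltrBrDl.
have tpa : tp < a by rewrite ltrDl.
have cS : {within `[a, T], continuous (fun t => Sy (Yd p (sigma t)))}.
  apply: continuous_subspaceT => t; exact: Sy_sigma_continuous.
(* The step constant blows up as [Sy] tends to 0, which happens at the base point; starting the run
   at [a > tp] gives a positive minimum [c]. *)
have [c0 + cmin] := EVT_min (ltW aT) cS.
rewrite in_itv /= => /andP[ac0 c0T].
set c := Sy (Yd p (sigma c0)) in cmin.
have cpos : 0 < c.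
  apply: (Sy_Yd_gt0 K_ge0 dm).
    by apply: inj; [exact: lt_le_trans ac0|exact: le_lt_trans TL].
  apply: le_lt_trans rhopi; rewrite ler_wpM2l // drho // c0T andbT.
  exact: le_trans (ltW tpa) ac0.
clearbody c.
have M0 := step_const_ge0 rho0 cpos; set M := step_const K k rho c in M0.
(* Error budget: [eps / 8] each for the start, the bad cells and the accumulated [e ^ 2] terms; the
   total [3 * eps / 8] is what [PhiP_end] admits. *)
have [eps1 eps10 Me] : exists2 eps1, 0 < eps1 & 2 * M * eps1 <= eps / 8.
  have [|t1 t10 H] := @small_scale [:: (2 * M, eps / 8)]; first by rewrite /= divr_gt0.
  by exists t1 => //; have := H t1 (ltW t10) (lexx _) => /= /andP[]; lra.
have [del del0 Hdel] := MC aT eps10.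
have gap0 : 0 < (pi - sK * rho) / 2 by lra.
have [|eta0 eta00 Heta] := @small_scale [:: (4, del); (2, 1); ((K + k ^+ 2) * 2, 1); (k * 2, 1);
   (2, tau); (4 * sK, (pi - sK * rho) / 2); (4 * M * (T - a), eps / 8);
   (2 * (k * (1 + rho)), eps / 4); (4, eps)].
  by rewrite /= del0 ltr01 tau0 gap0 eps0 !divr_gt0.
have [N N1 Neta] := fine_subdivision aT eta00.
have Npos : (0 < N)%N by apply: ltnW.
have NR : 0 < N%:R :> R by rewrite ltr0n.
have {Hdel} := Hdel N Npos.
set eta := (T - a) / N%:R in Neta * => Hbad.
have etap : 0 < eta by rewrite divr_gt0 // subr_gt0.
have etaN : N%:R * eta = T - a by rewrite /eta mulrC divfK // gt_eqF.
clearbody eta.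
have {Heta} := Heta eta (ltW etap) Neta => /=.
move=> /andP[e1 /andP[e2 /andP[e3 /andP[e4 /andP[e5 /andP[e6 /andP[e7 /andP[e8 /andP[e9 _]]]]]]]]].
have [tt [ttN ttb ttS tt1 ttc]] := @cell_points a T eta del N etap N1 etaN.
set e := 2 * eta in ttS tt1.
have eE : e = 2 * eta by [].
have ep : 0 < e by rewrite mulr_gt0.
have ee1 : e <= 1 by rewrite /e mulrC.
have ee : e ^+ 2 <= e by rewrite expr2 ger_pMl.
have KK : 0 <= K + k ^+ 2 by rewrite addr_ge0 ?sqr_ge0.
have Qe : (K + k ^+ 2) * e ^+ 2 <= 1.
  by apply: le_trans (ler_wpM2l KK ee) _; rewrite eE; lra.
have ke1 : k * e <= 1 by rewrite eE; lra.
have far : sK * (rho + 2 * e) < pi by rewrite eE; lra.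
have far' : sK * (rho + e) < pi.
  by apply: le_lt_trans far; rewrite ler_wpM2l // lerD2l; lra.
have ke2 : e * (k * (1 + rho)) <= eps / 4 by rewrite eE; lra.
have err : 4 * M * (T - a) * eta <= eps / 8 by move: e7; lra.
have edel : e < del by rewrite eE; lra.
have eeps : e < eps by rewrite eE; lra.
have ttau : tt 1%N <= tp + 2 * tau by apply: le_trans tt1 _; rewrite eE /a; lra.
clear e1 e2 e3 e4 e5 e6 e7 e8 e9 gap0 NR.
have tlo i : (i <= N)%N -> tp < tt i by move=> /ttb[h _]; apply: lt_trans h.
have thi i : (i <= N)%N -> tt i < tp + L by move=> /ttb[_ h]; apply: le_lt_trans TL.
have dp i : (i <= N)%N -> d p (sigma (tt i)) <= rho.
  by move=> iN; apply: drho; rewrite (ltW (tlo i iN)) (ttb i iN).2.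
have cS' i : (i <= N)%N -> c <= Sy (Yd p (sigma (tt i))).
  by move=> /ttb[h1 h2]; apply: cmin; rewrite in_itv /= (ltW h1) h2.
pose bad i : R := (~~ `[< curved_cell del (a + i%:R * eta) (a + i.+1%:R * eta) >])%:R.
have step i : (0 < i)%N -> (i < N)%N ->
     Num.min 0 (PhiP K k d p (sigma (tt i.-1)) (sigma (tt i))) - M * (e ^+ 2 + bad i * e)
       <= PhiP K k d p (sigma (tt i)) (sigma (tt i.+1)).
  case: i => // i _ iN.
  have iN' := ltnW iN.
  have [l1 g1] := ttS i iN'; have [l2 g2] := ttS i.+1 iN.
  apply: curve_step => //.
  - exact/tlo/ltnW.
  - exact: thi.
  - exact/dp/ltnW.
  - exact: dp.
  - exact: dp.
  - exact: cS'.
  - exact: cS'.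
  - rewrite /bad; case: asboolP => cc; last by left.
    right; split => //.
    have cu : curved_at del (tt i.+1) by apply: ttc.
    apply: cu => //.
      by rewrite ltrBlDr -ltrBlDl; apply: le_lt_trans edel.
    by rewrite -ltrBlDl; apply: le_lt_trans edel.
have b0 i : 0 <= bad i by rewrite /bad ler0n.
have m00 : - (2 * k * tau ^+ 2) <= 0.
  by rewrite oppr_le0 mulr_ge0 ?sqr_ge0 // mulr_ge0 // ltW.
have m1 : - (2 * k * tau ^+ 2) <= PhiP K k d p (sigma (tt 0%N)) (sigma (tt 1%N)).
  have [l1 g1] := ttS 0%N Npos.
  by apply: PhiP_start far' ttau _ _ => //; [exact: tlo|exact: thi|exact: dp|exact: dp].
have chain := @PhiP_chain p (fun i => sigma (tt i)) N rho c e _ bad step M0 (ltW ep) b0 m00 m1.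
have NE : N = N.-1.+1 by rewrite prednK.
have PN : (N.-1 < N)%N by rewrite {2}NE.
have := chain N.-1 PN; rewrite -NE ttN.
have sb : (\sum_(j < N) bad j) * eta <= eps1 by apply: le_trans Hbad; rewrite mulr_suml.
have err2 : M * (N.-1%:R * e ^+ 2 + (\sum_(j < N) bad j) * e) <= eps / 4.
  have h1 : N.-1%:R * e ^+ 2 <= 4 * (T - a) * eta.
    rewrite -etaN eE (_ : 4 * (N%:R * eta) * eta = N%:R * (2 * eta) ^+ 2); last by ring.
    by rewrite ler_wpM2r ?sqr_ge0 // ler_nat leq_pred.
  have h2 : N.-1%:R * e ^+ 2 + (\sum_(j < N) bad j) * e <= 4 * (T - a) * eta + 2 * eps1.
    by apply: lerD => //; rewrite eE; lra.
  by have := ler_wpM2l M0 h2; lra.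
rewrite -/M le_min => /andP[_ fin].
have {}fin : - (3 * eps / 8) <= PhiP K k d p (sigma (tt N.-1)) (sigma T).
  by apply: le_trans fin; move: tau3 err2; lra.
have [l1 g1] := ttS N.-1 PN; rewrite -NE ttN in l1 g1.
have pN := ltnW PN.
exists (tt N.-1); split => //.
- by rewrite ltrBlDr -ltrBlDl; apply: le_lt_trans eeps.
- exact: tlo.
apply: (PhiP_end (rho := rho) (e := e)) => //; [exact: tlo|exact: dp|].
by rewrite -ttN; apply: dp.
Qed.

End Dynamics.

Lemma defect_continuous_at (R : realType) (K k c t : R) (f g : R -> R) :
  {for t, continuous f} -> {for t, continuous g} ->
  {for t, continuous (fun x => 2 * k ^+ 2 * f x * g x * c - Del K (f x) (g x) c)}.
Proof.
move=> cf cg.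
have -> : (fun x => 2 * k ^+ 2 * f x * g x * c - Del K (f x) (g x) c) =
  (fun x => (2 * k ^+ 2 * c - 2 + 2 * K * c) * (f x * g x) - 2 * c * (f x + g x)
     + (f x * f x + g x * g x + c ^+ 2)).
  by apply/funext => x; rewrite /Del; ring.
apply: cvgD; last by apply: cvgD; [apply: cvgD; exact: cvgM|exact: cvg_cst].
by apply: cvgB; (apply: cvgM; first exact: cvg_cst); [exact: cvgM|exact: cvgD].
Qed.

(** * From almost every point to most cells *)

Section Measure.
Variables (R : realType) (K k : R) (X : Type) (d : X -> X -> R) (sigma : R -> X).
Hypothesis K_ge0 : 0 <= K.
Hypothesis dm : is_metric d.
Hypothesis lip : forall s t, d (sigma s) (sigma t) <= `|s - t|.
Local Notation Yd := (Yd K d).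
Local Notation mu := (@lebesgue_measure R).

(** For fixed [s] and [u], violating the inequality is an open condition on [t], so the complement
    is a union of open sets. Closedness provides measurability. *)
Lemma curved_at_closed (del : R) : closed [set t | curved_at K k d sigma del t].
Proof.
pose F s u t := 2 * k ^+ 2 * Yd (sigma s) (sigma t) * Yd (sigma u) (sigma t) * Yd (sigma s) (sigma u)
  - Del K (Yd (sigma s) (sigma t)) (Yd (sigma u) (sigma t)) (Yd (sigma s) (sigma u)).
have cF s u : continuous (F s u).
  move=> t; rewrite /F.
  have c1 := @Yd_sigma_continuous R K X d sigma K_ge0 dm lip (sigma s) t.
  have c2 := @Yd_sigma_continuous R K X d sigma K_ge0 dm lip (sigma u) t.
  exact: (defect_continuous_at c1 c2).
have op (f : R -> R) : continuous f -> open [set t | 0 < f t].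
  by move=> cf; apply: (@open_comp _ _ f [set x | 0 < x]); [move=> x _; exact: cf|exact: open_gt].
have -> : [set t | curved_at K k d sigma del t] =
  ~` \bigcup_(su in [set: R * R]) ([set t | 0 < su.1 - (t - del)] `&` [set t | 0 < t - su.1] `&`
     [set t | 0 < su.2 - t] `&` [set t | 0 < t + del - su.2] `&` [set t | 0 < F su.1 su.2 t]).
  apply/seteqP; split => t /=.
    move=> ct [[s u] _ /= [[[[]]]]]; rewrite !subr_gt0 => h1 h2 h3 h4.
    rewrite ltNge; have := ct s u h1 h2 h3 h4.
    by rewrite [Yd (sigma t) _](YdC _ dm) => ->.
  move=> H s u h1 h2 h3 h4; rewrite leNgt; apply/negP => lt; apply: H.
  exists (s, u) => //=; split; [split; [split; [split|]|]|]; rewrite ?subr_gt0 //.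
  by rewrite [Yd (sigma u) (sigma t)](YdC _ dm).
apply: open_closedC; apply: bigcup_open => -[s u] _ /=.
have cid : continuous (fun t : R => t) by move=> t; exact: cvg_id.
do 4 ?apply: openI; apply: op => t; try exact: cF;
 repeat first [exact: cvg_cst | exact: cid | apply: cvgB | apply: cvgD].
Qed.

Lemma curved_at_le (del del' t : R) : del' <= del ->
  curved_at K k d sigma del t -> curved_at K k d sigma del' t.
Proof. by move=> le ct s u h1 h2 h3 h4; apply: ct => //; lra. Qed.

(** The sets [B n] of points not curved at scale [1 / (n + 1)] decrease to a null set, so some [B n]
    has measure below [eps]. Every cell without a curved point at that scale lies inside [B n], and
    cells are disjoint, whatever their number. *)
Lemma mostly_curved_ae :
  {ae mu, forall t, exists2 del, 0 < del & curved_at K k d sigma del t} ->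
  mostly_curved K k d sigma.
Proof.
move=> [A [mA A0 NA]] a b eps ab eps0.
have lem (A1 A2 : set (measurableTypeR R)) : measurable A1 -> measurable A2 -> A1 `<=` A2 -> (mu A1 <= mu A2)%E.
  by move=> h1 h2 h3; apply: le_measure => //; exact: mem_set.
pose G n := [set t | curved_at K k d sigma n.+1%:R^-1 t].
have mG n : measurable (G n) by apply: measurable_realfun.closed_measurable; apply: curved_at_closed.
pose B n := `]a, b[%classic `\` G n.
have mB n : measurable (B n) by apply: measurableD.
have Binc : nonincreasing_seq B.
  move=> m n mn; apply/subsetPset; apply: setDS => t; apply: curved_at_le.
  by rewrite lef_pV2 ?posrE // ler_nat ltnS.
have B0 : (mu (B 0%N) < +oo)%E.
  apply: le_lt_trans (_ : mu `]a, b[%classic < _)%E.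
    by apply: lem; [exact: mB|exact: measurable_itv|exact: subDsetl].
  by rewrite lebesgue_measure_itv /= lte_fin ab -EFinD ltry.
have cap0 : mu (\bigcap_n B n) = 0%E.
  apply/eqP; rewrite eq_le measure_ge0 andbT -A0.
  apply: lem => //; first exact: bigcapT_measurable.
  move=> t Bt; apply: NA => /= -[del del0 ct].
  have [_] := Bt (Num.truncn del^-1) I; apply => /=; apply: curved_at_le ct.
  by rewrite invf_ple ?posrE // ltW // truncnS_gt.
have cv : (mu \o B) x @[x --> \oo] --> (0%E : \bar R).
  by rewrite -cap0; exact: (nonincreasing_cvg_mu B0 mB (bigcapT_measurable mB) Binc).
have [n Bn] : exists n, (mu (B n) < eps%:E)%E.
  have [|m _ H] := cv [set x | (x < eps%:E)%E].
    by apply: open_nbhs_nbhs; split; [exact: open_ereal_lt_ereal|rewrite /= lte_fin].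
  by exists m; apply: (H m) => /=.
exists n.+1%:R^-1; first by rewrite invr_gt0.
move=> N N0; set eta := (b - a) / N%:R.
have etap : 0 < eta by rewrite divr_gt0 ?subr_gt0 // ltr0n.
have etaN : N%:R * eta = b - a by rewrite /eta mulrC divfK // pnatr_eq0 -lt0n.
set bad := fun i : nat => (~~ `[< curved_cell K k d sigma n.+1%:R^-1 (a + i%:R * eta) (a + i.+1%:R * eta) >]).
pose D (i : nat) := `]a, (a + i%:R * eta)[%classic.
have mBD i : measurable (B n `&` D i) by apply: measurableI; [exact: mB|exact: measurable_itv].
have main i : (i <= N)%N ->
    ((\sum_(j < i) (bad j)%:R * eta)%R%:E <= mu (B n `&` D i))%E.
  elim: i => [|i IH] iN; first by rewrite big_ord0 measure_ge0.
  have {}IH := IH (ltnW iN).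
  rewrite big_ord_recr /= EFinD.
  pose C := `](a + i%:R * eta), (a + i.+1%:R * eta)[%classic.
  have lt : a + i%:R * eta < a + i.+1%:R * eta by rewrite ltrD2l ltr_pM2r // ltr_nat.
  apply: (@le_trans _ _ (mu (B n `&` D i) + mu (B n `&` C))%E).
    apply: leeD => //; rewrite /bad; case: asboolP => cc /=; first by rewrite mul0r measure_ge0.
    rewrite mul1r (_ : B n `&` C = C).
      rewrite lebesgue_measure_itv /= lte_fin lt -EFinD lee_fin -natr1; lra.
    apply/setIidPr => t; rewrite /C /= in_itv /= => /andP[t1 t2]; split.
      rewrite /= in_itv /=; apply/andP; split.
        by apply: le_lt_trans t1; rewrite lerDl mulr_ge0 // ltW.
      apply: lt_le_trans t2 _; rewrite -lerBrDl -etaN ler_pM2r // ler_nat //.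
    by move=> ct; apply: cc; exists t => //; rewrite t1.
  have mC : measurable (B n `&` C) by apply: measurableI; [exact: mB|exact: measurable_itv].
  have mU : mu ((B n `&` D i) `|` (B n `&` C)) = (mu (B n `&` D i) + mu (B n `&` C))%E.
    apply: measureU; [exact: mBD|exact: mC|].
    rewrite setIACA setIid (_ : _ `&` C = set0) ?setI0 //.
    apply/seteqP; split => t //=; rewrite /C /D /= !in_itv /= => -[/andP[_ h1] /andP[h2 _]].
    by have := lt_trans h1 h2; rewrite ltxx.
  rewrite -mU; apply: lem.
  - by apply: measurableU; [exact: mBD|exact: mC].
  - exact: mBD.
  - move=> t [[Bt]|[Bt]] /=; rewrite /C /D /= !in_itv /= => /andP[h1 h2]; split => //;
      apply/andP; split => //.
    + exact: lt_trans lt.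
    + by apply: le_lt_trans h1; rewrite lerDl mulr_ge0 // ltW.
have := main N (leqnn N) => le; rewrite -lee_fin; apply: le_trans le _.
apply: le_trans (ltW Bn); apply: lem; [exact: mBD|exact: mB|].
exact: subIsetl.
Qed.

End Measure.

(** * From one-sided angles to the global bound *)

Section Reversal.
Variables (R : realType) (K k : R) (X : Type) (d : X -> X -> R) (L : R) (sigma : R -> X).
Hypothesis dm : is_metric d.
Hypothesis period : forall t, sigma (t + L) = sigma t.
Local Notation rsigma := (fun t => sigma (- t)).

Let dC x y : d x y = d y x. Proof. by case: dm. Qed.

(** Negation reverses the order of the parameters; adding [L] to the last three makes the sequence
    increase from the same vertex again. *)
Lemma cyclic_superadd_rev : cyclic_superadd K d L sigma -> cyclic_superadd K d L rsigma.
Proof.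
move=> SA t0 t1 t2 t3 h1 h2 h3 h4 p1 p2 p3 p4.
have := @SA (- t0) (- t3 + L) (- t2 + L) (- t1 + L); rewrite !period.
rewrite ![pang K d (sigma (- t0)) (sigma (- t3)) _](pangC _ dm).
rewrite [pang K d (sigma (- t0)) (sigma (- t2)) (sigma (- t1))](pangC _ dm) [pang _ _ _ (sigma (- t2)) _ + _]addrC.
apply; try lra.
- move: p2; rewrite [d (sigma (- t3)) (sigma (- t0))]dC [d (sigma (- t2)) (sigma (- t3))]dC [d (sigma (- t0)) (sigma (- t2))]dC; lra.
- move: p1; rewrite [d (sigma (- t1)) (sigma (- t0))]dC [d (sigma (- t2)) (sigma (- t1))]dC [d (sigma (- t0)) (sigma (- t2))]dC; lra.
- move: p3; rewrite [d (sigma (- t1)) (sigma (- t2))]dC [d (sigma (- t3)) (sigma (- t1))]dC [d (sigma (- t2)) (sigma (- t3))]dC; lra.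
Qed.

Lemma curved_at_rev (del t : R) : curved_at K k d sigma del (- t) -> curved_at K k d rsigma del t.
Proof.
move=> ct s u h1 h2 h3 h4.
have := ct (- u) (- s); rewrite DelC12.
rewrite ![Yd K d (sigma (- t)) (sigma (- s))](YdC _ dm) ![Yd K d (sigma (- u)) (sigma (- t))](YdC _ dm).
rewrite ![Yd K d (sigma (- u)) (sigma (- s))](YdC _ dm).
rewrite [2 * k ^+ 2 * Yd K d (sigma (- t)) _ * _]mulrAC; apply; lra.
Qed.

Lemma mostly_curved_rev : mostly_curved K k d sigma -> mostly_curved K k d rsigma.
Proof.
move=> MC a b eps ab eps0.
have ab' : - b < - a by rewrite ltrN2.
have [del del0 H] := MC _ _ _ ab' eps0; exists del => // N N0.
apply: le_trans (H N N0); rewrite (reindex_inj rev_ord_inj) /=.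
have -> : - a - - b = b - a by ring.
set eta := (b - a) / N%:R.
have etaN : N%:R * eta = b - a by rewrite /eta mulrC divfK // pnatr_eq0 -lt0n.
have eta0 : 0 <= eta by rewrite divr_ge0 // subr_ge0 ltW.
clearbody eta.
apply: ler_sum => i _; rewrite ler_wpM2r // ler_nat.
suff imp : curved_cell K k d sigma del (- b + i%:R * eta) (- b + i.+1%:R * eta) ->
    curved_cell K k d rsigma del (a + (N - i.+1)%:R * eta) (a + (N - i.+1).+1%:R * eta).
  by case: asboolP => c1; case: asboolP => c2 //=; exfalso; apply: c1; apply: imp.
move=> [t /andP[t1 t2] ct]; exists (- t); last by apply: curved_at_rev; rewrite opprK.
rewrite subnSK // !natrB ?(ltnW (ltn_ord i)) // !mulrBl etaN; apply/andP; split; lra.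
Qed.

End Reversal.

Section FirstHit.
Variable R : realType.

Lemma first_hit (f : R -> R) (a b v : R) : continuous f -> a <= b -> f a < v -> v <= f b ->
  exists t, [/\ a < t, t <= b, f t = v & forall u, a <= u -> u < t -> f u < v].
Proof.
move=> cf ab fa fb.
pose E := `[a, b]%classic `&` [set t | v <= f t].
have cE : compact E.
  apply: (@subclosed_compact _ E `[a, b]%classic).
  - apply: closedI; first exact: interval_closed.
    apply: (@closed_comp _ _ f [set x | v <= x]); last exact: closed_ge.
    by move=> x _; exact: cf.
  - exact: segment_compact.
  - by move=> x [].
have Eb : E !=set0 by exists b; split => //=; rewrite in_itv /= ab lexx.
have cid : {within E, continuous (fun x : R => x)}.
  by apply: continuous_subspaceT => x; exact: cvg_id.
have [t tE tmin] := compact_EVT_min Eb cE cid.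
move: tE; rewrite inE => -[] /=; rewrite in_itv /= => /andP[at_ tb] vt.
have a_t : a < t by rewrite lt_neqAle at_ andbT; apply/eqP => e; move: vt; rewrite -e leNgt fa.
have lt u : a <= u -> u < t -> f u < v.
  move=> au ut; rewrite ltNge; apply/negP => vu.
  have : u \in E by rewrite inE; split => //=; rewrite in_itv /= au (le_trans (ltW ut)).
  by move/tmin; rewrite leNgt ut.
exists t; split => //; apply/eqP; rewrite eq_le vt andbT leNgt; apply/negP => ltv.
have cf' : {within `[a, t], continuous f} by apply: continuous_subspaceT.
have [|c] := IVT (v := v) at_ cf'.
  by rewrite ge_min (ltW fa) le_max (ltW ltv) orbT.
rewrite in_itv /= => /andP[ac ct] fc.
have : c < t by rewrite lt_neqAle ct andbT; apply/eqP => e; move: ltv; rewrite -e fc ltxx.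
by move/(lt c ac); rewrite fc ltxx.
Qed.

End FirstHit.

(** * Heron polynomials of special triangles *)

Section Algebra.
Variables (R : realType) (K : R).
Hypothesis K_ge0 : 0 <= K.

Lemma circ_curvE (a b c : R) : 0 < md K a -> 0 < md K b -> 0 < md K c ->
  circ_curv K a b c =
  Num.sqrt (Del K (md K a) (md K b) (md K c) / (2 * md K a * md K b * md K c)).
Proof.
rewrite /circ_curv /md; move: (chord K a) (chord K b) (chord K c) => A B C.
have nz (x : R) : 0 < x ^+ 2 / 2 -> x != 0.
  by apply: contraTneq => ->; rewrite expr0n /= mul0r ltxx.
move=> /nz A0 /nz B0 /nz C0; congr Num.sqrt; rewrite /Del; field.
by rewrite A0 B0 C0.
Qed.

(** The triangle is a full great circle: [md c = md (a + b)], so a factor of [Del] vanishes. *)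
Lemma Del_full_perimeter (a b c : R) : 0 < Num.sqrt K ->
  Num.sqrt K * (a + b + c) = 2 * pi -> Del K (md K a) (md K b) (md K c) = 0.
Proof.
move=> s0 per.
have K0 : K != 0 by apply: contraTneq s0 => ->; rewrite sqrtr0 ltxx.
have -> : md K c = md K (a + b).
  rewrite !mdE // (negbTE K0); congr ((1 - _) / _).
  have -> : Num.sqrt K * c = 2 * pi - Num.sqrt K * (a + b) by rewrite -per; ring.
  by rewrite [2 * pi]mulr_natl cosB cos2pi sin2pi mul1r mul0r addr0.
have h1 := sn_sqr K_ge0 a; have h2 := sn_sqr K_ge0 b.
rewrite md_add // /Del; ring: h1 h2.
Qed.

(** [Del] has two factors, and the upper bound on [c] controls only one. The other is negative only
    for a [c] that is too short, which [c] being the longest side excludes; no perimeter bound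
    enters. *)
Lemma Del_ge0_longest (a b c : R) : 0 <= a -> 0 <= b -> K * a <= 2 -> K * b <= 2 ->
  a <= c -> b <= c -> c <= a + b - K * a * b + Sy K a * Sy K b -> 0 <= Del K a b c.
Proof.
wlog ba : a b / b <= a.
  move=> W a0 b0 a2 b2 ac bc h; case: (leP b a) => ba; first exact: W.
  rewrite DelC12; apply: W => //; first exact: ltW.
  by move: h; rewrite [Sy K b * _]mulrC; lra.
move=> a0 b0 a2 b2 ac bc h.
have Sa := Sy_sqr a0 a2; have Sb := Sy_sqr b0 b2.
have sa0 : 0 <= Sy K a by rewrite sqrtr_ge0.
have sb0 : 0 <= Sy K b by rewrite sqrtr_ge0.
have -> : Del K a b c = (Sy K a * Sy K b - (a + b - K * a * b - c)) * (Sy K a * Sy K b + (a + b - K * a * b - c)).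
  by rewrite /Del; ring: Sa Sb.
apply: mulr_ge0; last by lra.
have ss := mulr_ge0 sa0 sb0.
suff : b * (1 - K * a) <= Sy K a * Sy K b by lra.
case: (leP (1 - K * a) 0) => q; first by apply: le_trans ss; rewrite mulr_ge0_le0.
rewrite -ler_sqr ?nnegrE ?mulr_ge0 ?(ltW q) // !exprMn Sa Sb.
have Kb : K * b <= K * a by rewrite ler_wpM2l.
have ka0 : 0 <= K * a by rewrite mulr_ge0.
have e1 : b ^+ 2 * (1 - K * a) ^+ 2 <= b * a.
  rewrite expr2 -mulrA ler_wpM2l //.
  have : (1 - K * a) ^+ 2 <= 1 by rewrite expr_le1 //; lra.
  by move/(ler_wpM2l b0); lra.
apply: le_trans e1 _.
have -> : (2 * a - K * a ^+ 2) * (2 * b - K * b ^+ 2) = (b * a) * ((2 - K * a) * (2 - K * b)) by ring.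
rewrite ler_peMr ?mulr_ge0 //.
have x1 : 1 <= 2 - K * a by lra.
have x2 : 1 <= 2 - K * b by lra.
by rewrite -[X in X <= _]mulr1; apply: ler_pM.
Qed.

End Algebra.

(** * The angle between a chord and the boundary *)

Section OneSided.
Variables (R : realType) (K kappa : R) (X : Type) (d : X -> X -> R) (L : R) (sigma : R -> X).
Hypothesis K_ge0 : 0 <= K.
Hypothesis kappa_gt0 : 0 < kappa.
Hypothesis dm : is_metric d.
Hypothesis lip : forall s t, d (sigma s) (sigma t) <= `|s - t|.
Hypothesis inj : forall s t, s < t -> t < s + L -> sigma s <> sigma t.
Hypothesis period : forall t, sigma (t + L) = sigma t.
Hypothesis SA : cyclic_superadd K d L sigma.
Hypothesis MC : forall k, 0 < k -> k < kappa -> mostly_curved K k d sigma.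
Local Notation sK := (Num.sqrt K).
Local Notation Sy := (Sy K).
Local Notation Yd := (Yd K d).
Local Notation pang := (pang K d).

Let dC x y : d x y = d y x. Proof. by case: dm. Qed.
Let dxx x : d x x = 0. Proof. by case: dm => _ h _ _; apply/h. Qed.
Let s0 : 0 <= sK. Proof. exact: sqrtr_ge0. Qed.

Lemma base_defect (k tp T rho : R) : 0 < k -> k < kappa -> tp < T -> T < tp + L ->
  sK * rho < pi -> (forall t, tp <= t <= T -> d (sigma tp) (sigma t) <= rho) ->
  k * Yd (sigma tp) (sigma T) <= Sy (Yd (sigma tp) (sigma T)).
Proof.
move=> k0 kk tpT TL rhopi drho; apply/ler_addgt0Pr => eps eps0.
have [t [_ _ _ /=]] := base_angle K_ge0 k0 dm lip inj period SA (MC k0 kk) tpT TL eps0 rhopi drho.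
case=> -[_ h]; first by lra.
have : Sy (Yd (sigma tp) (sigma T)) * sin (pang (sigma T) (sigma tp) (sigma t)) <= Sy (Yd (sigma tp) (sigma T)).
  by rewrite ler_piMr ?sqrtr_ge0 // sin_le1.
lra.
Qed.

(** A bootstrap: [base_defect] applies only while distances [r] satisfy [sK * r < pi] with a margin,
    and then bounds them by the diameter [r1] of a circle of curvature [kappa / 2]. A distance above
    [r1] would first have to reach some [v] with [r1 < v <= r2]; up to that time [base_defect]
    applies, with bound [v], and contradicts [r1 < v]. *)
Lemma boundary_diameter : exists2 rho, sK * rho < pi &
  forall tp T, tp <= T -> T < tp + L -> d (sigma tp) (sigma T) <= rho.
Proof.
have Kg := K_ge0; pose k := kappa / 2.
have k0 : 0 < k by rewrite divr_gt0.
have kk : k < kappa by rewrite /k; move: kappa_gt0; lra.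
have k2 : 0 < k ^+ 2 by rewrite exprn_gt0.
(* [y1] solves [Sy y = k * y], hence is [md] of the diameter of a circle of curvature [k]; [y2] is a
   larger value that still has [K * y2 < 2]. *)
pose y1 := 2 / (K + k ^+ 2); pose y2 := 2 / (K + k ^+ 2 / 2).
have D1 : 0 < K + k ^+ 2 by lra.
have D2 : 0 < K + k ^+ 2 / 2 by lra.
have y10 : 0 < y1 by rewrite divr_gt0.
have y20 : 0 < y2 by rewrite divr_gt0.
have y12 : y1 < y2 by rewrite ltr_pM2l // ltf_pV2 ?posrE //; lra.
have Ky2 : K * y2 < 2 by rewrite /y2 mulrA ltr_pdivrMr //; nra.
have Ky1 : K * y1 < 2 by apply: le_lt_trans Ky2; rewrite ler_wpM2l // ltW.
have lt_pi r : 0 <= r -> sK * r <= pi -> K * md K r < 2 -> sK * r < pi.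
  move=> r0 rp h; rewrite lt_neqAle rp andbT; apply/eqP => e.
  case: (eqVneq K 0) => K0; first by move: e; rewrite K0 sqrtr0 mul0r => e; have := pi_gt0 R; lra.
  move: h; rewrite mdE // (negbTE K0) e cospi mulrC divfK //; lra.
have [r1 [r10 r1p e1]] := md_surj K_ge0 (ltW y10) (ltW Ky1).
have [r2 [r20 r2p e2]] := md_surj K_ge0 (ltW y20) (ltW Ky2).
have r2pi : sK * r2 < pi by apply: lt_pi => //; rewrite e2.
have r12 : r1 < r2 by apply: (md_lt_inv K_ge0) => //; rewrite e1 e2.
exists r1; first by apply: lt_pi => //; rewrite e1.
move=> tp T; rewrite le_eqVlt => /orP[/eqP <-|tpT] TL; first by rewrite dxx.
rewrite leNgt; apply/negP => big.
pose v := Num.min (d (sigma tp) (sigma T)) r2.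
have v1 : r1 < v by rewrite lt_min big r12.
have v2 : v <= d (sigma tp) (sigma T) by rewrite ge_min lexx.
have v3 : v <= r2 by rewrite ge_min lexx orbT.
have cont := @dist_sigma_continuous R X d sigma dm lip (sigma tp).
have [|t [t1 t2 t3 t4]] := first_hit cont (ltW tpT) _ v2.
  by rewrite dxx; apply: le_lt_trans v1.
have vpi : sK * v < pi by apply: le_lt_trans r2pi; rewrite ler_wpM2l.
have bd u : tp <= u <= t -> d (sigma tp) (sigma u) <= v.
  move=> /andP[u1]; rewrite le_eqVlt => /orP[/eqP ->|u2]; first by rewrite t3.
  by apply: ltW; apply: t4.
have H := base_defect k0 kk t1 (le_lt_trans t2 TL) vpi bd.
have v0 : 0 < v by apply: le_lt_trans v1.
have Yv : Yd (sigma tp) (sigma t) = md K v by rewrite /(Yd _ _) t3.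
rewrite Yv in H.
have yv0 : 0 < md K v by apply: md_gt0 => //; apply: ltW.
have : y1 < md K v by rewrite -e1 md_lt // ltW.
have kv : 0 <= k * md K v by apply: mulr_ge0; apply: ltW.
move: H; rewrite -ler_sqr ?nnegrE ?sqrtr_ge0 //.
rewrite Sy_sqr ?(ltW yv0) ?md_le2 // => H.
have : (K + k ^+ 2) * md K v <= 2.
  rewrite -(ler_pM2r yv0); move: H; rewrite exprMn; lra.
by rewrite /y1 mulrC -ler_pdivlMr // => h1 h2; move: (lt_le_trans h2 h1); rewrite ltxx.
Qed.

(** A limit angle between chord and boundary need not exist, so the bound is stated as follows:
    every [alpha] strictly below the angle in the circle of curvature [kappa] is exceeded by
    comparison angles at points arbitrarily close to [T]. *)
Lemma base_angle_limit (tp T rho eps alpha : R) : tp < T -> T < tp + L ->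
  sK * rho < pi -> (forall t, tp <= t <= T -> d (sigma tp) (sigma t) <= rho) ->
  0 < eps -> 0 <= alpha -> alpha < pi / 2 ->
  Sy (Yd (sigma tp) (sigma T)) * sin alpha < kappa * Yd (sigma tp) (sigma T) ->
  exists t, [/\ T - eps < t, tp < t, t < T & alpha <= pang (sigma T) (sigma tp) (sigma t)].
Proof.
move=> tpT TL rhopi drho eps0 a0 a1 ha.
set y := Yd (sigma tp) (sigma T) in ha; set S := Sy y in ha.
have y0 : 0 <= y := Yd_ge0 K d _ _.
have S0 : 0 <= S by rewrite sqrtr_ge0.
have sa : 0 <= sin alpha by apply: sin_ge0_pi; have := pi_gt0 R; lra.
have yp : 0 < y.
  rewrite lt_neqAle y0 andbT eq_sym; apply/eqP => e; move: ha; rewrite e mulr0.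
  by rewrite ltNge mulr_ge0.
(* Halfway between [kappa] and the curvature at which [alpha] would be the angle of the chord. *)
pose k := (S * sin alpha / y + kappa) / 2.
have q1 : S * sin alpha / y < kappa by rewrite ltr_pdivrMr.
have q0 : 0 <= S * sin alpha / y by apply: divr_ge0 => //; exact: mulr_ge0.
have kE : k * y = (S * sin alpha + kappa * y) / 2.
  by rewrite /k; field; rewrite gt_eqF.
have k0 : 0 < k by rewrite /k; move: kappa_gt0 q0; lra.
have kk : k < kappa by rewrite /k; move: q1; lra.
clearbody k.
have [g g0 gP] : exists2 g, 0 < g & sK * (rho + g) < pi.
  have g0 : 0 < (pi - sK * rho) / 2 by lra.
  have [|g gp H] := @small_scale R [:: (sK, (pi - sK * rho) / 2)]; first by rewrite /= g0.
  by exists g => //; have := H g (ltW gp) (lexx _) => /= /andP[]; lra.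
pose eps1 := Num.min (Num.min eps g) ((kappa * y - S * sin alpha) / 4).
have e10 : 0 < eps1 by rewrite !lt_min eps0 g0 divr_gt0 ?subr_gt0.
have e11 : eps1 <= eps by rewrite !ge_min lexx.
have e13 : eps1 <= g by rewrite !ge_min lexx orbT.
have e12 : eps1 <= (kappa * y - S * sin alpha) / 4 by rewrite ge_min lexx orbT.
have [t [t1 t2 t3 /=]] := base_angle K_ge0 k0 dm lip inj period SA (MC k0 kk) tpT TL e10 rhopi drho.
rewrite -/y -/S => H; exists t; split => //; first by lra.
have rT : d (sigma tp) (sigma T) <= rho by apply: drho; rewrite lexx (ltW tpT).
have nT : sigma T <> sigma tp by apply/nesym/inj.
have nt : sigma T <> sigma t by apply/nesym/inj => //; lra.
have rt : d (sigma tp) (sigma t) <= rho by apply: drho; rewrite (ltW t2) (ltW t3).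
have per : sK * (d (sigma T) (sigma tp) + d (sigma tp) (sigma t) + d (sigma t) (sigma T)) < 2 * pi.
  have dd : d (sigma T) (sigma t) <= 2 * g.
    by apply: le_trans (lip _ _) _; rewrite gtr0_norm ?subr_gt0 //; lra.
  have := small_perimeter dm gP rT rt dd.
  by rewrite [d (sigma T) (sigma tp)]dC [d (sigma t) (sigma tp)]dC [d (sigma T) (sigma t)]dC; lra.
have r := pang_range K_ge0 dm nT nt per; have pp := pi_gt0 R.
case: H => -[c1 c2].
  case: (leP alpha (pang (sigma T) (sigma tp) (sigma t))) => // lt.
  have : cos (pang (sigma T) (sigma tp) (sigma t)) <= 0 := c1.
  move=> c; have : 0 < cos (pang (sigma T) (sigma tp) (sigma t)) by apply: cos_gt0_pihalf; lra.
  lra.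
move: (c1) => /ltW; rewrite (cos_ge0_lepihalf r) => q2.
have : S * sin alpha < S * sin (pang (sigma T) (sigma tp) (sigma t)) by lra.
have Sp : 0 < S.
  rewrite lt_neqAle S0 andbT eq_sym; apply/eqP => e; move: c2; rewrite e mul0r kE e mul0r add0r.
  by move: e12; rewrite e mul0r subr0 => h1 h2; have := mulr_gt0 kappa_gt0 yp; lra.
rewrite ltr_pM2l // => h; rewrite leNgt; apply/negP => lt; move: h; rewrite ltNge; apply/negP.
by apply/negPn/ltW; rewrite ltr_sin ?in_itv //=; lra.
Qed.

End OneSided.

Lemma asin_gt0 (R : realType) (x : R) : 0 < x -> x <= 1 -> 0 < asin x.
Proof.
move=> x0 x1; have ix : -1 <= x <= 1 by lra.
rewrite ltNge; apply/negP => le; have : sin (asin x) <= 0.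
  by rewrite -oppr_ge0 -sinN; apply: sin_ge0_pi; have := asin_geNpi2 ix; have := pi_gt0 R; lra.
by rewrite asinK ?in_itv //; lra.
Qed.

(** * The vertex opposite to the longest side *)

Section Global.
Variables (R : realType) (K kappa : R) (X : Type) (d : X -> X -> R) (L : R) (sigma : R -> X).
Hypothesis K_ge0 : 0 <= K.
Hypothesis kappa_gt0 : 0 < kappa.
Hypothesis dm : is_metric d.
Hypothesis lip : forall s t, d (sigma s) (sigma t) <= `|s - t|.
Hypothesis inj : forall s t, s < t -> t < s + L -> sigma s <> sigma t.
Hypothesis period : forall t, sigma (t + L) = sigma t.
Hypothesis SA : cyclic_superadd K d L sigma.
Hypothesis MC : forall k, 0 < k -> k < kappa -> mostly_curved K k d sigma.
Local Notation sK := (Num.sqrt K).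
Local Notation SyK := (Sy K).
Local Notation Yd := (Yd K d).
Local Notation pang := (pang K d).
Local Notation rsigma := (fun t => sigma (- t)).

Let d_ge0 x y : 0 <= d x y. Proof. by case: dm. Qed.
Let dC x y : d x y = d y x. Proof. by case: dm. Qed.
Let d_tri x y z : d x z <= d x y + d y z. Proof. by case: dm. Qed.
Let s0 : 0 <= sK. Proof. exact: sqrtr_ge0. Qed.

Let rlip s t : d (rsigma s) (rsigma t) <= `|s - t|.
Proof. by apply: le_trans (lip _ _) _; rewrite distrC opprK addrC. Qed.
Let rinj s t : s < t -> t < s + L -> rsigma s <> rsigma t.
Proof. by move=> h1 h2; apply/nesym/inj; lra. Qed.
Let rperiod t : rsigma (t + L) = rsigma t.
Proof. by rewrite /= -(period (- (t + L))); congr sigma; ring. Qed.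
Let rSA : cyclic_superadd K d L rsigma.
Proof. exact: cyclic_superadd_rev. Qed.
Let rMC k : 0 < k -> k < kappa -> mostly_curved K k d rsigma.
Proof. by move=> k0 kk; apply: mostly_curved_rev => //; apply: MC. Qed.

(** Choose [x] just before and [y] just after the middle point [q] by [base_angle_limit], for [y]
    along the reversed curve. Superadditivity, used twice, adds the three angles at [q] into the
    comparison angle between [x] and [y], which is at most [pi]. *)
Lemma angle_sum (t1 t2 t3 rho a1 a3 : R) : t1 < t2 -> t2 < t3 -> t3 < t1 + L ->
  sK * rho < pi -> (forall s t, s <= t -> t < s + L -> d (sigma s) (sigma t) <= rho) ->
  sK * (d (sigma t1) (sigma t2) + d (sigma t2) (sigma t3) + d (sigma t3) (sigma t1)) < 2 * pi ->
  0 <= a1 -> a1 < pi / 2 -> 0 <= a3 -> a3 < pi / 2 ->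
  SyK (Yd (sigma t1) (sigma t2)) * sin a1 < kappa * Yd (sigma t1) (sigma t2) ->
  SyK (Yd (sigma t3) (sigma t2)) * sin a3 < kappa * Yd (sigma t3) (sigma t2) ->
  a1 + pang (sigma t2) (sigma t1) (sigma t3) + a3 <= pi.
Proof.
move=> t12 t23 t31 rhopi drho per a10 a1p a30 a3p h1 h3.
have [e e0 [eP per']] : exists2 e, 0 < e & sK * (rho + 2 * e) < pi /\
    sK * (d (sigma t1) (sigma t2) + d (sigma t2) (sigma t3) + d (sigma t3) (sigma t1) + 2 * e) < 2 * pi.
  have g0 : 0 < (pi - sK * rho) / 2 by lra.
  have g1 : 0 < (2 * pi - sK * (d (sigma t1) (sigma t2) + d (sigma t2) (sigma t3) + d (sigma t3) (sigma t1))) / 2 by lra.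
  have [|g gp H] := @small_scale R [:: (2 * sK, (pi - sK * rho) / 2);
     (2 * sK, (2 * pi - sK * (d (sigma t1) (sigma t2) + d (sigma t2) (sigma t3) + d (sigma t3) (sigma t1))) / 2)].
    by rewrite /= g0 g1.
  exists g => //; have := H g (ltW gp) (lexx _) => /= /andP[q1 /andP[q2 _]].
  by split; lra.
have t2L : t2 < t1 + L := lt_trans t23 t31.
have [t [u1 u2 u3 A1]] := base_angle_limit K_ge0 kappa_gt0 dm lip inj period SA MC t12 t2L rhopi
  (fun t ht => drho t1 t (andP ht).1 (le_lt_trans (andP ht).2 t2L)) e0 a10 a1p h1.
have h3' : SyK (Yd (rsigma (- t3)) (rsigma (- t2))) * sin a3 < kappa * Yd (rsigma (- t3)) (rsigma (- t2)).
  by rewrite /= !opprK.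
have t23' : - t3 < - t2 by rewrite ltrN2.
have t2L' : - t2 < - t3 + L by lra.
have drho' t' : - t3 <= t' <= - t2 -> d (rsigma (- t3)) (rsigma t') <= rho.
  by move=> /andP[q1 q2] /=; rewrite opprK dC; apply: drho; lra.
have [v' [v1' v2' v3']] := base_angle_limit K_ge0 kappa_gt0 dm rlip rinj rperiod rSA rMC t23' t2L' rhopi
  drho' e0 a30 a3p h3'.
rewrite /= !opprK; set v := - v' => A3.
have v1 : t2 < v by rewrite /v; lra.
have v2 : v < t3 by rewrite /v; lra.
have v3 : v < t2 + e by rewrite /v; lra.
clearbody v; clear v1' v2' v3' v' h1 h3 h3' a10 a1p a30 a3p t23' t2L' drho'.
set p := sigma t1 in per per' A1 *; set q := sigma t2 in per per' A1 A3 *; set m := sigma t3 in per per' A3 *.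
set x := sigma t in A1 *; set y := sigma v in A3 *.
have qx : d q x <= e.
  by apply: le_trans (lip _ _) _; rewrite gtr0_norm ?subr_gt0 //; lra.
have qy : d q y <= e.
  by apply: le_trans (lip _ _) _; rewrite distrC gtr0_norm ?subr_gt0 //; lra.
have qp : d q p <= rho by rewrite dC; apply: drho => //; apply: ltW.
have qm : d q m <= rho by apply: drho; [apply: ltW|lra].
have eP1 : sK * (rho + e) < pi by apply: le_lt_trans eP; rewrite ler_wpM2l //; lra.
have near z w : d q z <= rho -> d q w <= e -> sK * (d q w + d w z + d z q) < 2 * pi.
  move=> qz qw; apply: le_lt_trans (_ : sK * (2 * (rho + e)) < _); last by lra.
  rewrite ler_wpM2l //; have := d_tri w q z; rewrite [d w q]dC [d z q]dC; lra.
have near' z w : d q z <= rho -> d q w <= e -> sK * (d q z + d z w + d w q) < 2 * pi.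
  by move=> qz qw; have := near z w qz qw; rewrite [d z w]dC [d z q]dC [d q w]dC; lra.
have S1 : pang q y m + pang q m p <= pang q y p.
  have := @SA t2 v t3 (t1 + L); rewrite !period -/p -/q -/m -/y; apply => //.
  - by rewrite ltrD2r.
  - exact: near.
  - by move: per; rewrite [d q m]dC [d p q]dC [d m p]dC [d m q]dC [d q p]dC; lra.
  - apply: le_lt_trans per'; rewrite ler_wpM2l //.
    have := d_tri m q y; have := d_tri y q p; rewrite [d y q]dC [d m q]dC [d q p]dC [d m p]dC; lra.
  - by apply: le_lt_trans eP1; rewrite ler_wpM2l //; lra.
have S2 : pang q y p + pang q p x <= pang q y x.
  have := @SA t2 v (t1 + L) (t + L); rewrite !period -/p -/q -/x -/y; apply => //.
  - by lra.
  - by rewrite ltrD2r.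
  - by rewrite ltrD2r.
  - exact: near.
  - exact: near'.
  - apply: le_lt_trans (_ : sK * (2 * (rho + 2 * e)) < _); last by lra.
    rewrite ler_wpM2l //; have := d_tri p q y; have := d_tri y q x; have := d_tri x q p.
    by rewrite [d y q]dC [d x q]dC [d p q]dC; lra.
  - by apply: le_lt_trans eP; rewrite ler_wpM2l //; have := le_trans (d_ge0 _ _) qp; lra.
have nqy : q <> y by apply: inj => //; lra.
have nqx : q <> x by apply/nesym/inj => //; lra.
have perxy : sK * (d q y + d y x + d x q) < 2 * pi.
  apply: le_lt_trans (_ : sK * (2 * (rho + 2 * e)) < _); last by lra.
  have := le_trans (d_ge0 _ _) qp => rho0.
  rewrite ler_wpM2l //; have := d_tri y q x; rewrite [d y q]dC [d x q]dC; lra.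
have /andP[_ S3] := pang_range K_ge0 dm nqy nqx perxy.
move: A3 S1; rewrite [pang q m y](pangC _ dm) [pang q m p](pangC _ dm); lra.
Qed.

Lemma angle_sum_asin (t1 t2 t3 rho : R) : t1 < t2 -> t2 < t3 -> t3 < t1 + L ->
  sK * rho < pi -> (forall s t, s <= t -> t < s + L -> d (sigma s) (sigma t) <= rho) ->
  sK * (d (sigma t1) (sigma t2) + d (sigma t2) (sigma t3) + d (sigma t3) (sigma t1)) < 2 * pi ->
  forall x1 x3, 0 < x1 -> x1 <= 1 -> 0 < x3 -> x3 <= 1 ->
  SyK (Yd (sigma t1) (sigma t2)) * x1 = kappa * Yd (sigma t1) (sigma t2) ->
  SyK (Yd (sigma t3) (sigma t2)) * x3 = kappa * Yd (sigma t3) (sigma t2) ->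
  0 < SyK (Yd (sigma t1) (sigma t2)) -> 0 < SyK (Yd (sigma t3) (sigma t2)) ->
  asin x1 + pang (sigma t2) (sigma t1) (sigma t3) + asin x3 <= pi.
Proof.
move=> t12 t23 t31 rhopi drho per x1 x3 x10 x11 x30 x31 h1 h3 S1 S3.
rewrite leNgt; apply/negP => big.
have pp := pi_gt0 R.
have i1 : -1 <= x1 <= 1 by lra.
have i3 : -1 <= x3 <= 1 by lra.
have p1 := asin_gt0 x10 x11; have p3 := asin_gt0 x30 x31.
have q1 := asin_lepi2 i1; have q3 := asin_lepi2 i3.
set b1 := asin x1 in big p1 q1; set b3 := asin x3 in big p3 q3.
have sb1 : sin b1 = x1 by rewrite /b1 asinK // in_itv.
have sb3 : sin b3 = x3 by rewrite /b3 asinK // in_itv.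
clearbody b1 b3.
set th := pang _ _ _ in big.
(* A third of the excess over [pi]: lowering both arcs by [g] leaves an excess and meets the strict
   hypotheses of [angle_sum]. *)
pose g := (b1 + th + b3 - pi) / 3.
have g0 : 0 < g by rewrite /g; lra.
pose a1 := Num.max 0 (b1 - g); pose a3 := Num.max 0 (b3 - g).
have aP b : 0 < b -> b <= pi / 2 -> [/\ 0 <= Num.max 0 (b - g), Num.max 0 (b - g) < pi / 2,
    b - g <= Num.max 0 (b - g) & Num.max 0 (b - g) < b].
  move=> b0 bp; have lt : Num.max 0 (b - g) < b by rewrite gt_max b0; lra.
  split => //; [by rewrite le_max lexx|exact: lt_le_trans bp|by rewrite le_max lexx orbT].
have [a10 a1p a1g a1b] := aP b1 p1 q1; have [a30 a3p a3g a3b] := aP b3 p3 q3.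
rewrite -/a1 in a10 a1p a1g a1b; rewrite -/a3 in a30 a3p a3g a3b; clearbody a1 a3.
have := @angle_sum t1 t2 t3 rho a1 a3 t12 t23 t31 rhopi drho per a10 a1p a30 a3p.
have l1 : sin a1 < x1 by rewrite -sb1 ltr_sin ?in_itv //=; lra.
have l3 : sin a3 < x3 by rewrite -sb3 ltr_sin ?in_itv //=; lra.
rewrite -h1 -h3 !ltr_pM2l // => /(_ l1 l3); rewrite -/th.
by move: a1g a3g; rewrite /g; lra.
Qed.

(** The sum of angles bounds the comparison angle at the middle point above by [pi] minus two angles
    of chords in a circle of curvature [kappa]. By the law of cosines this is an upper bound on the
    longest side, the one [Del_ge0_longest] asks for in curvature [K + kappa ^ 2]. *)
Lemma Del_longest_side (t1 t2 t3 rho : R) : t1 < t2 -> t2 < t3 -> t3 < t1 + L ->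
  sK * rho < pi -> (forall s t, s <= t -> t < s + L -> d (sigma s) (sigma t) <= rho) ->
  sK * (d (sigma t1) (sigma t2) + d (sigma t2) (sigma t3) + d (sigma t3) (sigma t1)) < 2 * pi ->
  Yd (sigma t1) (sigma t2) <= Yd (sigma t1) (sigma t3) ->
  Yd (sigma t2) (sigma t3) <= Yd (sigma t1) (sigma t3) ->
  0 <= Del (K + kappa ^+ 2) (Yd (sigma t1) (sigma t2)) (Yd (sigma t2) (sigma t3)) (Yd (sigma t1) (sigma t3)).
Proof.
move=> t12 t23 t31 rhopi drho per le1 le3.
have t2L : t2 < t1 + L := lt_trans t23 t31.
have t3L : t3 < t2 + L by apply: lt_trans t31 _; rewrite ltrD2r.
set p := sigma t1 in per le1 le3 *; set q := sigma t2 in per le1 le3 *; set m := sigma t3 in per le1 le3 *.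
have nqp : q <> p by apply/nesym/inj.
have nqm : q <> m by apply: inj.
have dpq : d p q <= rho by apply: drho => //; apply: ltW.
have dqm : d q m <= rho by apply: drho => //; apply: ltW.
have lt_pi x y : d x y <= rho -> sK * d x y < pi.
  by move=> h; apply: le_lt_trans rhopi; rewrite ler_wpM2l.
have S1 : 0 < SyK (Yd p q) by apply: (Sy_Yd_gt0 K_ge0 dm); [exact: nesym|exact: lt_pi].
have S3 : 0 < SyK (Yd q m) by apply: (Sy_Yd_gt0 K_ge0 dm); [|exact: lt_pi].
have y1 : 0 < Yd p q by apply: md_gt0 => //; [exact: (dist_gt0 dm (nesym nqp))|exact/ltW/lt_pi].
have y3 : 0 < Yd q m by apply: md_gt0 => //; [exact: (dist_gt0 dm nqm)|exact/ltW/lt_pi].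
have defect s t : s < t -> t < s + L -> kappa * Yd (sigma s) (sigma t) <= SyK (Yd (sigma s) (sigma t)).
  move=> st ts; have Y0 := Yd_ge0 K d (sigma s) (sigma t).
  have lek k : 0 < k -> k < kappa -> k * Yd (sigma s) (sigma t) <= SyK (Yd (sigma s) (sigma t)).
    move=> k0 kk; apply: (base_defect K_ge0 dm lip inj period SA MC k0 kk st ts rhopi).
    by move=> u /andP[u1 u2]; apply: drho => //; apply: le_lt_trans ts.
  rewrite leNgt; apply/negP => lt.
  have Yp : 0 < Yd (sigma s) (sigma t).
    rewrite lt_neqAle Y0 andbT eq_sym; apply/eqP => e; move: lt; rewrite e mulr0.
    by rewrite ltNge sqrtr_ge0.
  set z := Yd _ _ in lt lek Yp; set S := SyK z in lt lek.
  have Sz : S / z < kappa by rewrite ltr_pdivrMr.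
  have S0 : 0 <= S / z by rewrite divr_ge0 ?sqrtr_ge0 // ltW.
  have := lek ((S / z + kappa) / 2).
  rewrite -ler_pdivlMr // => H; have kg := kappa_gt0.
  have : (S / z + kappa) / 2 <= S / z by apply: H; lra.
  lra.
have D1 := defect _ _ t12 t2L; have D3 := defect _ _ t23 t3L.
(* [kappa * y / SyK y] is the sine of the angle between chord and circle of curvature [kappa]. As
   [SyK y ^ 2 - (kappa * y) ^ 2] is the square of [Sy (K + kappa ^ 2) y], multiplying the cosine by
   [SyK y] passes to the model of curvature [K + kappa ^ 2]. *)
have Q y : 0 < y -> K * y <= 2 -> kappa * y <= SyK y -> 0 < SyK y ->
   [/\ 0 < kappa * y / SyK y, kappa * y / SyK y <= 1, SyK y * (kappa * y / SyK y) = kappa * y,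
     (K + kappa ^+ 2) * y <= 2 &
     SyK y * Num.sqrt (1 - (kappa * y / SyK y) ^+ 2) = Sy (K + kappa ^+ 2) y].
  move=> yp y2 D S.
  have ky : 0 < kappa * y by rewrite mulr_gt0.
  have sq : SyK y ^+ 2 = 2 * y - K * y ^+ 2 by apply: Sy_sqr => //; apply: ltW.
  split.
  - by rewrite divr_gt0.
  - by rewrite ler_pdivrMr // mul1r.
  - by rewrite mulrC divfK // gt_eqF.
  - move: D; rewrite -ler_sqr ?nnegrE ?(ltW ky) ?(ltW S) // sq exprMn => D.
    by rewrite -(ler_pM2r yp); lra.
  - rewrite -[X in X * _](ger0_norm (ltW S)) -sqrtr_sqr -sqrtrM ?sqr_ge0 //.
    rewrite /Sy; congr Num.sqrt; rewrite mulrBr mulr1 -exprMn [SyK y * _]mulrC divfK ?gt_eqF //.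
    by rewrite sq; ring.
have [b1 c1 e1 k1 f1] := Q _ y1 (Yd_le2 K_ge0 d p q) D1 S1.
have [b3 c3 e3 k3 f3] := Q _ y3 (Yd_le2 K_ge0 d q m) D3 S3.
have e3' : SyK (Yd m q) * (kappa * Yd q m / SyK (Yd q m)) = kappa * Yd m q by rewrite [Yd m q](YdC _ dm).
have S3' : 0 < SyK (Yd m q) by rewrite (YdC _ dm).
have sum := angle_sum_asin t12 t23 t31 rhopi drho per b1 c1 b3 c3 e1 e3' S1 S3'.
have per2 : sK * (d q p + d p m + d m q) < 2 * pi.
  by move: per; rewrite [d m p]dC [d q m]dC [d p q]dC; lra.
have r := pang_range K_ge0 dm nqp nqm per2.
have law := pang_law K_ge0 dm nqp nqm per2.
set x1 := kappa * _ / _ in b1 c1 e1 f1 sum; set x3 := kappa * _ / _ in b3 c3 e3 e3' f3 sum.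
have i1 : -1 <= x1 <= 1 by lra.
have i3 : -1 <= x3 <= 1 by lra.
have a1 := asin_geNpi2 i1; have a3 := asin_geNpi2 i3.
have a1' := asin_lepi2 i1; have a3' := asin_lepi2 i3.
have cs : - cos (asin x1 + asin x3) <= cos (pang q p m).
  have -> : - cos (asin x1 + asin x3) = cos (pi - (asin x1 + asin x3)).
    by rewrite cosB cospi sinpi; ring.
  have z1 := asin_gt0 b1 c1; have z3 := asin_gt0 b3 c3.
  by rewrite leNgt ltr_cos ?in_itv //=; lra.
rewrite cosD !cos_asin // !asinK ?in_itv // in cs.
apply: Del_ge0_longest; rewrite ?addr_ge0 ?sqr_ge0 ?(ltW y1) ?(ltW y3) //.
rewrite -f1 -f3 law [Yd q p](YdC _ dm).
have := ler_wpM2l (ltW (mulr_gt0 S1 S3)) cs.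
have g1 : SyK (Yd p q) * x1 * (SyK (Yd q m) * x3) = kappa ^+ 2 * Yd p q * Yd q m.
  by rewrite e1 e3; ring.
move: g1; lra.
Qed.

End Global.

Lemma circ_curvC13 (R : realType) (K a b c : R) : circ_curv K a b c = circ_curv K c b a.
Proof.
rewrite /circ_curv; move: (chord K a) (chord K b) (chord K c) => A B C.
by congr (Num.sqrt (_ / _ - _)); ring.
Qed.

Lemma Del_shift (R : realType) (K k a b c : R) :
  Del (K + k ^+ 2) a b c = Del K a b c - 2 * k ^+ 2 * a * b * c.
Proof. by rewrite /Del; ring. Qed.

Lemma circ_curv_ge (R : realType) (K k a b c : R) : 0 < k ->
  0 < md K a -> 0 < md K b -> 0 < md K c ->
  (k <= circ_curv K a b c) = (0 <= Del (K + k ^+ 2) (md K a) (md K b) (md K c)).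
Proof.
move=> k0 a0 b0 c0; rewrite circ_curvE // Del_shift subr_ge0.
have abc : 0 < 2 * md K a * md K b * md K c by apply: (mulr_gt0 _ c0); apply: (mulr_gt0 _ b0); apply: mulr_gt0.
have -> : 2 * k ^+ 2 * md K a * md K b * md K c = k ^+ 2 * (2 * md K a * md K b * md K c) by ring.
rewrite -ler_pdivlMr //; set Z := _ / _.
case: (leP 0 Z) => Z0.
  by rewrite -[X in _ = (_ <= X)](sqr_sqrtr Z0) ler_sqr ?nnegrE ?sqrtr_ge0 ?(ltW k0).
(* For negative [Z] the root is 0, which is below [k], and both sides are false. *)
rewrite ltr0_sqrtr // !leNgt k0 /=; apply/esym/negbTE; rewrite negbK.
by apply: lt_trans Z0 _; rewrite exprn_gt0.
Qed.

(** * All triangles of boundary points *)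

Section Bound.
Variables (R : realType) (K kappa : R) (X : Type) (d : X -> X -> R) (L : R) (sigma : R -> X).
Hypothesis K_ge0 : 0 <= K.
Hypothesis kappa_gt0 : 0 < kappa.
Hypothesis dm : is_metric d.
Hypothesis lip : forall s t, d (sigma s) (sigma t) <= `|s - t|.
Hypothesis inj : forall s t, s < t -> t < s + L -> sigma s <> sigma t.
Hypothesis period : forall t, sigma (t + L) = sigma t.
Hypothesis SA : cyclic_superadd K d L sigma.
Hypothesis MC : forall k, 0 < k -> k < kappa -> mostly_curved K k d sigma.
Local Notation sK := (Num.sqrt K).
Local Notation Yd := (Yd K d).

Let dC x y : d x y = d y x. Proof. by case: dm. Qed.
Let dxx x : d x x = 0. Proof. by case: dm => _ h _ _; apply/h. Qed.
Let s0 : 0 <= sK. Proof. exact: sqrtr_ge0. Qed.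

(** [Del_longest_side] wants the longest side opposite to the middle point; shifting parameters by
    [L] puts any of the three points in the middle. *)
Lemma Del_boundary_lt (t1 t2 t3 : R) : t1 < t2 -> t2 < t3 -> t3 < t1 + L ->
  sK * (d (sigma t1) (sigma t2) + d (sigma t2) (sigma t3) + d (sigma t3) (sigma t1)) < 2 * pi ->
  0 <= Del (K + kappa ^+ 2) (Yd (sigma t1) (sigma t2)) (Yd (sigma t2) (sigma t3)) (Yd (sigma t1) (sigma t3)).
Proof.
move=> t12 t23 t31 per.
have [rho rhopi drho] := boundary_diameter K_ge0 kappa_gt0 dm lip inj period SA MC.
have H u1 u2 u3 h1 h2 h3 :=
  @Del_longest_side R K kappa X d L sigma K_ge0 kappa_gt0 dm lip inj period SA MC u1 u2 u3 rho h1 h2 h3 rhopi drho.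
have t1L : t1 + L < t2 + L by rewrite ltrD2r.
have t2L : t2 + L < t3 + L by rewrite ltrD2r.
have := H t1 t2 t3 t12 t23 t31 per.
have := H t2 t3 (t1 + L) t23 t31 t1L; have := H t3 (t1 + L) (t2 + L) t31 t1L t2L; rewrite !period.
rewrite ![Yd (sigma t3) _](YdC _ dm) ![Yd (sigma t2) (sigma t1)](YdC _ dm).
rewrite [d (sigma t2) (sigma t3) + _ + _]addrC addrA.
rewrite [X in sK * X < _ -> _ -> _ -> 0 <= Del _ (Yd (sigma t1) (sigma t3)) _ _]addrC addrA.
rewrite [d (sigma t2) (sigma t3) + _ + _]addrC addrA.
set a := Yd _ (sigma t2); set b := Yd (sigma t2) (sigma t3); set c := Yd _ (sigma t3).
move=> /(_ per) Hb /(_ per) Ha Hc.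
case: (leP a c) => ac; case: (leP b c) => bc; first exact: Hc.
- by rewrite DelC23 DelC12; apply: Hb; [exact: ltW|exact: le_trans (ltW bc)].
- by rewrite DelC12 DelC23; apply: Ha; [exact: le_trans (ltW ac)|exact: ltW].
- case: (leP a b) => ab.
    by rewrite DelC23 DelC12; apply: Hb => //; exact: ltW.
  by rewrite DelC12 DelC23; apply: Ha; exact: ltW.
Qed.

(** The case of equality is contradictory. At the first [t] where the perimeter is a full great
    circle, [Del K] vanishes, so [Del (K + kappa ^ 2)] is negative there and, by continuity, shortly
    before; but shortly before the perimeter is smaller and [Del_boundary_lt] applies. *)
Lemma Del_boundary (t1 t2 t3 : R) : t1 < t2 -> t2 < t3 -> t3 < t1 + L ->
  sK * (d (sigma t1) (sigma t2) + d (sigma t2) (sigma t3) + d (sigma t3) (sigma t1)) <= 2 * pi ->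
  0 <= Del (K + kappa ^+ 2) (Yd (sigma t1) (sigma t2)) (Yd (sigma t2) (sigma t3)) (Yd (sigma t1) (sigma t3)).
Proof.
move=> t12 t23 t31; rewrite le_eqVlt => /orP[/eqP per|]; last exact: Del_boundary_lt.
have pp := pi_gt0 R.
have sp : 0 < sK.
  rewrite lt_neqAle s0 andbT eq_sym; apply/eqP => e; move: per; rewrite e mul0r; lra.
have [rho rhopi drho] := boundary_diameter K_ge0 kappa_gt0 dm lip inj period SA MC.
have lt_pi s t : s <= t -> t < s + L -> sK * d (sigma s) (sigma t) < pi.
  by move=> st tL; apply: le_lt_trans rhopi; rewrite ler_wpM2l // drho.
pose f t := sK * (d (sigma t1) (sigma t2) + d (sigma t2) (sigma t) + d (sigma t1) (sigma t)).
have cd x := @dist_sigma_continuous R X d sigma dm lip x.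
have cf : continuous f.
  move=> t; apply: cvgM; first exact: cvg_cst.
  by apply: cvgD; [apply: cvgD; [exact: cvg_cst|exact: cd]|exact: cd].
have t2L : t2 < t1 + L := lt_trans t23 t31.
have f2 : f t2 < 2 * pi by rewrite /f dxx addr0; have := lt_pi _ _ (ltW t12) t2L; lra.
have f3 : 2 * pi <= f t3 by rewrite /f -per [d (sigma t1) (sigma t3)]dC.
have [t [t2t tt3 ft flt]] := first_hit cf (ltW t23) f2 f3.
have tL : t < t1 + L := le_lt_trans tt3 t31.
have tL2 : t < t2 + L by apply: lt_trans tL _; rewrite ltrD2r.
have t1t : t1 < t := lt_trans t12 t2t.
have Yp s u : s < u -> u < s + L -> 0 < Yd (sigma s) (sigma u).
  move=> su uL; apply: md_gt0 => //; first by apply: (dist_gt0 dm); apply: inj.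
  by apply: ltW; apply: lt_pi => //; apply: ltW.
have Y12 := Yp _ _ t12 t2L; have Y2t := Yp _ _ t2t tL2; have Y1t := Yp _ _ t1t tL.
have D0 := Del_full_perimeter K_ge0 sp ft.
pose F u := 2 * kappa ^+ 2 * Yd (sigma t2) (sigma u) * Yd (sigma t1) (sigma u) * Yd (sigma t1) (sigma t2)
  - Del K (Yd (sigma t2) (sigma u)) (Yd (sigma t1) (sigma u)) (Yd (sigma t1) (sigma t2)).
have cY x := @Yd_sigma_continuous R K X d sigma K_ge0 dm lip x.
have cF : {for t, continuous F} by apply: defect_continuous_at; exact: cY.
have FE u : F u = - Del (K + kappa ^+ 2) (Yd (sigma t1) (sigma t2)) (Yd (sigma t2) (sigma u)) (Yd (sigma t1) (sigma u)).
  by rewrite /F Del_shift [Del K (Yd (sigma t2) (sigma u)) _ _]DelC23 [Del K (Yd (sigma t2) (sigma u)) _ _]DelC12; ring.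
have Ft : 0 < F t.
  rewrite FE Del_shift D0 sub0r opprK; do !apply: mulr_gt0 => //.
have /nbhs_ballP[e /= e0 H] : \forall u \near t, 0 < F u by exact: (cvgr_gt _ cF _ Ft).
pose u := Num.max ((t2 + t) / 2) (t - e / 2).
have u2 : t2 < u by rewrite lt_max; apply/orP; left; lra.
have ut : u < t by rewrite gt_max; apply/andP; split; lra.
have ue : t - e / 2 <= u by rewrite le_max lexx orbT.
have : 0 < F u by apply: H; rewrite /ball /= gtr0_norm; lra.
rewrite FE oppr_gt0 ltNge => /negP; case.
apply: Del_boundary_lt => //; first exact: lt_trans tL.
by have := flt _ (ltW u2) ut; rewrite /f [d (sigma u) _]dC.
Qed.

Lemma chiK_boundary (t1 t2 t3 : R) : t1 < t2 -> t2 < t3 -> t3 < t1 + L ->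
  sK * (d (sigma t1) (sigma t2) + d (sigma t2) (sigma t3) + d (sigma t3) (sigma t1)) <= 2 * pi ->
  kappa <= chiK d K (sigma t1) (sigma t2) (sigma t3).
Proof.
move=> t12 t23 t31 per.
have [rho rhopi drho] := boundary_diameter K_ge0 kappa_gt0 dm lip inj period SA MC.
have Yp s u : s < u -> u < s + L -> 0 < Yd (sigma s) (sigma u).
  move=> su uL; apply: md_gt0 => //; first by apply: (dist_gt0 dm); apply: inj.
  by apply: ltW; apply: le_lt_trans rhopi; rewrite ler_wpM2l // drho // ltW.
have t2L : t2 < t1 + L := lt_trans t23 t31.
have t3L : t3 < t2 + L by apply: lt_trans t31 _; rewrite ltrD2r.
rewrite /chiK [d (sigma t3) _]dC circ_curv_ge //; try exact: Yp.
  exact: Del_boundary.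
exact: Yp (lt_trans t12 t23) t31.
Qed.

End Bound.

(** * Back to the notions of the theorem *)

Section Boundary.
Variables (R : realType) (K : R) (X : Type) (d : X -> X -> R) (h : R * R -> X).
Variables (L : R) (sigma : R -> X).
Hypothesis K_ge0 : 0 <= K.
Hypothesis alex : alexandrov d K.
Hypothesis hd : homeo_disk d h.
Hypothesis ap : arclength_param d (h @` (@ucircle R)) L sigma.
Local Notation sK := (Num.sqrt K).

Let dm : is_metric d. Proof. by case: alex. Qed.
Let dC x y : d x y = d y x. Proof. by case: dm. Qed.
Let s0 : 0 <= sK. Proof. exact: sqrtr_ge0. Qed.
Let lip := sigma_lip dm ap.
Let inj := @sigma_inj _ _ _ _ _ _ ap.
Let period t : sigma (t + L) = sigma t. Proof. by case: ap. Qed.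

Lemma boundary_superadd : cyclic_superadd K d L sigma.
Proof.
case: alex => _ mid cv t0 t1 t2 t3 t01 t12 t23 t3L.
have [z [z1 z2]] := boundary_cross dm mid hd ap t01 t12 t23 t3L.
apply: (pang_superadd K_ge0 dm cv) z1 z2; apply: inj; lra.
Qed.

Lemma small_boundary_triangles : exists2 del, 0 < del & forall s t u,
  t - del < s -> s < t -> t < u -> u < t + del ->
  [/\ sigma s <> sigma t, sigma t <> sigma u & sigma s <> sigma u] /\
  [/\ sK * d (sigma s) (sigma t) <= pi / 2, sK * d (sigma t) (sigma u) <= pi / 2 &
      sK * d (sigma s) (sigma u) <= pi].
Proof.
have L0 := L_gt0 ap; have pp := pi_gt0 R.
have [|del del0 H] := @small_scale R [:: (2 * sK, pi); (2, L)]; first by rewrite /= pp L0.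
exists del => // s t u s1 s2 u1 u2.
have := H del (ltW del0) (lexx _) => /= /and3P[q1 q2 _].
split; first by split; apply: inj; lra.
have d1 : d (sigma s) (sigma t) <= del.
  by apply: le_trans (lip _ _) _; rewrite distrC gtr0_norm ?subr_gt0 //; lra.
have d2 : d (sigma t) (sigma u) <= del.
  by apply: le_trans (lip _ _) _; rewrite distrC gtr0_norm ?subr_gt0 //; lra.
have d3 : d (sigma s) (sigma u) <= 2 * del.
  by apply: le_trans (lip _ _) _; rewrite distrC gtr0_norm ?subr_gt0 //; lra.
by have := ler_wpM2l s0 d1; have := ler_wpM2l s0 d2; have := ler_wpM2l s0 d3; split; lra.
Qed.

Lemma lower_chi_curved_at (kappa k t : R) : 0 < k -> k < kappa ->
  lower_chi_ge d K sigma t kappa -> exists2 del, 0 < del & curved_at K k d sigma del t.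
Proof.
move=> k0 kk lc; have pp := pi_gt0 R.
(* The gap between [k] and [kappa] is spent on the tolerance of the lower limit. *)
have [|d1 d10 H1] := lc (kappa - k); first by rewrite subr_gt0.
have [d2 d20 H2] := small_boundary_triangles.
exists (Num.min d1 d2); first by rewrite lt_min d10.
have m1 : Num.min d1 d2 <= d1 by rewrite ge_min lexx.
have m2 : Num.min d1 d2 <= d2 by rewrite ge_min lexx orbT.
move: (Num.min d1 d2) m1 m2 => del m1 m2 s u h1 h2 h3 h4.
have [||[n1 n2 n3] [p1 p2 p3]] := H2 s t u _ h2 h3; try lra.
have := H1 s u; rewrite subKr /chiK [d (sigma u) _]dC circ_curv_ge //;
  try by apply: md_gt0; [by []|exact: dist_gt0|lra].
by rewrite Del_shift subr_ge0; apply; lra.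
Qed.

Lemma global_chi_of_ae (kappa : R) : 0 < kappa ->
  {ae (@lebesgue_measure R), forall t, lower_chi_ge d K sigma t kappa} ->
  global_chi_ge d K (h @` (@ucircle R)) kappa.
Proof.
move=> kappa0 ae p q m Bp Bq Bm pq qm pm per.
have MC k : 0 < k -> k < kappa -> mostly_curved K k d sigma.
  move=> k0 kk; apply: (mostly_curved_ae K_ge0 dm lip).
  by apply: (negligibleS _ ae) => t; apply: contra_not; exact: lower_chi_curved_at.
have {}per : sK * (d p q + d q m + d m p) <= 2 * pi.
  have pp := pi_gt0 R.
  case: (ltP 0 sK) => [sp|sn]; first by rewrite mulrC -ler_pdivlMr // per // -sqrtr_gt0.
  have -> : sK = 0 by apply/eqP; rewrite eq_le sn s0.
  by rewrite mul0r mulr_ge0 // ltW.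
case: (ap) => _ _ _ rg _; rewrite -rg in Bp Bq Bm.
case: Bp Bq Bm => t1 _ e1 [t2' _ e2] [t3' _ e3].
have [t2 /andP[a2 b2] f2] := sigma_shift ap t1 t2'; have [t3 /andP[a3 b3] f3] := sigma_shift ap t1 t3'.
rewrite -e1 -e2 -e3 -f2 -f3 in pq qm pm per *.
have l2 : t1 < t2 by rewrite lt_neqAle a2 andbT; apply/eqP => e; apply: pq; rewrite e.
have l3 : t1 < t3 by rewrite lt_neqAle a3 andbT; apply/eqP => e; apply: pm; rewrite e.
have C := chiK_boundary K_ge0 kappa0 dm lip inj period boundary_superadd MC.
case: (ltgtP t2 t3) => [l|l|e]; first exact: C.
  (* The three points come in the opposite cyclic order; [circ_curv] does not depend on it. *)
  have := C _ _ _ l3 l b2; rewrite /chiK circ_curvC13.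
  rewrite [d (sigma t2) (sigma t1)]dC [d (sigma t3) (sigma t2)]dC [d (sigma t1) (sigma t3)]dC; apply.
  by move: per; lra.
by case: qm; rewrite e.
Qed.

Lemma lower_chi_of_global (kappa t : R) :
  global_chi_ge d K (h @` (@ucircle R)) kappa -> lower_chi_ge d K sigma t kappa.
Proof.
move=> gl e e0; have [del del0 H] := small_boundary_triangles.
exists del => // s u h1 h2 h3 h4; have [[n1 n2 n3] [p1 p2 p3]] := H s t u h1 h2 h3 h4.
apply: (@le_trans _ _ kappa); first by rewrite gerBl ltW.
have B v : (h @` (@ucircle R)) (sigma v) by case: (ap) => _ _ _ <- _; exists v.
apply: gl => // Kp; have sp : 0 < sK by rewrite sqrtr_gt0.
by rewrite ler_pdivlMr // mulrC [d (sigma u) _]dC; lra.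
Qed.

End Boundary.

Theorem theorem5p2 (R : realType) (X : Type) (d : X -> X -> R) (K kappa : R)
  (h : R * R -> X) (L : R) (sigma : R -> X) :
  0 <= K -> alexandrov d K -> homeo_disk d h -> rectifiable_boundary d h ->
  arclength_param d (h @` (@ucircle R)) L sigma -> 0 <= kappa ->
  ({ae (@lebesgue_measure R), forall t, lower_chi_ge d K sigma t kappa}
   <-> global_chi_ge d K (h @` (@ucircle R)) kappa).
Proof.
move=> K0 alex hd _ ap; rewrite le_eqVlt => /orP[/eqP <-|kappa0]; split.
(* For [kappa = 0] the global bound always holds, [circ_curv] being a square root. *)
- by move=> _ p q m *; exact: sqrtr_ge0.
- by move=> gl; apply: aeW => t; exact: (lower_chi_of_global alex ap).
- exact: (global_chi_of_ae K0 alex hd ap).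
- by move=> gl; apply: aeW => t; exact: (lower_chi_of_global alex ap).
Qed.
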